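(* Let $\theta_0,\sigma_0^2>0$ and let $Y$ be a centered Gaussian process on $[0,1]$ with covariance function $\sigma_0^2 e^{-\theta_0|t_1-t_2|}$. For each $n$ let $0=s_1<\dots<s_n=1$ be a design (depending on $n$), with $\Delta_i=s_i-s_{i-1}$, and assume $\limsup_{n\to\infty}\max_{i=2,\dots,n}\Delta_i=0$. Let $0<a\le A<\infty$, $0<b\le B<\infty$ and $J=[a,A]\times[b,B]$, and assume that there exists $(\tilde\theta,\tilde\sigma^2)\in J$ with $\tilde\theta\tilde\sigma^2=\theta_0\sigma_0^2$. Let $S_n(\theta,\sigma^2)$ be the leave-one-out logarithmic score defined in the context, and let $(\hat\theta,\hat\sigma^2)\in J$ be a minimizer of $S_n$ over $J$. Assume further that either [$aB<\theta_0\sigma_0^2$ and $Ab>\theta_0\sigma_0^2$] or [$aB>\theta_0\sigma_0^2$ and $Ab<\theta_0\sigma_0^2$]. Let $$\tau_n^2=\frac{2}{n}\sum_{i=3}^{n-1}\left[\left(\frac{\Delta_{i+1}}{\Delta_i+\Delta_{i+1}}+\frac{\Delta_{i-1}}{\Delta_i+\Delta_{i-1}}\right)^2+2\,\frac{\Delta_i\Delta_{i+1}}{(\Delta_i+\Delta_{i+1})^2}\right],\qquad \tau_n=\sqrt{\tau_n^2}.$$ Then $$\frac{\sqrt n}{\theta_0\sigma_0^2\tau_n}\bigl(\hat\theta\hat\sigma^2-\theta_0\sigma_0^2\bigr)\xrightarrow[n\to\infty]{\mathcal D}\mathcal N(0,1).$$ Also, if $\sigma_1^2>0$ is a predetermined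 constant with $\theta_1:=\sigma_0^2\theta_0/\sigma_1^2\in(a,A)$ and $\hat\theta_1\in[a,A]$ is a minimizer of $\theta\mapsto S_n(\theta,\sigma_1^2)$ over $[a,A]$, then $$\frac{\sqrt n}{\theta_1\tau_n}(\hat\theta_1-\theta_1)\xrightarrow[n\to\infty]{\mathcal D}\mathcal N(0,1).$$ Finally, if $\theta_2>0$ is a predetermined constant with $\sigma_2^2:=\sigma_0^2\theta_0/\theta_2\in(b,B)$ and $\hat\sigma_2^2\in[b,B]$ is a minimizer of $\sigma^2\mapsto S_n(\theta_2,\sigma^2)$ over $[b,B]$, then $$\frac{\sqrt n}{\sigma_2^2\tau_n}(\hat\sigma_2^2-\sigma_2^2)\xrightarrow[n\to\infty]{\mathcal D}\mathcal N(0,1).$$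
   Context: The design points $s_i$ and spacings $\Delta_i$ form triangular arrays (dependence on $n$ is not written; designs need not be nested). The observations are $y_i=Y(s_i)$, $i=1,\dots,n$, from one fixed process $Y$. Minimizers are understood as random variables (measurable choices). $\xrightarrow{\mathcal D}$ denotes convergence in distribution. For $\theta>0$, let $R_\theta=[e^{-\theta|s_i-s_j|}]_{1\le i,j\le n}$. For each $i$, let $R_{\theta,-i}$ be $R_\theta$ with row and column $i$ removed, $r_{\theta,-i}$ the vector $(e^{-\theta|s_i-s_j|})_{j\ne i}$ and $y_{-i}=(y_j)_{j\neq i}$. Define the leave-one-out conditional mean and variance of $y_i$ given $y_{-i}$, computed as if $Y$ were a centered Gaussian process with covariance $\sigma^2e^{-\theta|t_1-t_2|}$: $$\hat Y_{\theta,-i}(s_i)=r_{\theta,-i}'R_{\theta,-i}^{-1}y_{-i},\qquad \hat\sigma^2_{\theta,\sigma^2,-i}(s_i)=\sigma^2\bigl(1-r_{\theta,-i}'R_{\theta,-i}^{-1}r_{\theta,-i}\bigr).$$ The logarithmic score is $$S_n(\theta,\sigma^2)=\sum_{i=1}^n\left[\log\bigl(\hat\sigma^2_{\theta,\sigma^2,-i}(s_i)\bigr)+\frac{(y_i-\hat Y_{\theta,-i}(s_i))^2}{\hat\sigma^2_{\theta,\sigma^2,-i}(s_i)}\right].$$ *)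

(* Defs.v *)
From HB Require Import structures.
From mathcomp Require Import all_boot all_order all_algebra.
From mathcomp Require Import all_classical all_reals all_analysis.

Set Implicit Arguments.
Unset Strict Implicit.
Unset Printing Implicit Defensive.

Import Order.TTheory GRing.Theory Num.Theory.
Import numFieldNormedType.Exports.

Local Open Scope classical_set_scope.
Local Open Scope ring_scope.

(* The degenerate law is listed separately because [normal_prob m 0] is, by the
   library's convention, the uniform law on [0, 1] and not the Dirac mass. *)
Definition gaussian_law (R : realType) (mu : set R -> \bar R) : Prop :=
  (exists m s : R, 0 < s /\
     forall A : set R, measurable A -> mu A = normal_prob m s A) \/
  (exists m : R, forall A : set R, measurable A -> mu A = \d_m A).

(* Only the times in [D] matter; the values of [Y] outside [D] are junk. *)
Definition gaussian_process (R : realType) (d : measure_display)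
    (T : measurableType d) (P : probability T R) (D : set R)
    (Y : R -> {RV P >-> R}) : Prop :=
  forall (k : nat) (t c : 'I_k -> R), (forall i, D (t i)) ->
    gaussian_law (pushforward P (fun w => \sum_(i < k) c i * Y (t i) w)).

Definition centered_on (R : realType) (d : measure_display)
    (T : measurableType d) (P : probability T R) (D : set R)
    (Y : R -> {RV P >-> R}) : Prop :=
  forall t, D t -> ('E_P[Y t] = 0)%E.

Definition covariance_function_on (R : realType) (d : measure_display)
    (T : measurableType d) (P : probability T R) (D : set R)
    (Y : R -> {RV P >-> R}) (K : R -> R -> R) : Prop :=
  forall t1 t2, D t1 -> D t2 -> covariance P (Y t1) (Y t2) = (K t1 t2)%:E.

(* Pointwise convergence of the distribution functions at the continuity points
   of the limiting one. *)
Definition cvg_in_distribution (R : realType) (d : measure_display)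
    (T : measurableType d) (P : probability T R)
    (X : nat -> T -> R) (mu : set R -> \bar R) : Prop :=
  forall x : R,
    {for x, continuous (fun r : R => fine (mu `]-oo, r]%classic))} ->
    (fun n => P [set w | X n w <= x]) @ \oo --> mu `]-oo, x]%classic.

Definition is_minimizer (R : realType) (U : Type) (D : set U) (f : U -> R)
    (x : U) : Prop :=
  D x /\ forall z, D z -> f x <= f z.

(* The design of size [n] is [s 1 < ... < s n]; other values of [s] are
   irrelevant. *)
Definition is_design (R : realType) (n : nat) (s : nat -> R) : Prop :=
  [/\ s 1%N = 0, s n = 1 &
      forall i, (1 <= i < n)%N -> s i < s i.+1].

Definition spacing (R : realType) (s : nat -> R) (i : nat) : R :=
  s i - s i.-1.

(* The spacings of a design are positive, so the neutral element 0 is harmless. *)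
Definition max_spacing (R : realType) (n : nat) (s : nat -> R) : R :=
  \big[Num.max/0]_(2 <= i < n.+1) spacing s i.

Definition tau2 (R : realType) (n : nat) (s : nat -> R) : R :=
  let D := spacing s in
  2 / n%:R * \sum_(3 <= i < n)
    ((D i.+1 / (D i + D i.+1) + D i.-1 / (D i + D i.-1)) ^+ 2
     + 2 * (D i * D i.+1 / (D i + D i.+1) ^+ 2)).

Definition tau (R : realType) (n : nat) (s : nat -> R) : R :=
  Num.sqrt (tau2 n s).

(* Row and column [i : 'I_n] correspond to the design point [s i.+1]. *)
Definition corr_mx (R : realType) (n : nat) (s : nat -> R) (theta : R)
    : 'M[R]_n :=
  \matrix_(i < n, j < n) expR (- theta * `|s i.+1 - s j.+1|).

Definition loo_corr_mx (R : realType) (n : nat) (s : nat -> R) (theta : R)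
    (i : 'I_n) : 'M[R]_n.-1 :=
  row' i (col' i (corr_mx n s theta)).

Definition loo_corr_col (R : realType) (n : nat) (s : nat -> R) (theta : R)
    (i : 'I_n) : 'cV[R]_n.-1 :=
  (col' i (row i (corr_mx n s theta)))^T.

Definition loo_obs (R : realType) (n : nat) (y : nat -> R) (i : 'I_n)
    : 'cV[R]_n.-1 :=
  row' i (\col_(j < n) y j.+1).

Definition loo_mean (R : realType) (n : nat) (s y : nat -> R) (theta : R)
    (i : 'I_n) : R :=
  ((loo_corr_col s theta i)^T *m invmx (loo_corr_mx s theta i)
     *m loo_obs y i) ord0 ord0.

Definition loo_var (R : realType) (n : nat) (s : nat -> R) (theta sigma2 : R)
    (i : 'I_n) : R :=
  sigma2 * (1 - ((loo_corr_col s theta i)^T *m invmx (loo_corr_mx s theta i)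
                   *m loo_corr_col s theta i) ord0 ord0).

Definition log_score (R : realType) (n : nat) (s y : nat -> R)
    (theta sigma2 : R) : R :=
  \sum_(i < n) (ln (loo_var s theta sigma2 i)
    + (y i.+1 - loo_mean s y theta i) ^+ 2 / loo_var s theta sigma2 i).

(* Main.v *)
(* The precision matrix of the exponential kernel at [n] points is tridiagonal,
   with entries in [coth] and [csch] of the scaled spacings.  The leave-one-out
   residuals are [prec_app / prec_diag], their variances [sigma2 / prec_diag],
   and as the spacings tend to 0 these depend on [theta] only through a factor
   [theta].  Hence, with [x = theta * sigma2],
     [S_n = n ln x + (sum_i G_i) / x + const + o_P(1)]
   uniformly in the parameters, where [G_i] is free of them.  Since
   [t - 1 - ln t] dominates a multiple of [(t - 1)^2] for bounded [t], any minimizer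
   satisfies [x = (sum_i G_i) / n + o_P(n^(-1/2))] as soon as that mean lies in
   the range of [x], so all three estimators are treated at once.

   At the true [theta0] the sum is [x0] times [sum_i e_i^2] up to [o_P(1)], with
   [e_i] jointly Gaussian of unit variance and correlated only with their two
   neighbours.  By Gaussian integration by parts the moments of
   [c * sum_i (e_i^2 - 1)], normalized to variance 1, satisfy
   [m_(k+2) = (k+1) m_k + o(1)], which gives the limit by the method of moments.
   Finally [2 * sum_(i, j) E[e_i e_j]^2 = n tau_n^2 (1 + o(1))]: writing
   [a_i = D_(i+1) / (D_i + D_(i+1))], the [i]-th term of [tau_n^2] is
   [1 - (1 - a_i)^2 + (1 - a_(i-1))^2 + 2 (1 - a_(i-1)) a_i], where the middle
   terms telescope and [(1 - a_(i-1)) a_i] is the limiting squared correlation. *)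
Require Import Defs.
From HB Require Import structures.
From mathcomp Require Import all_boot all_order all_algebra.
From mathcomp Require Import all_classical all_reals all_analysis.
From mathcomp Require Import measurable_realfun.
From mathcomp Require Import ring lra zify.

Set Implicit Arguments.
Unset Strict Implicit.
Unset Printing Implicit Defensive.

Import Order.TTheory GRing.Theory Num.Theory.
Import numFieldNormedType.Exports.

Local Open Scope classical_set_scope.
Local Open Scope ring_scope.

(** * Expectation and moments *)

(** No rate links the mesh to [n], so an error of the order of the gap at each node is affordable
    only because the gaps sum to 1: errors are weighted by [node_err], whose sum is a constant
    whatever [n]. The smallness comes from [r], the square root of the mesh, which balances the
    observations (of size 1) against their increments (of mean square [r^2]).

    Gaussianity enters through moments only. Every linear combination satisfies the moment recursion
    of a centered normal law; the linear coefficient in [t] of that recursion for [f + t g] yields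
    Stein's and Wick's formulas, with no joint density and no differentiation under the integral.
    Degenerate laws obey the same recursion.

    Moments become distribution functions in two moves: Taylor's formula for the cosine gives
    convergence of the expectations of trigonometric polynomials, and these approximate a step on a
    bounded interval while staying in [0, 1] on the whole line, so that Chebyshev's inequality
    handles the rest.

    On the event that the remainder is small and the fluctuation bounded, the estimate of the
    minimizer is deterministic. *)

Section Expectation.
Context {d : measure_display} {T : measurableType d} {R : realType}.
Variable P : probability T R.
Implicit Types (f g : T -> R) (c : R).

(** Finiteness of all moments is stable under products as well as sums, which integrability is not;
    every integrability side condition below reduces to this predicate. *)
Definition allmom f := measurable_fun setT f /\
  forall k, P.-integrable setT (fun w => (f w ^+ k)%:E).

Definition Ex f : R := Rintegral P setT f.

Lemma allmom_meas f : allmom f -> measurable_fun setT f.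
Proof. by case. Qed.

Lemma allmom_int f : allmom f -> P.-integrable setT (EFin \o f).
Proof. by move=> [_ /(_ 1%N)]. Qed.

Lemma allmom_intN f k : allmom f -> P.-integrable setT (fun w => (`|f w| ^+ k)%:E).
Proof.
move=> [mf /(_ k) fk]; apply: eq_integrable (integrable_abse fk) => // w _ /=.
by rewrite normrX.
Qed.

Lemma allmom_dom f g : measurable_fun setT g -> allmom f ->
  (forall w, `|g w| <= `|f w|) -> allmom g.
Proof.
move=> mg af gf; split => // k.
apply: (le_integrable measurableT _ _ (allmom_intN k af)).
  by apply/measurable_EFinP; exact: measurable_funX.
move=> w _ /=; rewrite lee_fin normrX (ger0_norm (exprn_ge0 _ _))//.
by rewrite lerXn2r ?nnegrE.
Qed.

Lemma allmom_cst c : allmom (fun=> c).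
Proof.
split=> [|k]; first exact: measurable_cst.
exact: (@finite_measure_integrable_cst _ _ _ P setT (c ^+ k)).
Qed.

Lemma allmomD f g : allmom f -> allmom g -> allmom (fun w => f w + g w).
Proof.
move=> af ag.
have mfg : measurable_fun setT (fun w => f w + g w).
  by apply: measurable_funD; exact: allmom_meas.
split=> // k.
have := integrableD measurableT
  (integrableZl measurableT (2 ^+ k) (allmom_intN k af))
  (integrableZl measurableT (2 ^+ k) (allmom_intN k ag)).
apply: le_integrable => //; first by apply/measurable_EFinP; exact: measurable_funX.
move=> w _; rewrite /= lee_fin normrX -mulrDr.
rewrite (ger0_norm (mulr_ge0 _ _)) ?exprn_ge0 ?addr_ge0 ?exprn_ge0//.
have h0 : `|f w + g w| <= 2 * Num.max `|f w| `|g w|.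
  rewrite (le_trans (ler_normD _ _))// mulr_natl mulr2n lerD// le_max lexx ?orbT//.
apply: (@le_trans _ _ ((2 * Num.max `|f w| `|g w|) ^+ k)).
  by rewrite lerXn2r ?nnegrE// mulr_ge0// le_max normr_ge0.
rewrite exprMn ler_wpM2l ?exprn_ge0//.
by rewrite /Num.max; case: ifP => _; rewrite ?lerDr ?lerDl exprn_ge0.
Qed.

Lemma allmomM f g : allmom f -> allmom g -> allmom (fun w => f w * g w).
Proof.
move=> af ag.
have mfg : measurable_fun setT (fun w => f w * g w).
  by apply: measurable_funM; exact: allmom_meas.
split=> // k.
have := integrableD measurableT (allmom_intN (k + k) af) (allmom_intN (k + k) ag).
apply: le_integrable => //; first by apply/measurable_EFinP; exact: measurable_funX.
move=> w _ /=; rewrite lee_fin !exprD -!expr2 normrX normrM exprMn.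
set a := `|f w| ^+ k; set b := `|g w| ^+ k.
have a0 : 0 <= a by rewrite exprn_ge0.
have b0 : 0 <= b by rewrite exprn_ge0.
rewrite ger0_norm ?addr_ge0 ?sqr_ge0//.
nra.
Qed.

Lemma allmomZ c f : allmom f -> allmom (fun w => c * f w).
Proof. by apply: allmomM; exact: allmom_cst. Qed.

Lemma allmomB f g : allmom f -> allmom g -> allmom (fun w => f w - g w).
Proof.
move=> af ag; have := allmomD af (allmomZ (-1) ag).
by congr allmom; apply/funext => w; rewrite mulN1r.
Qed.

Lemma allmomX f k : allmom f -> allmom (fun w => f w ^+ k).
Proof.
move=> af; elim: k => [|k IH]; first exact: allmom_cst.
have := allmomM af IH.
by congr allmom; apply/funext => w; rewrite exprS.
Qed.

Lemma allmom_norm f : allmom f -> allmom (fun w => `|f w|).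
Proof.
move=> af; apply: (allmom_dom _ af); last by move=> w; rewrite normr_id.
by apply: measurableT_comp => //; exact: allmom_meas.
Qed.

Lemma allmom_sum (I : Type) (r : seq I) (Q : pred I) (F : I -> T -> R) :
  (forall i, Q i -> allmom (F i)) -> allmom (fun w => \sum_(i <- r | Q i) F i w).
Proof.
move=> aF; elim: r => [|i r IH].
  have := allmom_cst 0; congr allmom; apply/funext => w.
  by rewrite big_nil.
have [Qi|Qi] := boolP (Q i).
  have := allmomD (aF _ Qi) IH; congr allmom; apply/funext => w.
  by rewrite big_cons Qi.
by move: IH; congr allmom; apply/funext => w; rewrite big_cons (negbTE Qi).
Qed.

Lemma allmom_prod (l : seq (T -> R)) :
  List.Forall allmom l -> allmom (fun w => \prod_(f <- l) f w).
Proof.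
elim => [|f {}l af _ IH].
  by have := allmom_cst 1; congr allmom; apply/funext => w; rewrite big_nil.
by have := allmomM af IH; congr allmom; apply/funext => w; rewrite big_cons.
Qed.

Lemma Ex_ext f g : (forall w, f w = g w) -> Ex f = Ex g.
Proof. by move=> /funext ->. Qed.

Lemma Ex_cst c : Ex (fun=> c) = c.
Proof. by rewrite /Ex Rintegral_cst//= probability_setT/= mulr1. Qed.

Lemma ExD f g : allmom f -> allmom g -> Ex (fun w => f w + g w) = Ex f + Ex g.
Proof. by move=> af ag; rewrite /Ex RintegralD//; exact: allmom_int. Qed.

Lemma ExZ c f : allmom f -> Ex (fun w => c * f w) = c * Ex f.
Proof. by move=> af; rewrite /Ex RintegralZl//; exact: allmom_int. Qed.

Lemma ExB f g : allmom f -> allmom g -> Ex (fun w => f w - g w) = Ex f - Ex g.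
Proof. by move=> af ag; rewrite /Ex RintegralB//; exact: allmom_int. Qed.

Lemma Ex_sum (I : Type) (r : seq I) (Q : pred I) (F : I -> T -> R) :
  (forall i, Q i -> allmom (F i)) ->
  Ex (fun w => \sum_(i <- r | Q i) F i w) = \sum_(i <- r | Q i) Ex (F i).
Proof.
move=> aF; elim: r => [|i r IH].
  by rewrite big_nil -[RHS](Ex_cst 0); apply: Ex_ext => w; rewrite big_nil.
rewrite big_cons; have [Qi|Qi] := boolP (Q i).
  rewrite -IH -ExD; [|exact: aF|exact: allmom_sum].
  by apply: Ex_ext => w; rewrite big_cons Qi.
by rewrite -IH; apply: Ex_ext => w; rewrite big_cons (negbTE Qi).
Qed.

Lemma Ex_ge0 f : (forall w, 0 <= f w) -> 0 <= Ex f.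
Proof. by move=> f0; apply: Rintegral_ge0 => w _. Qed.

Lemma Ex_le f g : allmom f -> allmom g -> (forall w, f w <= g w) -> Ex f <= Ex g.
Proof. by move=> af ag fg; apply: le_Rintegral => //; exact: allmom_int. Qed.

Lemma Ex_norm f : allmom f -> `|Ex f| <= Ex (fun w => `|f w|).
Proof. by move=> af; apply: le_normr_Rintegral => //; exact: allmom_int. Qed.

Lemma markov_Ex f (e : R) : measurable_fun setT f -> P.-integrable setT (EFin \o f) ->
  (forall w, 0 <= f w) -> 0 < e ->
  (P [set w | (e <= f w)%R] <= (Ex f / e)%:E)%E.
Proof.
move=> mf intf f0 e0.
have mE : measurable [set w | e <= f w].
  rewrite -[X in measurable X]setTI.
  have := mf measurableT _ (measurable_itv `[e, +oo[).
  by congr measurable; apply/seteqP; split => w /=; rewrite in_itv/= andbT.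
have -> : (Ex f / e)%:E = (\int[P]_w (f w / e)%:E)%E.
  have -> : Ex f / e = Rintegral P setT (fun w => f w / e).
    by rewrite RintegralZr.
  rewrite /Rintegral fineK// integrable_fin_num//.
  have := integrableZl measurableT e^-1 intf.
  by apply: eq_integrable => // w _ /=; rewrite mulrC.
rewrite -[X in P X]setIT -integral_indic//.
apply: ge0_le_integral => //.
- exact/measurable_EFinP/measurable_indic.
- by apply/measurable_EFinP; apply: measurable_funM.
- move=> w _; rewrite lee_fin indicE; case: (boolP (w \in _)) => [|_]; last by rewrite divr_ge0// ltW.
  by rewrite inE/= => ew; rewrite ler_pdivlMr// mul1r.
Qed.

End Expectation.

Ltac allmom_solve := repeat first
  [ solve [auto 3] | exact: allmom_cst | apply: allmomB | apply: allmomD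
  | apply: allmomM | apply: allmomX | (apply: allmom_sum => ? _)
  | apply: allmom_norm ].

(** * Moment recursion of the normal density *)

Section NormalMoments.
Context {R : realType}.
Local Notation mu := (@lebesgue_measure R).

Let scE (a b : R) : a *: (b : R^o) = a * b. Proof. by []. Qed.

Lemma pow_le_expR (j : nat) (y : R) : 0 <= y -> y ^+ j <= j`!%:R * expR y.
Proof.
case: j => [|j] y0; first by rewrite expr0 fact0 mul1r -expR0 ler_expR.
rewrite mulrC -ler_pdivrMr ?ltr0n ?fact_gt0//.
by rewrite (le_trans _ (expR_ge1Dxn j y0))// lerDr.
Qed.

Lemma absX_le_expR (k : nat) (c : R) : 0 < c ->
  (* The constant comes from [|x|^k <= 1 + x^(2k)] and [(c x^2)^k <= k! e^(c x^2)]. *)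
  exists C : R, 0 < C /\ forall x : R, `|x| ^+ k <= C * expR (c * x ^+ 2).
Proof.
move=> c0; exists (1 + c^-1 ^+ k * k`!%:R); split.
  by rewrite ltr_pwDl// mulr_ge0// exprn_ge0// invr_ge0 ltW.
move=> x.
have cx0 : 0 <= c * x ^+ 2 by rewrite mulr_ge0 ?sqr_ge0// ltW.
have -> : (1 + c^-1 ^+ k * k`!%:R) * expR (c * x ^+ 2) =
    expR (c * x ^+ 2) + c^-1 ^+ k * (k`!%:R * expR (c * x ^+ 2)).
  by rewrite mulrDl mul1r -mulrA.
have : 1 + c^-1 ^+ k * (c * x ^+ 2) ^+ k <=
    expR (c * x ^+ 2) + c^-1 ^+ k * (k`!%:R * expR (c * x ^+ 2)).
  apply: lerD; first by rewrite -expR0 ler_expR.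
  rewrite ler_wpM2l ?pow_le_expR//.
  by rewrite exprn_ge0// invr_ge0 ltW.
apply: le_trans; rewrite -exprMn mulKf ?gt_eqF// -exprM mulnC exprM -normrX.
set a := x ^+ k; rewrite -[a ^+ 2]real_normK ?num_real//.
by have := normr_ge0 a; nra.
Qed.

(** The fundamental theorem of calculus on growing intervals centered at [m], passed to the limit by
    dominated convergence. *)
Lemma integral_antiderivative0 (m : R) (G g : R -> R) :
  (forall x : R, is_derive x 1 G (g x)) -> continuous g ->
  mu.-integrable setT (EFin \o g) ->
  G (m + n%:R) @[n --> \oo] --> (0 : R) -> G (m - n%:R) @[n --> \oo] --> (0 : R) ->
  Rintegral mu setT g = 0.
Proof.
move=> dG cg ig Gp Gm.
pose D (n : nat) : set R := `[m - n.+1%:R, m + n.+1%:R]%classic.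
have mD n : measurable (D n) by exact: measurable_itv.
have mg : measurable_fun setT (EFin \o g) by exact: (measurable_int mu).
pose f (n : nat) x : \bar R := ((EFin \o g) \_ (D n)) x.
have cvf : (\int[mu]_x f n x)%E @[n --> \oo] --> (\int[mu]_x (g x)%:E)%E.
  apply: (@dominated_cvg _ _ _ mu setT measurableT f _ (abse \o (EFin \o g))).
  - move=> n; apply/(measurable_restrict _ (mD n) measurableT).
    by apply: measurable_funS mg.
  - move=> x _; apply: cvg_near_cst; near=> n.
    rewrite /f patchE ifT// inE /D /= in_itv/=.
    have : `|x - m| <= n.+1%:R.
      apply: le_trans (_ : n%:R <= _); last by rewrite ler_nat.
      by near: n; exact: nbhs_infty_ger.
    by rewrite ler_norml => /andP[? ?]; apply/andP; split; lra.
  - by [].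
  - exact: integrable_abse.
  - move=> n x _; rewrite /f patchE; case: ifP => //= _.
    by rewrite normr0 lee_fin.
have {}cvf : (G (m + n.+1%:R) - G (m - n.+1%:R))%:E @[n --> \oo] -->
    (\int[mu]_x (g x)%:E)%E.
  move: cvf; apply: cvg_trans; apply: near_eq_cvg; near=> n.
  rewrite /f -integral_mkcond (@continuous_FTC2 _ g G) ?EFinB//.
  - have n0 : (0 : R) < n.+1%:R by rewrite ltr0n.
    by rewrite -subr_gt0 opprD opprK addrACA subrr add0r addr_gt0.
  - exact: continuous_subspaceT.
  - have cG x : {for x, continuous G}.
      apply: differentiable_continuous; apply/derivable1_diffP.
      by have [] := dG x.
    split; first by move=> x _; have [] := dG x.
    + exact/cvg_at_right_filter/cG.
    + exact/cvg_at_left_filter/cG.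
  - by move=> x _; rewrite derive1E; have [_ ->] := dG x.
have cv0 : (G (m + n.+1%:R) - G (m - n.+1%:R))%:E @[n --> \oo] --> (0 : R)%:E.
  apply: cvg_EFin; first exact: nearW.
  rewrite -(subr0 (0:R)); apply: cvgB.
  - by rewrite -cvg_shiftS in Gp.
  - by rewrite -cvg_shiftS in Gm.
by rewrite /Rintegral (cvg_unique _ cvf cv0).
Unshelve. all: by end_near. Qed.

Variables m s : R.
Hypothesis s0 : 0 < s.
Local Notation pdf := (normal_pdf m s).

Let sn0 : s != 0. Proof. by rewrite gt_eqF. Qed.

(** Half of the exponent of the density absorbs the polynomial factor; the other half is, up to a
    constant, the density of variance [2 s^2]. Integrability and decay of all moment integrands
    follow from this bound. *)
Lemma absX_normal_pdf_le (k : nat) :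
  exists C : R, 0 < C /\
    forall x, `|x - m| ^+ k * pdf x <= C * normal_pdf m (Num.sqrt 2 * s) x.
Proof.
have c0 : 0 < (4 * s ^+ 2)^-1 by rewrite invr_gt0 mulr_gt0// exprn_gt0.
have [C [C0 hC]] := absX_le_expR k c0.
have sq2 : Num.sqrt 2 * s != 0 :> R by rewrite mulf_neq0// sqrtr_eq0 -ltNge.
have p0 := normal_peak_gt0 sq2.
exists (C * normal_peak s / normal_peak (Num.sqrt 2 * s)); split.
  by rewrite divr_gt0// mulr_gt0// normal_peak_gt0.
move=> x; rewrite !normal_pdfE//.
set p := normal_peak s; set q := normal_peak _.
have -> : C * p / q * (q * normal_fun m (Num.sqrt 2 * s) x) =
    p * (C * normal_fun m (Num.sqrt 2 * s) x).
  by field; rewrite gt_eqF.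
rewrite mulrCA ler_wpM2l ?normal_peak_ge0//.
have -> : normal_fun m (Num.sqrt 2 * s) x =
    expR ((4 * s ^+ 2)^-1 * (x - m) ^+ 2) * normal_fun m s x.
  rewrite /normal_fun -expRD exprMn sqr_sqrtr//; congr expR.
  by field; rewrite sn0.
by rewrite mulrA ler_wpM2r// normal_fun_ge0.
Qed.

Lemma measurable_normal_moment (k : nat) :
  measurable_fun setT (fun x : R => (x - m) ^+ k * pdf x).
Proof.
apply: measurable_funM; last exact: measurable_normal_pdf.
by apply: measurable_funX; apply: measurable_funB.
Qed.

Lemma integrable_normal_moment (k : nat) :
  mu.-integrable setT (fun x => ((x - m) ^+ k * pdf x)%:E).
Proof.
have [C [C0 hC]] := absX_normal_pdf_le k.
apply: (le_integrable measurableT _ _ (integrableZl measurableT C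
  (integrable_normal_pdf m (Num.sqrt 2 * s)))).
  by apply/measurable_EFinP; exact: measurable_normal_moment.
move=> x _; rewrite /= lee_fin normrM normrX [X in _ * X]ger0_norm ?normal_pdf_ge0//.
by rewrite (le_trans (hC x))// ler_norm.
Qed.

Lemma is_derive_normal_pdf (x : R) :
  is_derive x 1 pdf (- ((x - m) / s ^+ 2) * pdf x).
Proof.
rewrite normal_pdfE//.
have -> : (fun x : R => normal_peak s * normal_fun m s x) =
  normal_peak s \*: (expR \o (- (2 * s ^+ 2)^-1 \*: (id - cst m) ^+ 2)).
  apply/funext => y; rewrite /normal_fun /=; congr (_ * expR _).
  by rewrite scE exprfctE/= !fctE/=; field; rewrite sn0.
have -> : - ((x - m) / s ^+ 2) * (normal_peak s * normal_fun m s x) =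
  normal_peak s *: (expR ((- (2 * s ^+ 2)^-1 \*: (id - cst m) ^+ 2) x) *
      (- (2 * s ^+ 2)^-1 * (2 * (x - m)))).
  rewrite /normal_fun -[_ *: _]/(_ * _).
  have -> : - (x - m) ^+ 2 / (s ^+ 2 *+ 2) = - (2 * s ^+ 2)^-1 * (x - m) ^+ 2.
    by field; rewrite sn0.
  by field; rewrite sn0.
apply: is_deriveZ.
apply: is_derive1_comp.
apply: is_derive_eq.
by rewrite !scE !fctE/=; ring.
Qed.

Lemma is_derive_normal_moment (k : nat) (x : R) :
  is_derive x 1 (fun x => (x - m) ^+ k * pdf x)
    (k%:R * (x - m) ^+ k.-1 * pdf x - (x - m) ^+ k.+1 / s ^+ 2 * pdf x).
Proof.
have dp := is_derive_normal_pdf x.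
have -> : (fun x => (x - m) ^+ k * pdf x) = (id - cst m) ^+ k * pdf.
  by apply/funext => y; rewrite /= fctE/= exprfctE.
apply: is_derive_eq.
rewrite !scE exprfctE !fctE/=; case: k => [|k] /=; rewrite !exprS.
  by field; exact: sn0.
set z := (x - m) ^+ k; set p := pdf x; set j := k.+1%:R.
by field; exact: sn0.
Qed.

(** The bound for the power [k.+1] leaves a decay in [1 / n]; the boolean [e] selects the end of the
    line. *)
Lemma cvg_normal_moment (k : nat) (e : bool) :
  (fun x => (x - m) ^+ k * pdf x) (m + (-1) ^+ e * n%:R) @[n --> \oo] --> (0 : R).
Proof.
have [C [C0 hC]] := absX_normal_pdf_le k.+1.
have sq2 : Num.sqrt 2 * s != 0 :> R by rewrite mulf_neq0// sqrtr_eq0 -ltNge.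
pose K := C * normal_peak (Num.sqrt 2 * s).
apply/cvgr0Pnorm_le => eps eps0; near=> n.
have n0 : (0 : R) < n%:R.
  by rewrite ltr0n; near: n; exact: nbhs_infty_gt.
have nK : K / eps <= n%:R by near: n; exact: nbhs_infty_ger.
have := hC (m + (-1) ^+ e * n%:R).
rewrite addrAC subrr add0r normrM normrX normrN1 expr1n mul1r ger0_norm//.
move=> /le_trans/(_ (ler_wpM2l (ltW C0) (normal_pdf_ub _ _ sq2))) h.
rewrite normrM normrX normrM normrX normrN1 expr1n mul1r.
rewrite [X in X ^+ k]ger0_norm// [X in _ * X]ger0_norm ?normal_pdf_ge0//.
rewrite -(ler_pM2l n0) mulrA -exprS (le_trans h)//.
by rewrite -/K -ler_pdivrMr.
Unshelve. all: by end_near. Qed.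

(** Integrates the derivative of [(x - m)^k pdf x], a function that vanishes at both ends. For
    [k = 0] the truncated [k.-1] is harmless, its coefficient being 0. *)
Lemma normal_moment_rec_gen (k : nat) :
  Rintegral mu setT (fun x => (x - m) ^+ k.+1 * pdf x) =
  k%:R * s ^+ 2 * Rintegral mu setT (fun x => (x - m) ^+ k.-1 * pdf x).
Proof.
pose G x := (x - m) ^+ k * pdf x.
pose g x := k%:R * ((x - m) ^+ k.-1 * pdf x) - (s ^+ 2)^-1 * ((x - m) ^+ k.+1 * pdf x).
have dG (x : R) : is_derive x 1 G (g x).
  by apply: is_derive_eq (is_derive_normal_moment k x) _; rewrite /g; ring.
have i1 := integrable_normal_moment k.-1.
have i2 := integrable_normal_moment k.+1.
have i1' : mu.-integrable setT (EFin \o (fun x => k%:R * ((x - m) ^+ k.-1 * pdf x))).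
  exact: (integrableZl measurableT k%:R i1).
have i2' : mu.-integrable setT (EFin \o (fun x => (s ^+ 2)^-1 * ((x - m) ^+ k.+1 * pdf x))).
  exact: (integrableZl measurableT (s ^+ 2)^-1 i2).
have cX j : continuous (fun x : R => (x - m) ^+ j * pdf x).
  move=> x; apply: differentiable_continuous; apply/derivable1_diffP.
  by have [] := is_derive_normal_moment j x.
have : Rintegral mu setT g = 0.
  apply: (@integral_antiderivative0 m G) => //.
  - move=> x; apply: cvgB; apply: cvgM; [exact: cvg_cst|exact: cX|exact: cvg_cst|exact: cX].
  - exact: (integrableB measurableT i1' i2').
  - by have := cvg_normal_moment k false; rewrite expr0; under eq_fun do rewrite mul1r.
  - by have := cvg_normal_moment k true; rewrite expr1; under eq_fun do rewrite mulN1r.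
rewrite RintegralB// !RintegralZl// => /eqP; rewrite subr_eq0 => /eqP h.
by rewrite -[LHS](mulVKf (_ : s ^+ 2 != 0)) ?sqrf_eq0// -h; ring.
Qed.

End NormalMoments.

(** * Integration against the normal law *)

Section GaussianLaw.
Context {R : realType}.
Local Notation mu := (@lebesgue_measure R).
Local Open Scope ereal_scope.

(** The explicit density equals the Radon-Nikodym derivative almost everywhere, since both have the
    same integral over every measurable set. *)
Lemma ge0_integral_normal_prob (m s : R) (f : R -> \bar R) :
  measurable_fun setT f -> (forall x, 0 <= f x) ->
  \int[normal_prob m s]_x f x = \int[mu]_x (f x * (normal_pdf m s x)%:E).
Proof.
move=> mf f0; have dom := normal_prob_dominates m s.
have mp : measurable_fun setT (fun x : R => (normal_pdf m s x)%:E).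
  by apply/measurable_EFinP; exact: measurable_normal_pdf.
have iRN := Radon_Nikodym_SigmaFinite.f_integrable dom.
rewrite -(Radon_Nikodym_SigmaFinite.change_of_variables dom)//.
apply: ae_eq_integral => //.
- by apply: emeasurable_funM => //; exact: measurable_int iRN.
- exact: emeasurable_funM.
- apply: ae_eqe_mul2l; apply: integral_ae_eq => // E _ mE.
  by rewrite -(Radon_Nikodym_SigmaFinite.f_integral dom mE).
Qed.

Lemma integral_normal_prob (m s : R) (f : R -> R) :
  measurable_fun setT f ->
  mu.-integrable setT (fun x => (f x * normal_pdf m s x)%:E) ->
  (normal_prob m s).-integrable setT (EFin \o f) /\
  \int[normal_prob m s]_x (f x)%:E = \int[mu]_x (f x * normal_pdf m s x)%:E.
Proof.
move=> mf ifp; have dom := normal_prob_dominates m s.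
have mp : measurable_fun setT (fun x : R => (normal_pdf m s x)%:E).
  by apply/measurable_EFinP; exact: measurable_normal_pdf.
have mEf : measurable_fun setT (EFin \o f) by exact/measurable_EFinP.
have ifn : (normal_prob m s).-integrable setT (EFin \o f).
  apply/integrableP; split => //.
  rewrite (ge0_integral_normal_prob _ _ (f := fun x => `|(f x)%:E|))//.
    move/integrableP : ifp => [_]; under eq_integral do
      rewrite EFinM abseM [X in _ * X]gee0_abs ?lee_fin ?normal_pdf_ge0//.
    by [].
  exact: measurableT_comp.
split => //.
rewrite -(Radon_Nikodym_change_of_variables dom)//.
apply: ae_eq_integral => //.
- by apply: emeasurable_funM => //; apply: (measurable_int mu).
- exact: measurable_int ifp.
- under [X in ae_eq _ _ _ X]eq_fun do rewrite EFinM.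
  apply: ae_eqe_mul2l; apply: integral_ae_eq => //.
    exact: Radon_Nikodym_integrable.
  by move=> E _ mE; rewrite -Radon_Nikodym_integral.
Qed.

End GaussianLaw.

Section GaussianMoments.
Context {d : measure_display} {T : measurableType d} {R : realType}.
Variable P : probability T R.

Lemma pushforward_moment (X : {RV P >-> measurableTypeR R}) (m s : R) : 0 < s ->
  (forall A, measurable A -> pushforward P X A = normal_prob m s A) ->
  forall k, P.-integrable setT (fun w => ((X w - m) ^+ k)%:E) /\
    Ex P (fun w => (X w - m) ^+ k) =
    Rintegral (@lebesgue_measure R) setT (fun x => (x - m) ^+ k * normal_pdf m s x).
Proof.
move=> s0 PX k.
have mXk : measurable_fun setT (fun x : R => (x - m) ^+ k).
  by apply: measurable_funX; exact: measurable_funB.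
have mX : measurable_fun setT X by exact: measurable_funP.
have mXk' : measurable_fun setT (fun x : R => ((x - m) ^+ k)%:E).
  exact/measurable_EFinP.
have [i1 e1] := integral_normal_prob mXk (integrable_normal_moment m s0 k).
have iP : P.-integrable setT (fun w => ((X w - m) ^+ k)%:E).
  apply/integrableP; split.
    by apply/measurable_EFinP; apply: measurable_funX; exact: measurable_funB.
  move/integrableP : i1 => [_]; apply: le_lt_trans.
  have -> : (\int[normal_prob m s]_x `|(EFin \o (fun x => ((x - m) ^+ k)%R)) x| =
      \int[distribution P X]_x `|(EFin \o (fun x => ((x - m) ^+ k)%R)) x|)%E.
    by apply: eq_measure_integral => A mA _; exact/esym/PX.
  by rewrite ge0_integral_distribution//; exact: measurableT_comp.
split => //; rewrite /Ex /Rintegral; congr fine; rewrite -e1.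
have -> : (\int[normal_prob m s]_x ((x - m) ^+ k)%:E =
    \int[distribution P X]_x ((x - m) ^+ k)%:E)%E.
  by apply: eq_measure_integral => A mA _; exact/esym/PX.
by rewrite integral_distribution.
Qed.

(** A centered Dirac mass sits at 0 and satisfies the same recursion with both sides 0, so the two
    cases of [gaussian_law] need not be told apart afterwards. *)
Lemma gaussian_law_moments_RV (X : {RV P >-> measurableTypeR R}) :
  gaussian_law (pushforward P X) -> Ex P X = 0 ->
  allmom P X /\ forall k, Ex P (fun w => X w ^+ k.+1) =
    k%:R * Ex P (fun w => X w ^+ 2) * Ex P (fun w => X w ^+ k.-1).
Proof.
have mX : measurable_fun setT X by exact: measurable_funP.
move=> [[m [s [s0 PX]]]|[m PX]] EX0.
  have H := pushforward_moment s0 PX.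
  have rec k := normal_moment_rec_gen m s0 k.
  have aX : allmom P (fun w => X w - m).
    by split=> [|k]; [exact: measurable_funB|have [] := H k].
  have aX' : allmom P X.
    have := allmomD aX (allmom_cst P m); congr allmom; apply/funext => w.
    by rewrite subrK.
  have m0 : m = 0.
    have : Ex P (fun w => X w - m) = 0.
      have [_] := H 1%N; rewrite (rec 0%N) !mul0r => <-.
      by apply: Ex_ext => w; rewrite expr1.
    by rewrite ExB ?Ex_cst ?EX0//; [move/eqP; rewrite sub0r oppr_eq0 => /eqP|exact: allmom_cst].
  split => // k.
  have {}H j : Ex P (fun w => X w ^+ j) =
      Rintegral (@lebesgue_measure R) setT (fun x => (x - m) ^+ j * normal_pdf m s x).
    by have [_ <-] := H j; apply: Ex_ext => w; rewrite m0 subr0.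
  have E0 : Rintegral (@lebesgue_measure R) setT (fun x => (x - m) ^+ 0 * normal_pdf m s x) = 1.
    by rewrite -H -[RHS](Ex_cst P); apply: Ex_ext => w; rewrite expr0.
  by rewrite !H !rec E0 mul1r mulr1.
have aeX (f : R -> R) : measurable_fun setT f ->
    P.-integrable setT (fun w => (f (X w))%:E) /\ Ex P (fun w => f (X w)) = f m.
  move=> mf; have mEf : measurable_fun setT (EFin \o f) by exact/measurable_EFinP.
  have iP : P.-integrable setT (fun w => (f (X w))%:E).
    apply/integrableP; split.
      by apply/measurable_EFinP; exact: measurableT_comp.
    have -> : (\int[P]_x `|(f (X x))%:E| = \int[distribution P X]_x `|(f x)%:E|)%E.
      by rewrite ge0_integral_distribution//; exact: measurableT_comp.
    rewrite (@eq_measure_integral _ (measurableTypeR R) R setT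
      \d_(m : measurableTypeR R) (distribution P X)); last by move=> A mA _; exact: PX.
    rewrite integral_dirac//; last exact: measurableT_comp (measurableT_comp _ mf).
    by rewrite diracT mul1e ltry.
  split => //; rewrite /Ex /Rintegral.
  have -> : (\int[P]_x (f (X x))%:E = \int[distribution P X]_x (f x)%:E)%E.
    by rewrite integral_distribution.
  rewrite (@eq_measure_integral _ (measurableTypeR R) R setT
      \d_(m : measurableTypeR R) (distribution P X)); last by move=> A mA _; exact: PX.
  by rewrite integral_dirac// diracT mul1e.
have mpow k : measurable_fun setT (fun x : R => x ^+ k) by exact: measurable_funX.
have m0 : m = 0 by have [_] := aeX _ (mpow 1%N); rewrite expr1 => <-.
split; first by split=> // k; have [] := aeX _ (mpow k).
move=> k; have [_ ->] := aeX _ (mpow k.+1).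
have [_ ->] := aeX _ (mpow 2%N).
by rewrite m0 !expr0n/= mulr0 mul0r.
Qed.

Lemma gaussian_law_moments (X : T -> R) : measurable_fun setT X ->
  gaussian_law (pushforward P X) -> Ex P X = 0 ->
  allmom P X /\ forall k, Ex P (fun w => X w ^+ k.+1) =
    k%:R * Ex P (fun w => X w ^+ 2) * Ex P (fun w => X w ^+ k.-1).
Proof.
move=> mX; pose X' : {RV P >-> measurableTypeR R} :=
  HB.pack (X : T -> measurableTypeR R)
    (isMeasurableFun.Build _ _ T (measurableTypeR R) X mX).
exact: (@gaussian_law_moments_RV X').
Qed.

End GaussianMoments.

(** * Gaussian spaces *)

Section GaussianSpace.
Context {d : measure_display} {T : measurableType d} {R : realType}.
Variable P : probability T R.
Local Notation E := (Ex P).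
Implicit Types (f g p q : T -> R).

(** Only the moment recursion of a centered normal law is retained. Closure under [f + c g] turns it
    into information on joint moments, which is all that Wick's formula requires. *)
Definition gaussian_space (V : set (T -> R)) :=
  (forall (c : R) f g, V f -> V g -> V (fun w => f w + c * g w)) /\
  (forall f, V f -> allmom P f /\ forall k, E (fun w => f w ^+ k.+1) =
    k%:R * E (fun w => f w ^+ 2) * E (fun w => f w ^+ k.-1)).

(** Replaces differentiation under the expectation: the moment is a polynomial in [t], so an
    identity valid for all [t] may be read on its linear coefficients. *)
Lemma Ex_pow_lin_poly (A B q : T -> R) (k : nat) :
  allmom P A -> allmom P B -> allmom P q ->
  exists r : {poly R},
    [/\ forall t, r.[t] = E (fun w => (A w + t * B w) ^+ k * q w),
        r`_0 = E (fun w => A w ^+ k * q w) &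
        r`_1 = k%:R * E (fun w => A w ^+ k.-1 * B w * q w)].
Proof.
move=> aA aB; elim: k q => [|k IH] q aq.
  exists (E q)%:P; split.
  - by move=> t; rewrite hornerC; apply: Ex_ext => w; rewrite expr0 mul1r.
  - by rewrite coefC eqxx; apply: Ex_ext => w; rewrite expr0 mul1r.
  - by rewrite coefC mul0r.
have aAq := allmomM aA aq; have aBq := allmomM aB aq.
have [r [rE r0 r1]] := IH _ aAq.
have [s [sE s0 s1]] := IH _ aBq.
have aX (h : T -> R) : allmom P h -> allmom P (fun w => A w ^+ k * h w).
  by move=> ah; apply: allmomM ah; exact: allmomX.
exists (r + 'X * s); split.
- move=> t; rewrite hornerD hornerM hornerX rE sE.
  have at_ : allmom P (fun w => (A w + t * B w) ^+ k).
    by apply: allmomX; apply: allmomD => //; exact: allmomZ.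
  rewrite -ExZ -?ExD; first by apply: Ex_ext => w; rewrite exprS; ring.
  + exact: allmomM.
  + by apply: allmomZ; exact: allmomM.
  + exact: allmomM.
- by rewrite coefD coefXM eqxx addr0 r0; apply: Ex_ext => w; rewrite exprSr mulrA.
- rewrite coefD coefXM/= r1 s0.
  have -> : k%:R * E (fun w => A w ^+ k.-1 * B w * (A w * q w)) =
      k%:R * E (fun w => A w ^+ k * B w * q w).
    case: k {IH r s rE sE r0 s0 r1 s1 aX} => [|k] /=; first by rewrite !mul0r.
    by congr (_ * _); apply: Ex_ext => w; rewrite exprSr; ring.
  rewrite -[in RHS]natr1 mulrDl mul1r; congr (_ + _).
  by apply: Ex_ext => w; rewrite mulrA.
Qed.

(** Leibniz's rule for the product over [l], along a direction in which each factor [f] has the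
    constant derivative [c f]. In Wick's formula [c] is the covariance with [g]. *)
Fixpoint prod_deriv (c : (T -> R) -> R) (l : seq (T -> R)) : T -> R :=
  if l is f :: l' then
    fun w => c f * (\prod_(g <- l') g w) + f w * prod_deriv c l' w
  else fun=> 0.

Lemma allmom_prod_deriv c l : List.Forall (allmom P) l ->
  allmom P (prod_deriv c l).
Proof.
elim => [|f {}l af al IH] /=; first exact: allmom_cst.
apply: allmomD; last exact: allmomM.
by apply: allmomZ; exact: allmom_prod.
Qed.

Variable V : set (T -> R).
Hypothesis gV : gaussian_space V.
Local Notation C f g := (E (fun w => f w * g w)).

Lemma gaussian_space_allmom f : V f -> allmom P f.
Proof. by move=> /gV.2 []. Qed.
Hint Resolve gaussian_space_allmom : core.

Lemma Forall_allmom l : List.Forall V l -> List.Forall (allmom P) l.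
Proof. by apply: List.Forall_impl => f; exact: gaussian_space_allmom. Qed.

Lemma poly_eq_coef1 (r s : {poly R}) : (forall t, r.[t] = s.[t]) -> r`_1 = s`_1.
Proof.
move=> rs; suff -> : r = s by [].
apply/eqP; rewrite -subr_eq0; apply/negPn/negP => rs0.
have := max_poly_roots rs0 (rs := [seq i%:R | i <- iota 0 (size (r - s))]).
rewrite size_map size_iota ltnn => H; suff : false by []; apply: H => //.
- by apply/allP => x _; rewrite /root hornerD hornerN rs subrr.
- rewrite map_inj_uniq ?iota_uniq// => i j /eqP.
  by rewrite eqr_nat => /eqP.
Qed.

(** Induction by steps of two: the linear coefficient in [t] of the moment recursion of order [k.+3]
    for [f + t g] expresses the case [k.+2] through the case [k]. *)
Lemma gaussian_space_stein f g k : V f -> V g ->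
  E (fun w => g w * f w ^+ k) = k%:R * C g f * E (fun w => f w ^+ k.-1).
Proof.
move=> Vf Vg; elim/ltn_ind: k => -[|[|k]] IH.
- rewrite !mul0r.
  have [_ /(_ 0%N)] := gV.2 _ Vg; rewrite !mul0r => <-.
  by apply: Ex_ext => w; rewrite expr0 mulr1 expr1.
- have -> : E (fun w => f w ^+ 1.-1) = 1.
    by rewrite -[RHS](Ex_cst P); apply: Ex_ext => w; rewrite expr0.
  by rewrite mul1r mulr1; apply: Ex_ext => w; rewrite expr1.
have af := gaussian_space_allmom Vf; have ag := gaussian_space_allmom Vg.
have a1 := allmom_cst P 1.
have [r [rE r0 r1]] := Ex_pow_lin_poly k.+3 af ag a1.
have [s [sE s0 s1]] := Ex_pow_lin_poly 2 af ag a1.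
have [u [uE u0 u1]] := Ex_pow_lin_poly k.+1 af ag a1.
have : r`_1 = (k.+2%:R%:P * s * u)`_1.
  apply: poly_eq_coef1 => t; rewrite !hornerM hornerC rE sE uE.
  have [_ /(_ k.+2)/=] := gV.2 _ (gV.1 t _ _ Vf Vg).
  have e1 j : E (fun w => (f w + t * g w) ^+ j * 1) = E (fun w => (f w + t * g w) ^+ j).
    by apply: Ex_ext => w; rewrite mulr1.
  by rewrite !e1.
rewrite -mulrA coefCM coefM big_ord_recl big_ord1/= r1 s0 s1 u0 u1 /=.
have -> : E (fun w => f w ^+ k.+2 * g w * 1) = E (fun w => g w * f w ^+ k.+2).
  by apply: Ex_ext => w; ring.
have -> : E (fun w => f w ^+ k.+1 * 1) = E (fun w => f w ^+ k.+1).
  by apply: Ex_ext => w; rewrite mulr1.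
have -> : E (fun w => f w ^+ k * g w * 1) = E (fun w => g w * f w ^+ k).
  by apply: Ex_ext => w; ring.
have -> : E (fun w => f w ^+ 1 * g w * 1) = C g f.
  by apply: Ex_ext => w; ring.
have -> : E (fun w => f w ^+ 2 * 1) = E (fun w => f w ^+ 2).
  by apply: Ex_ext => w; ring.
rewrite (IH k)//; have [_ /(_ k)->] := gV.2 _ Vf.
set x := C g f; set y := E _; set z := E (fun w => f w ^+ k.-1).
move=> H; apply: (mulfI (_ : k.+3%:R != 0 :> R)); first by rewrite pnatr_eq0.
by rewrite H -!natr1; ring.
Qed.

(** Polarization: the case [h :: l] is the linear coefficient in [t] of the case [l] with [f + t h]
    in place of [f] and power [k.+1]. The free power of [f] is in the statement to make this
    induction possible. *)
Lemma wick l f g k : V f -> V g -> List.Forall V l ->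
  E (fun w => g w * f w ^+ k * \prod_(h <- l) h w) =
  E (fun w => k%:R * C g f * f w ^+ k.-1 * \prod_(h <- l) h w +
              f w ^+ k * prod_deriv (fun h => C g h) l w).
Proof.
move=> Vf Vg Vl; elim: Vl f k Vf => {l} [|h l Vh Vl IH] f k Vf.
  have af := gaussian_space_allmom Vf.
  transitivity (E (fun w => g w * f w ^+ k)).
    by apply: Ex_ext => w; rewrite big_nil mulr1.
  rewrite gaussian_space_stein// -ExZ; last exact: allmomX.
  by apply: Ex_ext => w; rewrite big_nil mulr1 mulr0 addr0.
have af := gaussian_space_allmom Vf; have ag := gaussian_space_allmom Vg.
have ah := gaussian_space_allmom Vh.
have al := Forall_allmom Vl.
have ap := allmom_prod al.
have ad : allmom P (prod_deriv (fun h => C g h) l) by exact: allmom_prod_deriv.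
have agp := allmomM ag ap.
have [r [rE r0 r1]] := Ex_pow_lin_poly k.+1 af ah agp.
have [s [sE s0 s1]] := Ex_pow_lin_poly k af ah ap.
have [u [uE u0 u1]] := Ex_pow_lin_poly k.+1 af ah ad.
have afX j : allmom P (fun w => f w ^+ j) by exact: allmomX.
have : r`_1 = (k.+1%:R%:P * ((C g f)%:P + (C g h)%:P * 'X) * s + u)`_1.
  apply: poly_eq_coef1 => t; rewrite hornerD !hornerM hornerD hornerM !hornerC hornerX rE sE uE.
  have afh : allmom P (fun w => f w + t * h w).
    by apply: allmomD => //; exact: allmomZ.
  have afhX j : allmom P (fun w => (f w + t * h w) ^+ j) by exact: allmomX.
  have := IH _ k.+1 (gV.1 t _ _ Vf Vh).
  have -> : C g (fun w => f w + t * h w) = C g f + t * C g h.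
    rewrite -ExZ -?ExD; first by apply: Ex_ext => w; ring.
    + exact: allmomM.
    + by apply: allmomZ; exact: allmomM.
    + exact: allmomM.
  rewrite ExD; first last.
  - exact: allmomM.
  - by apply: allmomM => //; apply: allmomZ.
  rewrite (mulrC (C g h)) -[in X in _ -> X]ExZ; last exact: allmomM.
  move=> H; transitivity (E (fun w => g w * (f w + t * h w) ^+ k.+1 * \prod_(h <- l) h w)).
    by apply: Ex_ext => w; ring.
  by rewrite H; congr (_ + _); apply: Ex_ext => w; rewrite /=; ring.
rewrite coefD -mulrA coefCM coefM big_ord_recl big_ord1/= r1 s0 s1 u1.
rewrite !coefD !coefC !coefCM !coefX/= mulr0 mulr1 addr0 add0r => H.
apply: (mulfI (_ : k.+1%:R != 0 :> R)); first by rewrite pnatr_eq0.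
transitivity (k.+1%:R * E (fun w => f w ^+ k * h w * (g w * \prod_(h <- l) h w))).
  by congr (_ * _); apply: Ex_ext => w; rewrite big_cons; ring.
rewrite H -mulrDr; congr (_ * _).
rewrite /=; set x := C g f; set y := C g h.
transitivity (E (fun w => (k%:R * x) * (f w ^+ k.-1 * h w * \prod_(h <- l) h w)) +
  E (fun w => y * (f w ^+ k * \prod_(h <- l) h w)) +
  E (fun w => f w ^+ k * h w * prod_deriv (fun h : T -> R => C g h) l w)).
  rewrite !ExZ; [by ring|by repeat (first [assumption|exact: afX|apply: allmomM])..].
rewrite -!ExD; first by apply: Ex_ext => w; rewrite big_cons; ring.
all: by repeat (first [assumption|exact: afX|apply: allmomZ|apply: allmomD|apply: allmomM]).
Qed.

(** Expresses that [p'] is the derivative of [p] in the Gaussian direction [g]. Testing against all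
    products over [V] makes the relation stable under multiplication by elements of [V], hence
    available for every polynomial in them. *)
Definition ibp g p p' := [/\ allmom P p, allmom P p' &
  forall l, List.Forall V l ->
    E (fun w => g w * p w * \prod_(h <- l) h w) =
    E (fun w => p' w * \prod_(h <- l) h w +
                p w * prod_deriv (fun h => C g h) l w)].

Lemma ibp_Ex g p p' : ibp g p p' -> E (fun w => g w * p w) = E p'.
Proof.
move=> [_ _ /(_ [::] (List.Forall_nil _))] H.
transitivity (E (fun w => g w * p w * \prod_(h <- [::]) h w)).
  by apply: Ex_ext => w; rewrite big_nil mulr1.
by rewrite H; apply: Ex_ext => w; rewrite big_nil mulr1 mulr0 addr0.
Qed.

Lemma ibp1 g : V g -> ibp g (fun=> 1) (fun=> 0).
Proof.
move=> Vg; split; [exact: allmom_cst|exact: allmom_cst|move=> l Vl].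
have := wick 0 Vg Vg Vl.
under Ex_ext do rewrite expr0.
move=> ->; apply: Ex_ext => w; rewrite expr0; ring.
Qed.

(** Leibniz's rule, obtained by adding [f] to the list of test factors. *)
Lemma ibpM g p p' f : V g -> V f -> ibp g p p' ->
  ibp g (fun w => f w * p w) (fun w => f w * p' w + C g f * p w).
Proof.
move=> Vg Vf [ap ap' H]; have af := gaussian_space_allmom Vf.
split; first exact: allmomM.
  by apply: allmomD; [exact: allmomM|exact: allmomZ].
move=> l Vl; have := H (f :: l) (List.Forall_cons _ Vf Vl).
move=> h; transitivity (E (fun w => g w * p w * \prod_(h <- (f :: l)) h w)).
  by apply: Ex_ext => w; rewrite big_cons; ring.
by rewrite h; apply: Ex_ext => w; rewrite big_cons /=; ring.
Qed.

Lemma ibpD g p p' q q' c : V g -> ibp g p p' -> ibp g q q' ->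
  ibp g (fun w => p w + c * q w) (fun w => p' w + c * q' w).
Proof.
move=> Vg [ap ap' Hp] [aq aq' Hq].
split; [by apply: allmomD => //; exact: allmomZ..|].
move=> l Vl.
have ag := gaussian_space_allmom Vg.
have al := Forall_allmom Vl.
have aP := allmom_prod al.
have ad : allmom P (prod_deriv (fun h => C g h) l) by exact: allmom_prod_deriv.
transitivity (E (fun w => g w * p w * \prod_(h <- l) h w) +
   c * E (fun w => g w * q w * \prod_(h <- l) h w)).
  rewrite -ExZ -?ExD; [by apply: Ex_ext => w; ring|
    by repeat (first [assumption|apply: allmomZ|apply: allmomM|apply: allmomD])..].
rewrite Hp// Hq// -ExZ -?ExD; first by apply: Ex_ext => w; ring.
all: by repeat (first [assumption|apply: allmomZ|apply: allmomM|apply: allmomD]).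
Qed.

Lemma ibp_ext g p p' q q' : p =1 q -> p' =1 q' -> ibp g p p' -> ibp g q q'.
Proof. by move=> /funext -> /funext ->. Qed.

Lemma ibp_sum (I : Type) (r : seq I) (F F' : I -> T -> R) g : V g ->
  (forall i, ibp g (F i) (F' i)) ->
  ibp g (fun w => \sum_(i <- r) F i w) (fun w => \sum_(i <- r) F' i w).
Proof.
move=> Vg HF; elim: r => [|i r IH].
  apply: ibp_ext (ibpD (-1) Vg (ibp1 Vg) (ibp1 Vg)) => w; rewrite big_nil; ring.
apply: ibp_ext (ibpD 1 Vg (HF i) IH) => w; rewrite big_cons; ring.
Qed.

End GaussianSpace.

(** * Quadratic forms in a Gaussian space *)

Section QuadraticForm.
Context {d : measure_display} {T : measurableType d} {R : realType}.
Variable P : probability T R.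
Variable V : set (T -> R).
Hypothesis gV : gaussian_space P V.
Variables (N : nat) (e : 'I_N -> T -> R).
Hypothesis Ve : forall i, V (e i).
Local Notation E := (Ex P).
Local Notation gam i j := (E (fun w => e i w * e j w)).
Hypothesis gam1 : forall i, gam i i = 1.
Hypothesis gam_le1 : forall i j, `|gam i j| <= 1.
Hypothesis gam_row : forall i, \sum_j `|gam i j| <= 3.

Let gamC i j : gam i j = gam j i.
Proof. by apply: Ex_ext => w; rewrite mulrC. Qed.

Let ae i : allmom P (e i).
Proof. exact: gaussian_space_allmom gV _ (Ve i). Qed.

Definition sqsum w := \sum_i e i w ^+ 2.
(** A quarter of the squared norm of the Malliavin derivative of [sqsum]. Its concentration around
    its mean [gamsq] is what makes the moments asymptotically normal. *)
Definition bilin w := \sum_i \sum_j gam i j * (e i w * e j w).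

Lemma allmom_sqsum : allmom P sqsum.
Proof. by apply: allmom_sum => i _; exact: allmomX. Qed.

Lemma allmom_bilin : allmom P bilin.
Proof.
apply: allmom_sum => i _; apply: allmom_sum => j _; apply: allmomZ.
exact: allmomM.
Qed.

Let aH (al be : R) k : allmom P (fun w => (al * sqsum w + be) ^+ k).
Proof.
apply: allmomX; apply: allmomD; last exact: allmom_cst.
by apply: allmomZ; exact: allmom_sqsum.
Qed.

Lemma ibp_affine_sqsum (g : T -> R) (al be : R) k : V g ->
  ibp P V g (fun w => (al * sqsum w + be) ^+ k)
    (fun w => k%:R * (al * sqsum w + be) ^+ k.-1 *
      (2 * al * \sum_j E (fun w => g w * e j w) * e j w)).
Proof.
move=> Vg; elim: k => [|k IH].
  by apply: ibp_ext (ibp1 gV Vg) => w; rewrite ?expr0// !mul0r.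
pose H w := al * sqsum w + be.
have h1 i := ibpM gV Vg (Ve i) (ibpM gV Vg (Ve i) IH).
have h2 := ibp_sum gV (index_enum 'I_N) Vg h1.
(* [ibpD] only adds a multiple, so [be * p] is obtained as [p + (be - 1) * p]. *)
have h3 := ibpD gV (be - 1) Vg IH IH.
have h4 := ibpD gV al Vg h3 h2.
apply: ibp_ext h4 => w.
- rewrite exprS -/(H w).
  under eq_bigr do rewrite mulrA -expr2.
  by rewrite -mulr_suml -/(sqsum w) /H; ring.
- rewrite -/(H w) /=.
  set D := \sum_j E (fun w => g w * e j w) * e j w.
  have -> : \sum_i (e i w * (e i w * (k%:R * H w ^+ k.-1 * (2 * al * D)) +
      E (fun w => g w * e i w) * H w ^+ k) + E (fun w => g w * e i w) * (e i w * H w ^+ k)) =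
      sqsum w * (k%:R * H w ^+ k.-1 * (2 * al * D)) + 2 * H w ^+ k * D.
    have -> : 2 * H w ^+ k * D = \sum_j 2 * H w ^+ k * (E (fun w => g w * e j w) * e j w).
      by rewrite mulr_sumr.
    by rewrite /sqsum mulr_suml -big_split/=; apply: eq_bigr => i _; ring.
  transitivity (H w * (k%:R * H w ^+ k.-1 * (2 * al * D)) + H w ^+ k * (2 * al * D)).
    by rewrite /H; ring.
  have -> : H w * (k%:R * H w ^+ k.-1 * (2 * al * D)) = k%:R * H w ^+ k * (2 * al * D).
    by case: k {IH h1 h2 h3} => [|k] /=; rewrite ?exprS; ring.
  by rewrite -natr1; ring.
Qed.

(** Integrates by parts one factor of each [e i ^+ 2]; the diagonal correlations, all equal to 1,
    produce the term in [N]. *)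
Lemma Ex_sqsum_affine (al be : R) k :
  E (fun w => sqsum w * (al * sqsum w + be) ^+ k) =
  N%:R * E (fun w => (al * sqsum w + be) ^+ k) +
  2 * al * k%:R * E (fun w => (al * sqsum w + be) ^+ k.-1 * bilin w).
Proof.
pose H w := al * sqsum w + be.
transitivity (\sum_i E (fun w => e i w * (e i w * H w ^+ k))).
  rewrite -Ex_sum.
    by apply: Ex_ext => w; rewrite /sqsum mulr_suml; apply: eq_bigr => i _; rewrite expr2 mulrA.
  by move=> i _; apply: allmomM => //; apply: allmomM => //; exact: aH.
transitivity (\sum_i (E (fun w => H w ^+ k) + 2 * al * k%:R *
    E (fun w => H w ^+ k.-1 * \sum_j gam i j * (e i w * e j w)))).
  apply: eq_bigr => i _.
  rewrite (ibp_Ex (ibpM gV (Ve i) (Ve i) (ibp_affine_sqsum al be k (Ve i)))).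
  rewrite gam1 -ExZ; last by rewrite /H; allmom_solve.
  rewrite -ExD; [|by rewrite /H; allmom_solve..].
  apply: Ex_ext => w; rewrite -/(H w).
  have -> : \sum_j gam i j * (e i w * e j w) = e i w * \sum_j gam i j * e j w.
    by rewrite mulr_sumr; apply: eq_bigr => j _; ring.
  by ring.
rewrite big_split/= sumr_const card_ord mulr_natl -mulr_sumr; congr (_ + _ * _); first by rewrite mulr_natl.
rewrite -Ex_sum; first by apply: Ex_ext => w; rewrite /bilin mulr_sumr.
move=> i _; apply: allmomM; first exact: aH.
by apply: allmom_sum => j _; apply: allmomZ; exact: allmomM.
Qed.

(** Schur's test: [|xy| <= (x^2 + y^2) / 2] and the row sums of the correlations. *)
Lemma bilin_le w : `|bilin w| <= 3 * sqsum w.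
Proof.
have h i j : `|gam i j * (e i w * e j w)| <=
    `|gam i j| * (e i w ^+ 2 / 2) + `|gam i j| * (e j w ^+ 2 / 2).
  rewrite normrM -mulrDr ler_wpM2l// ler_norml.
  move: (e i w) (e j w) => x y.
  have := sqr_ge0 (x - y); have := sqr_ge0 (x + y); rewrite !expr2 => h1 h2.
  by apply/andP; split; nra.
apply: (@le_trans _ _ (\sum_i \sum_j
    (`|gam i j| * (e i w ^+ 2 / 2) + `|gam i j| * (e j w ^+ 2 / 2)))).
  apply: le_trans (ler_norm_sum _ _ _) _; apply: ler_sum => i _.
  by apply: le_trans (ler_norm_sum _ _ _) _; apply: ler_sum => j _.
have -> : 3 * sqsum w = \sum_i 3 * (e i w ^+ 2 / 2) + \sum_i 3 * (e i w ^+ 2 / 2).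
  rewrite -big_split/= /sqsum mulr_sumr; apply: eq_bigr => i _; lra.
under eq_bigr do rewrite big_split/=.
rewrite big_split/=; apply: lerD.
  by apply: ler_sum => i _; rewrite -mulr_suml ler_wpM2r// divr_ge0// sqr_ge0.
rewrite exchange_big/=; apply: ler_sum => j _.
rewrite -mulr_suml ler_wpM2r//; first by rewrite divr_ge0// sqr_ge0.
by rewrite (le_trans _ (gam_row j))//; apply: ler_sum => i _; rewrite gamC.
Qed.

Lemma sqsum_ge0 w : 0 <= sqsum w.
Proof. by apply: sumr_ge0 => i _; rewrite sqr_ge0. Qed.

Lemma Ex_sqsumS m :
  E (fun w => sqsum w ^+ m.+1) <= (N%:R + 6 * m%:R) * E (fun w => sqsum w ^+ m).
Proof.
have aS k : allmom P (fun w => sqsum w ^+ k) by apply: allmomX; exact: allmom_sqsum.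
have EH k : E (fun w => (1 * sqsum w + 0) ^+ k) = E (fun w => sqsum w ^+ k).
  by apply: Ex_ext => w; rewrite mul1r addr0.
have := Ex_sqsum_affine 1 0 m; rewrite EH.
have -> : E (fun w => sqsum w * (1 * sqsum w + 0) ^+ m) = E (fun w => sqsum w ^+ m.+1).
  by apply: Ex_ext => w; rewrite mul1r addr0 exprS.
have -> : E (fun w => (1 * sqsum w + 0) ^+ m.-1 * bilin w) = E (fun w => sqsum w ^+ m.-1 * bilin w).
  by apply: Ex_ext => w; rewrite mul1r addr0.
move=> ->; rewrite [leRHS]mulrDl lerD2l mulr1.
case: m => [|m]; first by rewrite !mulr0 !mul0r.
rewrite (_ : 6 = 2 * 3); last by ring.
rewrite -!mulrA ler_pM2l// [3 * _]mulrCA ler_wpM2l// -ExZ//.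
apply: Ex_le => [||w].
- by apply: allmomM => //; exact: allmom_bilin.
- exact: allmomZ.
- rewrite exprSr mulrCA ler_wpM2l ?exprn_ge0 ?sqsum_ge0//.
  exact: le_trans (ler_norm _) (bilin_le w).
Qed.

Lemma Ex_sqsum_pow m : (0 < N)%N ->
  E (fun w => sqsum w ^+ m) <= N%:R ^+ m * \prod_(j < m) (1 + 6 * j%:R).
Proof.
move=> N0; have N1 : (1 : R) <= N%:R by rewrite ler1n.
elim: m => [|m IH].
  by rewrite big_ord0 mulr1 expr0 -[leRHS](Ex_cst P); under Ex_ext do rewrite expr0.
apply: le_trans (Ex_sqsumS m) _.
have -> : N%:R ^+ m.+1 * \prod_(j < m.+1) (1 + 6 * j%:R) =
    (N%:R * (1 + 6 * m%:R)) * (N%:R ^+ m * \prod_(j < m) (1 + 6 * j%:R)) :> R.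
  by rewrite big_ord_recr/= exprS; ring.
apply: ler_pM => //.
- by apply: Ex_ge0 => w; rewrite exprn_ge0// sqsum_ge0.
- by rewrite mulrDr mulr1 lerD2l ler_peMl// mulr_ge0.
Qed.

Definition gamsq : R := \sum_i \sum_j gam i j ^+ 2.

Lemma Ex_bilin : E bilin = gamsq.
Proof.
rewrite Ex_sum; last first.
  by move=> i _; apply: allmom_sum => j _; apply: allmomZ; exact: allmomM.
apply: eq_bigr => i _; rewrite Ex_sum; last by move=> j _; apply: allmomZ; exact: allmomM.
by apply: eq_bigr => j _; rewrite ExZ ?expr2//; exact: allmomM.
Qed.

Lemma Ex_prod4 i j k l :
  E (fun w => e i w * e j w * (e k w * e l w)) =
  gam i j * gam k l + gam i k * gam j l + gam i l * gam j k.
Proof.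
have h := ibpM gV (Ve i) (Ve j) (ibpM gV (Ve i) (Ve k) (ibpM gV (Ve i) (Ve l) (ibp1 gV (Ve i)))).
transitivity (E (fun w => e i w * (e j w * (e k w * (e l w * 1))))).
  by apply: Ex_ext => w; ring.
have {}h := ibp_Ex h; rewrite h -!ExZ -?ExD; [|by allmom_solve..].
by apply: Ex_ext => w /=; ring.
Qed.

(** Of the three pairings in the fourth moment, the one that keeps [(i, j)] and [(k, l)] gives
    [gamsq ^+ 2]. In each of the other two the four correlations form a cycle: one is bounded by 1
    and the row sums of the remaining three leave [27 N]. *)
Lemma Ex_bilin2 : E (fun w => bilin w ^+ 2) <= gamsq ^+ 2 + 54 * N%:R.
Proof.
pose g i j := gam i j.
have gC i j : g i j = g j i by exact: gamC.
have arow i : \sum_j `|g j i| <= 3.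
  by rewrite (le_trans _ (gam_row i))//; apply: ler_sum => j _; rewrite gC.
have -> : E (fun w => bilin w ^+ 2) = \sum_i \sum_j \sum_k \sum_l
    (g i j * g k l) * (g i j * g k l + g i k * g j l + g i l * g j k).
  transitivity (E (fun w => \sum_i \sum_j \sum_k \sum_l
      (g i j * g k l) * (e i w * e j w * (e k w * e l w)))).
    apply: Ex_ext => w; rewrite expr2 /bilin mulr_suml; apply: eq_bigr => i _.
    rewrite mulr_suml; apply: eq_bigr => j _.
    rewrite mulr_sumr; apply: eq_bigr => k _.
    by rewrite mulr_sumr; apply: eq_bigr => l _; rewrite /g; ring.
  have a4 i j k l : allmom P (fun w => (g i j * g k l) * (e i w * e j w * (e k w * e l w))).
    by apply: allmomZ; apply: allmomM; exact: allmomM.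
  rewrite Ex_sum; last by move=> ? _; allmom_solve.
  apply: eq_bigr => i _; rewrite Ex_sum; last by move=> ? _; allmom_solve.
  apply: eq_bigr => j _; rewrite Ex_sum; last by move=> ? _; allmom_solve.
  apply: eq_bigr => k _; rewrite Ex_sum; last by move=> ? _; allmom_solve.
  apply: eq_bigr => l _; rewrite ExZ ?Ex_prod4//; apply: allmomM; exact: allmomM.
have -> : gamsq ^+ 2 = \sum_i \sum_j \sum_k \sum_l (g i j * g k l) ^+ 2.
  rewrite expr2 /gamsq mulr_suml; apply: eq_bigr => i _.
  rewrite mulr_suml; apply: eq_bigr => j _.
  rewrite mulr_sumr; apply: eq_bigr => k _.
  by rewrite mulr_sumr; apply: eq_bigr => l _; rewrite /g; ring.
have b1 i j k l : `|g k l| * (`|g i k| * `|g j l|) <= `|g i k| * `|g j l|.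
  by rewrite ler_piMl ?mulr_ge0 ?normr_ge0//; exact: gam_le1.
have S1 : \sum_i \sum_j \sum_k \sum_l (g i j * g k l) * (g i k * g j l) <= 27 * N%:R.
  apply: (@le_trans _ _ (\sum_(i < N) (27 : R))); last first.
    by rewrite sumr_const card_ord mulr_natr.
  apply: ler_sum => i _.
  apply: (@le_trans _ _ (\sum_j \sum_k \sum_l `|g i j| * (`|g i k| * `|g j l|))).
    do 3 (apply: ler_sum => ? _).
    apply: le_trans (ler_norm _) _; rewrite !normrM -mulrA ler_wpM2l//.
  apply: (@le_trans _ _ (\sum_j `|g i j| * 9)); last first.
    by rewrite -mulr_suml; have := gam_row i; rewrite -/(g i _) => h; lra.
  apply: ler_sum => j _.
  under eq_bigr do rewrite -mulr_sumr -mulr_sumr.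
  rewrite -mulr_sumr -mulr_suml ler_wpM2l//.
  rewrite (_ : 9 = 3 * 3); last by ring.
  by apply: ler_pM; rewrite ?sumr_ge0//; exact: gam_row.
have S2 : \sum_i \sum_j \sum_k \sum_l (g i j * g k l) * (g i l * g j k) <= 27 * N%:R.
  apply: le_trans S1; apply: ler_sum => i _; apply: ler_sum => j _.
  rewrite exchange_big/=; apply: ler_sum => k _; apply: ler_sum => l _.
  by rewrite (gC l k).
apply: (@le_trans _ _ (\sum_i \sum_j \sum_k \sum_l (g i j * g k l) ^+ 2 +
   \sum_i \sum_j \sum_k \sum_l (g i j * g k l) * (g i k * g j l) +
   \sum_i \sum_j \sum_k \sum_l (g i j * g k l) * (g i l * g j k))); last by lra.
do 4 (rewrite -!big_split/=; apply: ler_sum => ? _).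
by rewrite le_eqVlt; apply/orP; left; apply/eqP; ring.
Qed.

Hypothesis N0 : (0 < N)%N.
Variable c : R.
Hypothesis c2 : 2 * c ^+ 2 * gamsq = 1.

(** By [c2] an element of variance 1 of the second Wiener chaos, written in the affine form to which
    [Ex_sqsum_affine] applies. *)
Definition chaos w := c * sqsum w + (- c * N%:R).

Lemma allmom_chaos : allmom P chaos.
Proof.
apply: allmomD; last exact: allmom_cst.
by apply: allmomZ; exact: allmom_sqsum.
Qed.

Lemma gamsq_geN : N%:R <= gamsq.
Proof.
apply: (@le_trans _ _ (\sum_(i < N) (1 : R))).
  by rewrite sumr_const card_ord.
apply: ler_sum => i _; rewrite (bigD1 i)//= gam1 expr1n lerDl.
by apply: sumr_ge0 => j _; rewrite sqr_ge0.
Qed.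

Lemma c2N : 2 * c ^+ 2 * N%:R <= 1.
Proof. by rewrite -[leRHS]c2 ler_wpM2l ?gamsq_geN// mulr_ge0// sqr_ge0. Qed.

(** The centering cancels the term in [N] of [Ex_sqsum_affine]. *)
Lemma Ex_chaosS k :
  E (fun w => chaos w ^+ k.+1) =
  k%:R * E (fun w => chaos w ^+ k.-1 * (2 * c ^+ 2 * bilin w)).
Proof.
have aC j : allmom P (fun w => chaos w ^+ j) by apply: allmomX; exact: allmom_chaos.
have aS := allmom_sqsum; have aB := allmom_bilin.
transitivity (c * E (fun w => sqsum w * chaos w ^+ k) - c * N%:R * E (fun w => chaos w ^+ k)).
  rewrite -!ExZ -?ExB; [|by allmom_solve..].
  by apply: Ex_ext => w; rewrite exprS {1}/chaos; ring.
rewrite (Ex_sqsum_affine c (- c * N%:R) k) -/chaos.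
have -> : E (fun w => chaos w ^+ k.-1 * (2 * c ^+ 2 * bilin w)) =
    2 * c ^+ 2 * E (fun w => chaos w ^+ k.-1 * bilin w).
  rewrite -ExZ; first by apply: Ex_ext => w; ring.
  exact: allmomM.
by rewrite /chaos; ring.
Qed.

(** Independent of [N] and of the correlations. With [K = 2m - 1], the first factor comes from
    [young_pow] with weight [1 / (2K)], the second from [Ex_sqsum_pow] and [6 c^2 N <= 3]. *)
Definition chaos_moment_bound (m : nat) : R :=
  (2 * (m.*2.-1)%:R) ^+ m * (3 ^+ m * \prod_(j < m) (1 + 6 * j%:R)).

Lemma young_pow (eta a b : R) m : 0 < eta -> 0 <= a -> 0 <= b ->
  a ^+ m * b <= eta * a ^+ m.+1 + (eta^-1) ^+ m * b ^+ m.+1.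
Proof.
move=> eta0 a0 b0; have [h|h] := leP b (eta * a).
  apply: (@le_trans _ _ (a ^+ m * (eta * a))).
    by rewrite ler_wpM2l// exprn_ge0.
  rewrite mulrCA -exprSr lerDl mulr_ge0// exprn_ge0// invr_ge0 ltW//.
apply: (@le_trans _ _ ((eta^-1 * b) ^+ m * b)).
  rewrite ler_wpM2r// lerXn2r ?nnegrE//; first by rewrite mulr_ge0// invr_ge0 ltW.
  by rewrite ler_pdivlMl// ltW.
by rewrite exprMn -mulrA -exprSr lerDr mulr_ge0 ?exprn_ge0// ltW.
Qed.

(** Absorption: bounding [bilin] by [3 * sqsum] and applying [young_pow] puts half of the moment
    itself on the right, from where it is moved to the left. *)
Lemma Ex_chaos_even m : E (fun w => chaos w ^+ m.*2) <= chaos_moment_bound m.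
Proof.
case: m => [|m].
  rewrite /chaos_moment_bound big_ord0 !expr0 !mulr1 -[leRHS](Ex_cst P).
  by under Ex_ext do rewrite expr0.
have aC j : allmom P (fun w => chaos w ^+ j) by apply: allmomX; exact: allmom_chaos.
have aS := allmom_sqsum; have aB := allmom_bilin.
set K := (m.+1.*2.-1)%:R : R.
have K0 : 0 < K by rewrite ltr0n.
pose Q w := 6 * c ^+ 2 * sqsum w.
have Q0 w : 0 <= Q w by rewrite mulr_ge0 ?sqsum_ge0// mulr_ge0// sqr_ge0.
have aQ : allmom P Q by exact: allmomZ.
have EQ : E (fun w => Q w ^+ m.+1) <= 3 ^+ m.+1 * \prod_(j < m.+1) (1 + 6 * j%:R).
  have -> : E (fun w => Q w ^+ m.+1) = (6 * c ^+ 2) ^+ m.+1 * E (fun w => sqsum w ^+ m.+1).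
    rewrite -ExZ; first by apply: Ex_ext => w; rewrite exprMn.
    exact: allmomX.
  apply: le_trans (ler_wpM2l _ (Ex_sqsum_pow m.+1 N0)) _.
    by rewrite exprn_ge0// mulr_ge0// sqr_ge0.
  rewrite mulrA -exprMn ler_wpM2r//.
    by apply: prodr_ge0 => j _; rewrite addr_ge0// mulr_ge0.
  have z0 : 0 <= 6 * c ^+ 2 * N%:R by rewrite mulr_ge0// mulr_ge0// sqr_ge0.
  rewrite lerXn2r ?nnegrE//.
  by have := c2N; lra.
rewrite doubleS Ex_chaosS -/K /=.
have h : E (fun w => chaos w ^+ m.*2 * (2 * c ^+ 2 * bilin w)) <=
   (2 * K)^-1 * E (fun w => chaos w ^+ m.+1.*2) + (2 * K) ^+ m * E (fun w => Q w ^+ m.+1).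
  rewrite -!ExZ -?ExD; [|by allmom_solve..].
    apply: Ex_le => [||w].
    + by apply: allmomM => //; exact: allmomZ.
    + by apply: allmomD; apply: allmomZ => //; exact: allmomX.
    + rewrite -!mul2n !exprM.
      have h := young_pow m (_ : 0 < (2 * K)^-1) (sqr_ge0 (chaos w)) (Q0 w).
      rewrite invrK in h; apply: le_trans (h _); last by rewrite invr_gt0 mulr_gt0.
      rewrite ler_wpM2l//; first by apply: exprn_ge0; exact: sqr_ge0.
      apply: (@le_trans _ _ (2 * c ^+ 2 * (3 * sqsum w))); last by rewrite /Q; lra.
      by rewrite ler_wpM2l ?(le_trans (ler_norm _) (bilin_le w))// mulr_ge0// sqr_ge0.
have h2 := ler_wpM2l (ltW K0) h.
have h3 : K * (2 * K)^-1 = 2^-1 by field; rewrite gt_eqF.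
rewrite mulrDr (mulrA K) h3 doubleS Ex_chaosS -/K /= in h2.
have h4 := ler_wpM2l (_ : 0 <= (2 * K) ^+ m.+1) EQ.
have {}h4 := h4 (exprn_ge0 _ (mulr_ge0 (ler0n _ 2) (ltW K0))).
rewrite /chaos_moment_bound -/K; apply: le_trans h4.
have -> : (2 * K) ^+ m.+1 * E (fun w => Q w ^+ m.+1) =
    2 * (K * ((2 * K) ^+ m * E (fun w => Q w ^+ m.+1))) by rewrite exprS; ring.
by lra.
Qed.

Lemma Ex_bilin_var : E (fun w => (2 * c ^+ 2 * bilin w - 1) ^+ 2) <= 54 / N%:R.
Proof.
have aB := allmom_bilin; have N1 : (0 : R) < N%:R by rewrite ltr0n.
have -> : E (fun w => (2 * c ^+ 2 * bilin w - 1) ^+ 2) =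
    (2 * c ^+ 2) ^+ 2 * E (fun w => bilin w ^+ 2) - 2 * (2 * c ^+ 2 * E bilin) + 1.
  rewrite -[X in _ + X](Ex_cst P) -!ExZ -?ExB -?ExD; [|by allmom_solve..].
  by apply: Ex_ext => w; ring.
rewrite Ex_bilin c2.
have := ler_wpM2l (_ : 0 <= (2 * c ^+ 2) ^+ 2) Ex_bilin2.
rewrite mulrDr -exprMn c2 expr1n => /(_ (sqr_ge0 _)) h.
have h2 : (2 * c ^+ 2) ^+ 2 * (54 * N%:R) <= 54 / N%:R.
  rewrite ler_pdivlMr// (_ : (2 * c ^+ 2) ^+ 2 * (54 * N%:R) * N%:R = 54 * (2 * c ^+ 2 * N%:R) ^+ 2); last by ring.
  have z0 : 0 <= 2 * c ^+ 2 * N%:R by rewrite mulr_ge0// mulr_ge0// sqr_ge0.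
  by rewrite ler_piMr// exprn_ile1 ?c2N.
by lra.
Qed.

(** The deviation of [2 c^2 bilin] from 1 is separated from the power of [chaos] by
    [2uv <= eta u^2 + v^2 / eta]; the weight [eta] stays free until the limit is taken. *)
Lemma Ex_chaos_rec k (eta : R) : 0 < eta ->
  `|E (fun w => chaos w ^+ k.+2) - k.+1%:R * E (fun w => chaos w ^+ k)| <=
  k.+1%:R * ((eta * chaos_moment_bound k + 54 / N%:R / eta) / 2).
Proof.
move=> eta0.
have aC j : allmom P (fun w => chaos w ^+ j) by apply: allmomX; exact: allmom_chaos.
have aB := allmom_bilin.
have aQ : allmom P (fun w => 2 * c ^+ 2 * bilin w - 1).
  by apply: allmomB; [exact: allmomZ|exact: allmom_cst].
rewrite Ex_chaosS/= -mulrBr normrM ger0_norm// ler_wpM2l//.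
have -> : E (fun w => chaos w ^+ k * (2 * c ^+ 2 * bilin w)) - E (fun w => chaos w ^+ k) =
    E (fun w => chaos w ^+ k * (2 * c ^+ 2 * bilin w - 1)).
  rewrite -ExB; first by apply: Ex_ext => w; ring.
  - by apply: allmomM => //; exact: allmomZ.
  - exact: aC.
apply: le_trans (Ex_norm _) _; first exact: allmomM.
apply: (@le_trans _ _ (E (fun w => eta / 2 * chaos w ^+ k.*2 +
    eta^-1 / 2 * (2 * c ^+ 2 * bilin w - 1) ^+ 2))).
  apply: Ex_le => [||w].
  - by apply: allmom_norm; exact: allmomM.
  - by apply: allmomD; apply: allmomZ => //; exact: allmomX.
  - rewrite -mul2n mulnC exprM; set x := chaos w ^+ k; set y := (_ - 1).
    rewrite normrM -(real_normK (num_real x)) -(real_normK (num_real y)).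
    have := normr_ge0 x; have := normr_ge0 y; move: `|x| `|y| => u v v0 u0.
    have i0 : 0 < eta^-1 by rewrite invr_gt0.
    have ei : eta * eta^-1 = 1 by rewrite divff// gt_eqF.
    have h : 0 <= eta^-1 * (eta * u - v) ^+ 2 by rewrite mulr_ge0 ?sqr_ge0// ltW.
    have e2 : eta^-1 * (eta * u - v) ^+ 2 = (eta * eta^-1) * (eta * u ^+ 2) - 2 * (eta * eta^-1) * (u * v) + eta^-1 * v ^+ 2.
      by ring.
    by rewrite e2 ei in h; lra.
rewrite ExD; [|by apply: allmomZ|by apply: allmomZ; exact: allmomX].
rewrite !ExZ; [|exact: allmomX|exact: aC].
have h1 := ler_wpM2l (_ : 0 <= eta / 2) (Ex_chaos_even k).
have h2 := ler_wpM2l (_ : 0 <= eta^-1 / 2) Ex_bilin_var.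
have {}h1 := h1 (divr_ge0 (ltW eta0) (ler0n _ 2)).
have z0 : 0 <= eta^-1 / 2 by rewrite divr_ge0 ?invr_ge0// ltW.
by have {}h2 := h2 z0; lra.
Qed.

End QuadraticForm.

(** * The method of moments for the normal law *)

Section CosTaylor.
Context {R : realType}.

Let scE (a b : R) : a *: (b : R^o) = a * b. Proof. by []. Qed.

Lemma is_derive_ge0_le (f f' : R -> R) (a b : R) :
  (forall x : R, is_derive x 1 f (f' x)) -> (forall x, a <= x -> 0 <= f' x) ->
  a <= b -> f a <= f b.
Proof.
move=> df f'0 ab.
apply: (@ger0_derive1_le _ f a b _ _ true false) => //.
- move=> x; rewrite in_itv/= => /andP[ax _].
  by rewrite derive1E; have [_ ->] := df x; rewrite f'0// ltW.
- apply: continuous_subspaceT => x.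
  apply: differentiable_continuous; apply/derivable1_diffP.
  by have [] := df x.
- by rewrite in_itv/= lexx.
- by rewrite in_itv/= lexx ab.
Qed.

Lemma is_derive_pow_fact (m : nat) (x : R) :
  is_derive x 1 (fun x => x ^+ m.+1 / m.+1`!%:R) (x ^+ m / m`!%:R).
Proof.
have -> : (fun x : R => x ^+ m.+1 / m.+1`!%:R) = (m.+1`!%:R^-1) \*: (id ^+ m.+1).
  by apply/funext => y; rewrite /= scE exprfctE mulrC.
apply: is_derive_eq.
rewrite !scE /= factS natrM mulr1; field.
by rewrite nat1r !pnatr_eq0 -lt0n fact_gt0.
Qed.

Lemma integrate_bound (f f' : R -> R) (m : nat) :
  (forall x : R, is_derive x 1 f (f' x)) -> f 0 = 0 ->
  (forall x, 0 <= x -> `|f' x| <= x ^+ m / m`!%:R) ->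
  forall x, 0 <= x -> `|f x| <= x ^+ m.+1 / m.+1`!%:R.
Proof.
move=> df f0 f'b x x0.
have dp := is_derive_pow_fact m.
have h1 : 0 <= x ^+ m.+1 / m.+1`!%:R - f x.
  have := @is_derive_ge0_le ((fun x => x ^+ m.+1 / m.+1`!%:R) - f)
    (fun x => x ^+ m / m`!%:R - f' x) 0 x _ _ x0.
  rewrite !fctE f0 expr0n/= mul0r subr0; apply => y y0.
  by rewrite subr_ge0 (le_trans (ler_norm _))// f'b.
have h2 : 0 <= x ^+ m.+1 / m.+1`!%:R + f x.
  have := @is_derive_ge0_le ((fun x => x ^+ m.+1 / m.+1`!%:R) + f)
    (fun x => x ^+ m / m`!%:R + f' x) 0 x _ _ x0.
  rewrite !fctE f0 expr0n/= mul0r addr0; apply => y y0.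
  have := f'b y y0; rewrite ler_norml => /andP[+ _].
  by rewrite -subr_ge0 opprK addrC.
by rewrite ler_norml; apply/andP; split; lra.
Qed.

(** The phase makes the [k]-th derivative at 0 equal to [cos (phi + k pi / 2)], which avoids parity
    cases: the derivative of a remainder is the previous remainder with a shifted phase. *)
Definition cos_rem (m : nat) (phi x : R) :=
  cos (phi + x) - \sum_(k < m) cos (phi + k%:R * (pi / 2)) * (x ^+ k / k`!%:R).

Lemma is_derive_cos_shift (phi x : R) :
  is_derive x 1 (fun x => cos (phi + x)) (cos (phi + pi / 2 + x)).
Proof.
have -> : (fun x => cos (phi + x)) = cos \o (cst phi + id) by [].
apply: is_derive_eq; rewrite /= add0r mulr1 -[phi + pi / 2 + x]addrA (addrC (pi / 2)) addrA.
by rewrite cosDpihalf.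
Qed.

Lemma is_derive_cos_rem (m : nat) (phi x : R) :
  is_derive x 1 (cos_rem m.+1 phi) (cos_rem m (phi + pi / 2) x).
Proof.
have -> : cos_rem m.+1 phi = (fun x => cos (phi + x)) - cst (cos phi) -
    \sum_(k < m) (cos (phi + k.+1%:R * (pi / 2)) \*: (fun x => x ^+ k.+1 / k.+1`!%:R)).
  apply/funext => y; rewrite /cos_rem big_ord_recl /= expr0 fact0 divr1 mulr1 mul0r addr0.
  rewrite opprD addrA !fctE; congr (_ - _).
  by rewrite fct_sumE; apply: eq_bigr => k _.
have d1 := is_derive_cos_shift phi x.
have d2 (k : 'I_m) : is_derive x 1
    (cos (phi + k.+1%:R * (pi / 2)) \*: (fun x => x ^+ k.+1 / k.+1`!%:R))
    (cos (phi + k.+1%:R * (pi / 2)) *: (x ^+ k / k`!%:R)).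
  by apply: is_deriveZ; exact: is_derive_pow_fact.
apply: is_derive_eq.
rewrite subr0 /cos_rem; congr (_ - _); apply: eq_bigr => k _; rewrite scE.
by rewrite -[k.+1%:R]nat1r mulrDl mul1r addrA.
Qed.

Lemma cos_rem0 m phi : cos_rem m.+1 phi 0 = 0.
Proof.
rewrite /cos_rem big_ord_recl/= expr0 fact0 divr1 mulr1 mul0r !addr0.
rewrite big1 ?addr0 ?subrr// => k _.
by rewrite expr0n /= mul0r mulr0.
Qed.

Lemma cos_rem_le m phi x : `|cos_rem m phi x| <= `|x| ^+ m / m`!%:R.
Proof.
elim: m phi x => [|m IH] phi x.
  by rewrite /cos_rem big_ord0 subr0 expr0 fact0 divr1 cos_max.
have [x0|x0] := leP 0 x.
  rewrite (ger0_norm x0); apply: (@integrate_bound (cos_rem m.+1 phi) (cos_rem m (phi + pi / 2))) => //.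
  - exact: is_derive_cos_rem.
  - exact: cos_rem0.
  - by move=> y y0; rewrite -{2}(ger0_norm y0).
rewrite (ltr0_norm x0) -{1}(opprK x).
apply: (@integrate_bound (cos_rem m.+1 phi \o -%R)
  (fun y => cos_rem m (phi + pi / 2) (- y) * -1)).
- move=> y; apply: is_derive1_comp; exact: is_derive_cos_rem.
- by rewrite /= oppr0; exact: cos_rem0.
- by move=> y y0; rewrite mulrN1 normrN -{2}(ger0_norm y0) -[`|y|]normrN.
- by rewrite oppr_ge0 ltW.
Qed.

End CosTaylor.

Section Moments.
Context {R : realType}.

Fixpoint normal_moment (k : nat) : R :=
  if k is k'.+1 then
    if k' is k''.+1 then k'%:R * normal_moment k'' else 0
  else 1.

Lemma normal_moment_even j :
  normal_moment j.*2 * (2 ^+ j * j`!%:R) = (j.*2)`!%:R.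
Proof.
elim: j => [|j IH]; first by rewrite double0 fact0 expr0 !mul1r.
rewrite doubleS [normal_moment _]/= -/(normal_moment j.*2).
have e : (j.*2.+2)`!%:R = j.*2.+2%:R * j.*2.+1%:R * (j.*2)`!%:R :> R.
  by rewrite !factS !natrM mulrA.
rewrite e -IH exprS factS natrM.
have -> : j.*2.+2%:R = 2 * j.+1%:R :> R by rewrite -natrM mul2n doubleS.
by ring.
Qed.

(* Taylor's bound makes the error uniform in [n]: it is controlled by the even
   moments, whose limits [t^2j m_2j / (2j)! = (t^2/2)^j / j!] tend to 0. *)
Lemma cvg_normal_moment_tail (t : R) :
  (t ^+ j.*2 * normal_moment j.*2 / (j.*2)`!%:R) @[j --> \oo] --> (0 : R).
Proof.
have -> : (fun j => t ^+ j.*2 * normal_moment j.*2 / (j.*2)`!%:R) =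
    exp_coeff (t ^+ 2 / 2).
  apply/funext => j; rewrite exp_coeffE -(normal_moment_even j) exprMn -exprM mul2n.
  have m0 : normal_moment j.*2 != 0.
    apply/eqP => h; have := normal_moment_even j; rewrite h mul0r => /esym/eqP.
    by rewrite pnatr_eq0 -leqn0 leqNgt fact_gt0.
  rewrite exprVn; field; rewrite m0 /= expf_neq0//= pnatr_eq0.
  by rewrite -lt0n fact_gt0.
exact/cvg_series_cvg_0/is_cvg_series_exp_coeff.
Qed.

End Moments.

(** * Trigonometric polynomials close to a step *)

Section TrigPoly.
Context {R : realType}.

(** Frequencies are arbitrary reals, and the phase provides sines and constants. *)
Inductive trig_poly : (R -> R) -> Prop :=
| trig_cos t phi : trig_poly (fun x => cos (phi + t * x))
| trig_lin c f g : trig_poly f -> trig_poly g ->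
    trig_poly (fun x => f x + c * g x).

Lemma trig_ext f g : f =1 g -> trig_poly f -> trig_poly g.
Proof. by move=> /funext ->. Qed.

Lemma trig_cst c : trig_poly (fun=> c).
Proof.
apply: trig_ext (trig_lin (c - 1) (trig_cos 0 0) (trig_cos 0 0)) => x.
by rewrite mul0r addr0 cos0; ring.
Qed.

Lemma trig_mul_cos f t phi : trig_poly f ->
  trig_poly (fun x => f x * cos (phi + t * x)).
Proof.
elim=> {f} [u psi|c f g _ tf _ tg].
  have := trig_lin 1 (trig_cos (u + t) (psi + phi)) (trig_cos (u - t) (psi - phi)).
  (* Halves the product-to-sum formula, as [h - h / 2]. *)
  move=> h; have {}h := trig_lin (-1/2) h h; apply: trig_ext h => x.
  have -> : psi + phi + (u + t) * x = (psi + u * x) + (phi + t * x) by ring.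
  have -> : psi - phi + (u - t) * x = (psi + u * x) - (phi + t * x) by ring.
  by rewrite cosD cosB; field.
by apply: trig_ext (trig_lin c tf tg) => x; ring.
Qed.

Lemma trigM f g : trig_poly f -> trig_poly g -> trig_poly (fun x => f x * g x).
Proof.
move=> tf; elim=> {g} [t phi|c g h _ tg _ th]; first exact: trig_mul_cos.
by apply: trig_ext (trig_lin c tg th) => x; ring.
Qed.

Lemma trigX f k : trig_poly f -> trig_poly (fun x => f x ^+ k).
Proof.
move=> tf; elim: k => [|k IH]; first exact: trig_cst.
by apply: trig_ext (trigM tf IH) => x; rewrite exprS.
Qed.

Lemma trig_sin t phi : trig_poly (fun x => sin (phi + t * x)).
Proof.
apply: trig_ext (trig_cos t (phi - pi / 2)) => x.
by rewrite addrAC cosBpihalf.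
Qed.

Lemma trig_measurable f : trig_poly f -> measurable_fun setT f.
Proof.
elim=> {f} [t phi|c f g _ tf _ tg].
  apply: measurableT_comp; last by apply: measurable_funD => //; exact: measurable_funM.
  by apply: continuous_measurable_fun; exact: continuous_cos.
by apply: measurable_funD => //; exact: measurable_funM.
Qed.

Lemma trig_bounded f : trig_poly f -> exists C, forall x, `|f x| <= C.
Proof.
elim=> {f} [t phi|c f g _ [C1 h1] _ [C2 h2]].
  by exists 1 => x; exact: cos_max.
exists (C1 + `|c| * C2) => x; rewrite (le_trans (ler_normD _ _))// lerD// normrM.
by rewrite ler_wpM2l.
Qed.

(* [v |-> 1 - (1 - v^m)^(2^m)] approximates the indicator of [1/2, 1] on [0, 1]. *)
Lemma step_poly (q : R) (eps : R) : 0 <= q < 1 -> 0 < eps ->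
  exists m : nat, (forall v, 0 <= v -> 2 * v <= q -> 1 - (1 - v ^+ m) ^+ (2 ^ m) <= eps) /\
    (forall v, v <= 1 -> 1 <= q * (2 * v) -> (1 - v ^+ m) ^+ (2 ^ m) <= eps).
Proof.
move=> /andP[q0 q1] eps0.
have [m hm] : exists m : nat, q ^+ m <= eps.
  have qn : `|q| < 1 by rewrite ger0_norm.
  have /cvgr0Pnorm_le/(_ _ eps0) [N _ hN] := cvg_expr qn; exists N.
  by have := hN N (leqnn N); rewrite /= normrX ger0_norm.
exists m; split=> v h1 h2.
  have v1 : v <= 1 by lra.
  have vm : 0 <= v ^+ m <= 1 by rewrite exprn_ge0//= exprn_ile1.
  have bern n (u : R) : 0 <= u <= 1 -> 1 - n%:R * u <= (1 - u) ^+ n.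
    move=> /andP[u0 u1]; elim: n => [|n IH]; first by rewrite mul0r subr0 expr0.
    rewrite exprS; apply: le_trans (ler_wpM2l _ IH); last by lra.
    rewrite -natr1; have : 0 <= n%:R * u ^+ 2 by rewrite mulr_ge0// sqr_ge0.
    by nra.
  have := bern (2 ^ m)%N _ vm; rewrite natrX -exprMn => h3.
  have : (2 * v) ^+ m <= q ^+ m by rewrite lerXn2r ?nnegrE// mulr_ge0.
  by lra.
have v0 : 0 <= v by nra.
have vm : 0 <= v ^+ m <= 1 by rewrite exprn_ge0//= exprn_ile1.
have bern n (u : R) : 0 <= u -> 1 + n%:R * u <= (1 + u) ^+ n.
  move=> u0; elim: n => [|n IH]; first by rewrite mul0r addr0 expr0.
  rewrite exprS; apply: le_trans (ler_wpM2l _ IH); last by lra.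
  rewrite -natr1; have : 0 <= n%:R * u ^+ 2 by rewrite mulr_ge0// sqr_ge0.
  by nra.
have /andP[vm0 vm1] := vm.
set A := (1 - v ^+ m) ^+ (2 ^ m).
have A0 : 0 <= A by rewrite exprn_ge0// subr_ge0.
(* [(1 - u)^n (1 + u)^n <= 1] turns Bernoulli's lower bound on [(1 + u)^n] into an upper bound on
   [(1 - u)^n]. *)
have hA : A * (1 + v ^+ m) ^+ (2 ^ m) <= 1.
  rewrite -exprMn exprn_ile1//; nra.
have h3 : (2 * v) ^+ m <= (1 + v ^+ m) ^+ (2 ^ m).
  have := bern (2 ^ m)%N _ vm0; rewrite natrX -exprMn; lra.
have h4 : A * (2 * v) ^+ m <= 1.
  by rewrite (le_trans _ hA)// ler_wpM2l.
have h5 : 1 <= q ^+ m * (2 * v) ^+ m.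
  by rewrite -exprMn exprn_ege1.
apply: le_trans hm; rewrite -[leLHS]mulr1 (le_trans (ler_wpM2l A0 h5))//.
by rewrite mulrCA ler_piMr// exprn_ge0.
Qed.

(** Applies [step_poly] to [v x = (1 + sin ((x - c) / L)) / 2]. The scale [L] is so large that, for
    [|x| <= K], the argument stays where the sine increases. Beyond [K] the function oscillates, and
    only its range [0, 1] is controlled. *)
Lemma step_trig (c delta eps K : R) : 0 < delta -> 0 < eps ->
  exists h, [/\ trig_poly h, (forall x, 0 <= h x <= 1),
    (forall x, `|x| <= K -> x <= c - delta -> h x <= eps) &
    (forall x, `|x| <= K -> c + delta <= x -> 1 - h x <= eps)].
Proof.
move=> d0 e0.
pose L := `|K| + `|c| + delta.
have L0 : 0 < L by rewrite ltr_wpDl// addr_ge0.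
have pi2 : (1 : R) <= pi / 2 by exact: pihalf_ge1.
have dL : 0 < delta / L <= 1.
  rewrite divr_gt0//= ler_pdivrMr// mul1r lerDr addr_ge0//.
pose s := sin (delta / L).
have s0 : 0 < s.
  by rewrite sin_gt0_pi//; have := dL; case/andP; lra.
have s1 : s <= 1 by exact: sin_le1.
(* Since [1 - s <= 1 / (1 + s)], the single ratio [1 / (1 + s)] serves on both sides of [c]. *)
have q01 : 0 <= (1 + s)^-1 < 1 by rewrite invr_ge0 invf_lt1; lra.
have [m [hm1 hm2]] := step_poly q01 e0.
pose v x := (1 + sin (- c / L + L^-1 * x)) / 2.
have v01 x : 0 <= v x <= 1.
  have := sin_geN1 (- c / L + L^-1 * x); have := sin_le1 (- c / L + L^-1 * x).
  by rewrite /v; lra.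
have tv : trig_poly v.
  apply: trig_ext (trig_lin 2^-1 (trig_cst 2^-1) (trig_sin L^-1 (- c / L))) => x.
  by rewrite /v; field.
have mono x y : `|x - c| <= delta \/ `|x| <= K -> `|y - c| <= delta \/ `|y| <= K -> x <= y ->
    sin (- c / L + L^-1 * x) <= sin (- c / L + L^-1 * y).
  move=> xK yK xy.
  have bnd z : `|z - c| <= delta \/ `|z| <= K -> - c / L + L^-1 * z \in `[ - (pi / 2), pi / 2].
    move=> hz; have -> : - c / L + L^-1 * z = (z - c) / L by field; rewrite gt_eqF.
    rewrite in_itv/=.
    have : `|z - c| <= L.
      case: hz => hz; first by rewrite (le_trans hz)// lerDr addr_ge0.
      by rewrite (le_trans (ler_normB _ _))// /L; have := ler_norm K; lra.
    rewrite ler_norml => /andP[h1 h2].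
    apply/andP; split.
      by rewrite ler_pdivlMr//; nra.
    by rewrite ler_pdivrMr//; nra.
  move: xy; rewrite le_eqVlt => /predU1P[-> //|xy]; apply/ltW.
  by rewrite ltr_sin ?bnd// ltrD2l ltr_pM2l ?invr_gt0.
have sinm : sin (- c / L + L^-1 * (c - delta)) = - s.
  by rewrite /s -sinN; congr sin; field; rewrite gt_eqF.
have sinp : sin (- c / L + L^-1 * (c + delta)) = s.
  by rewrite /s; congr sin; field; rewrite gt_eqF.
exists (fun x => 1 - (1 - v x ^+ m) ^+ (2 ^ m)); split.
- have tX : trig_poly (fun x => (1 - v x ^+ m) ^+ (2 ^ m)).
    apply: trigX; apply: trig_ext (trig_lin (-1) (trig_cst 1) (trigX m tv)) => x.
    by rewrite mulN1r.
  by apply: trig_ext (trig_lin (-1) (trig_cst 1) tX) => x; rewrite mulN1r.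
- move=> x; have /andP[v0 v1] := v01 x.
  have h0 : 0 <= 1 - v x ^+ m by rewrite subr_ge0 exprn_ile1.
  have h1 : 1 - v x ^+ m <= 1 by rewrite gerBl exprn_ge0.
  by rewrite subr_ge0 exprn_ile1//= gerBl exprn_ge0.
- move=> x xK xc; have /andP[v0 v1] := v01 x.
  apply: hm1 => //.
  have : sin (- c / L + L^-1 * x) <= - s.
    rewrite -sinm; apply: mono => //; [by right|left].
    by rewrite addrAC subrr add0r normrN gtr0_norm.
  have -> : 2 * v x = 1 + sin (- c / L + L^-1 * x) by rewrite /v; field.
  by move=> h; rewrite -[leRHS]div1r ler_pdivlMr; nra.
- move=> x xK xc; have /andP[v0 v1] := v01 x.
  rewrite subKr; apply: hm2 => //.
  have : s <= sin (- c / L + L^-1 * x).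
    rewrite -sinp; apply: mono => //; [left|by right].
    by rewrite addrAC subrr add0r gtr0_norm.
  have -> : 2 * v x = 1 + sin (- c / L + L^-1 * x) by rewrite /v; field.
  move=> h; rewrite mulrC ler_pdivlMr; lra.
Qed.

End TrigPoly.

Section Normal01.
Context {R : realType}.
Local Notation P0 := (normal_prob (0 : R) 1).

Lemma normal01_moments : allmom P0 (@id R) /\
  forall k, Ex P0 (fun x => GRing.exp x k) = normal_moment k.
Proof.
have mid : measurable_fun setT (@id (measurableTypeR R)) by exact: measurable_id.
pose X : {RV P0 >-> measurableTypeR R} :=
  HB.pack (@id (measurableTypeR R)) (isMeasurableFun.Build _ _ _ _ _ mid).
have H := @pushforward_moment _ _ R P0 X 0 1 ltr01 (fun A _ => erefl).
have {}H k : P0.-integrable setT (fun w => (GRing.exp w k)%:E) /\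
    Ex P0 (fun w => GRing.exp w k) =
    Rintegral (@lebesgue_measure R) setT (fun x => GRing.exp (x - 0) k * normal_pdf 0 1 x).
  have [h1 h2] := H k; split; [move: h1|rewrite -h2].
    by apply: eq_integrable => // w _ /=; rewrite subr0.
  by apply: Ex_ext => w; rewrite /= subr0.
split; first by split=> [|k]; [exact: mid|have [] := H k].
elim/ltn_ind => -[|[|k]] IH.
- by rewrite -[RHS](Ex_cst P0); apply: Ex_ext => w; rewrite expr0.
- by have [_ ->] := H 1%N; rewrite (normal_moment_rec_gen 0 ltr01 0) !mul0r.
have [_ ->] := H k.+2; rewrite (normal_moment_rec_gen 0 ltr01 k.+1)/= expr1n mulr1.
by rewrite -IH//; have [_ <-] := H k.
Qed.

End Normal01.

Lemma cvgn_sum (R : realType) (I : Type) (r : seq I) (u : I -> nat -> R) (l : I -> R) :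
  (forall i, u i n @[n --> \oo] --> l i) ->
  \sum_(i <- r) u i n @[n --> \oo] --> \sum_(i <- r) l i.
Proof.
move=> ul; elim: r => [|i r IH].
  by rewrite big_nil; under eq_fun do rewrite big_nil; exact: cvg_cst.
by rewrite big_cons; under eq_fun do rewrite big_cons; exact: cvgD.
Qed.

(** * From moments to convergence in distribution *)

Section MethodOfMoments.
Context {d : measure_display} {T : measurableType d} {R : realType}.
Variable P : probability T R.
Variable X : nat -> T -> R.
Hypothesis aX : forall n, allmom P (X n).
Hypothesis cX : forall k,
  Ex P (fun w => GRing.exp (X n w) k) @[n --> \oo] --> (normal_moment k : R).
Local Notation P0 := (normal_prob (0 : R) 1).

Lemma trig_allmom d' (T' : measurableType d') (Q : probability T' R)
  (f : T' -> R) (h : R -> R) : measurable_fun setT f -> trig_poly h ->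
  allmom Q (fun w => h (f w)).
Proof.
move=> mf th; have [C hC] := trig_bounded th.
apply: (allmom_dom _ (allmom_cst Q C)).
  by apply: measurableT_comp mf; exact: trig_measurable.
by move=> w; rewrite (le_trans (hC _))// ler_norm.
Qed.

(** The order [m.*2] is even, so the remainder is bounded by a moment without absolute values. *)
Lemma Ex_cos_taylor d' (T' : measurableType d') (Q : probability T' R)
  (f : T' -> R) t phi m : allmom Q f ->
  `|Ex Q (fun w => cos (phi + t * f w)) -
    \sum_(k < m.*2) cos (phi + k%:R * (pi / 2)) * t ^+ k / k`!%:R * Ex Q (fun w => f w ^+ k)|
  <= t ^+ m.*2 * Ex Q (fun w => f w ^+ m.*2) / (m.*2)`!%:R.
Proof.
move=> af; have mf := allmom_meas af.
have afX k : allmom Q (fun w => f w ^+ k) by exact: allmomX.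
have acos : allmom Q (fun w => cos (phi + t * f w)).
  exact: (@trig_allmom _ _ Q f _ mf (trig_cos t phi)).
have asum : allmom Q (fun w => \sum_(k < m.*2)
    cos (phi + k%:R * (pi / 2)) * t ^+ k / k`!%:R * f w ^+ k).
  by apply: allmom_sum => k _; exact: allmomZ.
have -> : \sum_(k < m.*2) cos (phi + k%:R * (pi / 2)) * t ^+ k / k`!%:R *
      Ex Q (fun w => f w ^+ k) =
    Ex Q (fun w => \sum_(k < m.*2) cos (phi + k%:R * (pi / 2)) * t ^+ k / k`!%:R * f w ^+ k).
  rewrite Ex_sum; last by move=> k _; exact: allmomZ.
  by apply: eq_bigr => k _; rewrite ExZ.
rewrite -ExB//; apply: le_trans (Ex_norm _) _; first exact: allmomB.
rewrite mulrAC -ExZ//; apply: Ex_le.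
- by apply: allmom_norm; exact: allmomB.
- exact: allmomZ.
move=> w; have := cos_rem_le m.*2 phi (t * f w).
rewrite -[`|_| ^+ _](ger0_norm (exprn_ge0 _ (normr_ge0 _))) -normrX normr_id.
have e : (t * f w) ^+ m.*2 = t ^+ m.*2 * f w ^+ m.*2 by rewrite exprMn.
have p0 : 0 <= (t * f w) ^+ m.*2 by rewrite -mul2n exprM exprn_ge0// sqr_ge0.
rewrite (ger0_norm p0) e [leRHS]mulrAC; congr (`|_| <= _).
rewrite /cos_rem; congr (_ - _); apply: eq_bigr => k _.
by rewrite exprMn; ring.
Qed.

Lemma cvg_Ex_cos t phi :
  Ex P (fun w => cos (phi + t * X n w)) @[n --> \oo] -->
  Ex P0 (fun x => cos (phi + t * x)).
Proof.
have [a0 e0] := normal01_moments (R := R).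
apply/cvgrPdist_le => eps eps0.
have e4 : 0 < eps / 4 by rewrite divr_gt0.
have [m hm] : exists m, t ^+ m.*2 * normal_moment m.*2 / (m.*2)`!%:R <= eps / 4.
  have /cvgr0Pnorm_le/(_ _ e4) [N _ hN] := cvg_normal_moment_tail t; exists N.
  by rewrite (le_trans (ler_norm _))// (hN N)//=.
pose S (mom : nat -> R) := \sum_(k < m.*2) cos (phi + k%:R * (pi / 2)) * t ^+ k / k`!%:R * mom k.
have cS : S (fun k => Ex P (fun w => GRing.exp (X n w) k)) @[n --> \oo] --> S normal_moment.
  apply: cvgn_sum => k; apply: cvgM; [exact: cvg_cst|exact: cX].
have cT : t ^+ m.*2 * Ex P (fun w => GRing.exp (X n w) m.*2) / (m.*2)`!%:R @[n --> \oo] -->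
    t ^+ m.*2 * normal_moment m.*2 / (m.*2)`!%:R.
  by apply: cvgM; [apply: cvgM; [exact: cvg_cst|exact: cX]|exact: cvg_cst].
move/cvgrPdist_le : cS => /(_ _ e4) cS; move/cvgrPdist_le : cT => /(_ _ e4) cT.
near=> n.
have hS : `|S normal_moment - S (fun k => Ex P (fun w => GRing.exp (X n w) k))| <= eps / 4.
  by near: n.
have hT : `|t ^+ m.*2 * normal_moment m.*2 / (m.*2)`!%:R -
    t ^+ m.*2 * Ex P (fun w => GRing.exp (X n w) m.*2) / (m.*2)`!%:R| <= eps / 4.
  by near: n.
have h1 := Ex_cos_taylor t phi m (aX n).
have h0 := Ex_cos_taylor t phi m a0.
rewrite e0 in h0.
have {}h0 : `|Ex P0 (fun x => cos (phi + t * x)) - S normal_moment| <= eps / 4.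
  apply: le_trans hm; apply: le_trans h0.
  by rewrite le_eqVlt; apply/orP; left; apply/eqP; congr (`|_ - _|); apply: eq_bigr => k _; rewrite e0.
move: h1 h0 hS hT; rewrite -/(S (fun k => Ex P (fun w => GRing.exp (X n w) k))).
rewrite !ler_norml => /andP[? ?] /andP[? ?] /andP[? ?] /andP[? ?].
by apply/andP; split; lra.
Unshelve. all: by end_near. Qed.

Lemma cvg_Ex_trig h : trig_poly h ->
  Ex P (fun w => h (X n w)) @[n --> \oo] --> Ex P0 h.
Proof.
have [a0 _] := normal01_moments (R := R).
elim=> {h} [t phi|c f g tf cf tg cg]; first exact: cvg_Ex_cos.
have mX n : measurable_fun setT (X n) by exact: allmom_meas.
have -> : Ex P0 (fun x => f x + c * g x) = Ex P0 f + c * Ex P0 g.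
  rewrite ExD ?ExZ//; first exact: (trig_allmom P0 (allmom_meas a0) tg).
  + exact: (trig_allmom P0 (allmom_meas a0) tf).
  + by apply: allmomZ; exact: (trig_allmom P0 (allmom_meas a0) tg).
have -> : (fun n => Ex P (fun w => f (X n w) + c * g (X n w))) =
    (fun n => Ex P (fun w => f (X n w)) + c * Ex P (fun w => g (X n w))).
  apply/funext => n; rewrite ExD ?ExZ//; first exact: (trig_allmom P (mX n) tg).
  + exact: (trig_allmom P (mX n) tf).
  + by apply: allmomZ; exact: (trig_allmom P (mX n) tg).
by apply: cvgD => //; apply: cvgM => //; exact: cvg_cst.
Qed.

Lemma Ex_indic d' (T' : measurableType d') (Q : probability T' R) (A : set T') :
  measurable A -> Ex Q (\1_A) = fine (Q A).
Proof. by move=> mA; rewrite /Ex /Rintegral integral_indic// setIT. Qed.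

Lemma allmom_indic d' (T' : measurableType d') (Q : probability T' R) (A : set T') :
  measurable A -> allmom Q (\1_A).
Proof.
move=> mA; apply: (allmom_dom _ (allmom_cst Q 1)); first exact: measurable_indic.
by move=> w; rewrite normr1 indicE; case: (_ \in _); rewrite ?normr1 ?normr0.
Qed.

Lemma measurable_le_set d' (T' : measurableType d') (f : T' -> R) (x : R) :
  measurable_fun setT f -> measurable [set w | f w <= x].
Proof.
move=> mf; rewrite -[X in measurable X]setTI.
have := mf measurableT _ (measurable_itv `]-oo, x]).
by congr measurable; apply/seteqP; split => w /=; rewrite in_itv.
Qed.

(** [1 - h] dominates the indicator of [f w <= x] up to [eps] where [|f w| <= K]; elsewhere
    [(f w / K)^2] exceeds 1. *)
Lemma prob_le_step d' (T' : measurableType d') (Q : probability T' R)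
    (f : T' -> R) (h : R -> R) (x eps K : R) :
  allmom Q f -> trig_poly h -> 0 < eps -> 0 < K -> (forall y, 0 <= h y <= 1) ->
  (forall y, `|y| <= K -> y <= x -> h y <= eps) ->
  fine (Q [set w | f w <= x]) <=
    1 - Ex Q (fun w => h (f w)) + eps + Ex Q (fun w => f w ^+ 2) / K ^+ 2.
Proof.
move=> af th e0 K0 h01 hx; have mf := allmom_meas af.
have ms := measurable_le_set x mf.
have ah := trig_allmom Q mf th.
have K2 : 0 < K ^+ 2 by rewrite exprn_gt0.
rewrite -Ex_indic// -[X in X - _](Ex_cst Q) -ExB; [|exact: allmom_cst|exact: ah].
rewrite -[X in _ + X + _](Ex_cst Q) -ExD; [|by allmom_solve..].
rewrite mulrC -ExZ; last by allmom_solve.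
rewrite -ExD; [|by allmom_solve..].
apply: Ex_le => [||w]; [exact: allmom_indic|by allmom_solve|].
have /andP[h0 h1] := h01 (f w).
have q0 : 0 <= (K ^+ 2)^-1 * f w ^+ 2 by rewrite mulr_ge0 ?sqr_ge0// invr_ge0 ltW.
rewrite indicE; case: (boolP (w \in _)) => [|_]; last by rewrite mulr0n; lra.
rewrite inE/= => fx; have [fK|fK] := leP `|f w| K.
  by have := hx _ fK fx; rewrite mulr1n; lra.
have : 1 <= (K ^+ 2)^-1 * f w ^+ 2.
  rewrite ler_pdivlMl// mulr1 -[leRHS]real_normK ?num_real//.
  by rewrite lerXn2r ?nnegrE// ltW.
by rewrite mulr1n; lra.
Qed.

Lemma prob_ge_step d' (T' : measurableType d') (Q : probability T' R)
    (f : T' -> R) (h : R -> R) (x eps K : R) :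
  allmom Q f -> trig_poly h -> 0 < eps -> 0 < K -> (forall y, 0 <= h y <= 1) ->
  (forall y, `|y| <= K -> x <= y -> 1 - h y <= eps) ->
  1 - Ex Q (fun w => h (f w)) <=
  fine (Q [set w | f w <= x]) + eps + Ex Q (fun w => f w ^+ 2) / K ^+ 2.
Proof.
move=> af th e0 K0 h01 hx; have mf := allmom_meas af.
have ms := measurable_le_set x mf.
have ah := trig_allmom Q mf th.
have ai := allmom_indic Q ms.
have K2 : 0 < K ^+ 2 by rewrite exprn_gt0.
rewrite -Ex_indic// -[X in X - _](Ex_cst Q) -ExB; [|exact: allmom_cst|exact: ah].
rewrite -[X in _ + X + _](Ex_cst Q) -ExD; [|by allmom_solve..].
rewrite mulrC -ExZ; last by allmom_solve.
rewrite -ExD; [|by allmom_solve..].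
apply: Ex_le => [||w]; [by allmom_solve..|].
have /andP[h0 h1] := h01 (f w).
have q0 : 0 <= (K ^+ 2)^-1 * f w ^+ 2 by rewrite mulr_ge0 ?sqr_ge0// invr_ge0 ltW.
rewrite indicE; case: (boolP (w \in _)) => [_|]; first by rewrite mulr1n; lra.
rewrite notin_setE/= => /negP; rewrite -ltNge => fx.
have [fK|fK] := leP `|f w| K.
  by have := hx _ fK (ltW fx); rewrite mulr0n; lra.
have : 1 <= (K ^+ 2)^-1 * f w ^+ 2.
  rewrite ler_pdivlMl// mulr1 -[leRHS]real_normK ?num_real//.
  by rewrite lerXn2r ?nnegrE// ltW.
by rewrite mulr0n; lra.
Qed.

(** The step is placed between [x] and [x + delta] for the upper bound, between [x - delta] and [x]
    for the lower one, so no continuity is involved yet. *)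
Lemma cdf_sandwich (x delta eta : R) : 0 < delta -> 0 < eta ->
  \forall n \near \oo,
    fine (P [set w | X n w <= x]) <= fine (P0 [set y | y <= x + delta]) + eta /\
    fine (P0 [set y | y <= x - delta]) <= fine (P [set w | X n w <= x]) + eta.
Proof.
move=> d0 eta0; have [a0 e0] := normal01_moments (R := R).
have d2 : 0 < delta / 2 by rewrite divr_gt0.
have e8 : 0 < eta / 8 by rewrite divr_gt0.
(* The 2 bounds the second moments of [X n], eventually, as well as that of the limit. *)
have [K K0 hK] : exists2 K : R, 0 < K & 2 / K ^+ 2 <= eta / 8.
  exists (1 + 16 / eta); first by rewrite ltr_pwDl// divr_ge0// ltW.
  set z := 16 / eta; have z0 : 0 < z by rewrite divr_gt0.
  have ez : eta = 16 / z by rewrite /z; field; rewrite gt_eqF.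
  rewrite ler_pdivrMr; last by rewrite exprn_gt0// addr_gt0.
  rewrite ez (_ : 16 / z / 8 * (1 + z) ^+ 2 = 2 * (2 + z + z^-1)); last by field; rewrite gt_eqF.
  have zi : 0 < z^-1 by rewrite invr_gt0.
  by lra.
have E2 : Ex P0 (fun y : R => y ^+ 2) = 1 by rewrite e0 /= mulr1.
have [h [th h01 hl hr]] := @step_trig R (x + delta / 2) (delta / 2) (eta / 8) K d2 e8.
have [g [tg g01 gl gr]] := @step_trig R (x - delta / 2) (delta / 2) (eta / 8) K d2 e8.
have c2 : Ex P (fun w => X n w ^+ 2) @[n --> \oo] --> (1 : R).
  by have := @cX 2%N; rewrite /= mulr1.
have ch := cvg_Ex_trig th; have cg := cvg_Ex_trig tg.
move/cvgrPdist_le : c2 => /(_ _ ltr01) c2.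
move/cvgrPdist_le : ch => /(_ _ e8) ch; move/cvgrPdist_le : cg => /(_ _ e8) cg.
near=> n.
have h2 : `|1 - Ex P (fun w => X n w ^+ 2)| <= 1 by near: n.
have hh : `|Ex P0 h - Ex P (fun w => h (X n w))| <= eta / 8 by near: n.
have hg : `|Ex P0 g - Ex P (fun w => g (X n w))| <= eta / 8 by near: n.
have K2 : 0 < (K ^+ 2)^-1 by rewrite invr_gt0 exprn_gt0.
have EX2 : Ex P (fun w => X n w ^+ 2) / K ^+ 2 <= eta / 8.
  apply: le_trans hK; rewrite ler_wpM2r//; first exact: ltW.
  by move: h2; rewrite ler_norml => /andP[]; lra.
have E02 : Ex P0 (fun y : R => y ^+ 2) / K ^+ 2 <= eta / 8.
  by apply: le_trans hK; rewrite E2 ler_wpM2r//; [exact: ltW|lra].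
move: hh hg; rewrite !ler_norml => /andP[hh1 hh2] /andP[hg1 hg2].
split.
  have p1 := @prob_le_step _ _ P (X n) h x _ K (aX n) th e8 K0 h01.
  have p2 := @prob_ge_step _ _ P0 id h (x + delta) _ K a0 th e8 K0 h01.
  have {}p1 := p1 _; have {}p2 := p2 _.
  have q1 : forall y, `|y| <= K -> y <= x -> h y <= eta / 8.
    by move=> y yK yx; apply: hl => //; lra.
  have q2 : forall y, `|y| <= K -> x + delta <= y -> 1 - h y <= eta / 8.
    by move=> y yK yx; apply: hr => //; lra.
  have {}p1 := p1 q1; have {}p2 := p2 q2.
  rewrite /= in p2; lra.
have p1 := @prob_ge_step _ _ P (X n) g x _ K (aX n) tg e8 K0 g01.
have p2 := @prob_le_step _ _ P0 id g (x - delta) _ K a0 tg e8 K0 g01.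
have q1 : forall y, `|y| <= K -> x <= y -> 1 - g y <= eta / 8.
  by move=> y yK yx; apply: gr => //; lra.
have q2 : forall y, `|y| <= K -> y <= x - delta -> g y <= eta / 8.
  by move=> y yK yx; apply: gl => //; lra.
have {}p1 := p1 q1; have {}p2 := p2 q2.
rewrite /= in p2; lra.
Unshelve. all: by end_near. Qed.

(** Slutsky's lemma is built in: the moments are those of [X n], while [Y n] is only close to [X n]
    in probability. *)
Lemma cvg_in_distribution_moments (Y : nat -> T -> R) :
  (forall n, measurable_fun setT (Y n)) ->
  (forall eps eta : R, 0 < eps -> 0 < eta -> \forall n \near \oo,
     fine (P [set w | eps < `|Y n w - X n w|]) <= eta) ->
  cvg_in_distribution P Y (normal_prob 0 1).
Proof.
move=> mY hY x cx.
have mX n : measurable_fun setT (X n) by exact: allmom_meas.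
pose F (r : R) := fine (P0 [set y | y <= r]).
have FE r : F r = fine (normal_prob 0 1 `]-oo, r]%classic).
  by rewrite /F; congr (fine (normal_prob _ _ _)); apply/seteqP; split => y; rewrite /= in_itv.
have mle n r : measurable [set w | Y n w <= r] by exact: measurable_le_set.
have -> : normal_prob 0 1 `]-oo, x]%classic = (F x)%:E.
  by rewrite FE fineK// fin_num_measure.
have -> : (fun n => P [set w | Y n w <= x]) = (fun n => (fine (P [set w | Y n w <= x]))%:E).
  by apply/funext => n; rewrite fineK// fin_num_measure.
apply: cvg_EFin; first exact: nearW.
apply/cvgrPdist_le => eps eps0.
have e3 : 0 < eps / 3 by rewrite divr_gt0.
(* Continuity of the limit at [x] is granted by the definition of convergence in distribution. A
   third of [delta] pays for passing from [Y n] to [X n], another for [cdf_sandwich]. *)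
have [delta d0 hd] : exists2 delta : R, 0 < delta &
    forall r, `|x - r| < delta -> `|F x - F r| <= eps / 3.
  move/cvgrPdist_le : cx => /(_ _ e3) /nbhs_ballP[delta /= d0 hd].
  by exists delta.
have d3 : 0 < delta / 3 by rewrite divr_gt0.
have := hY _ _ d3 e3 => hY3.
have S1 := @cdf_sandwich (x + delta / 3) _ _ d3 e3.
have S2 := @cdf_sandwich (x - delta / 3) _ _ d3 e3.
near=> n.
have hn : fine (P [set w | delta / 3 < `|Y n w - X n w|]) <= eps / 3 by near: n.
have [s1 _] : fine (P [set w | X n w <= x + delta / 3]) <=
    fine (P0 [set y | y <= x + delta / 3 + delta / 3]) + eps / 3 /\
    fine (P0 [set y | y <= x + delta / 3 - delta / 3]) <= fine (P [set w | X n w <= x + delta / 3]) + eps / 3.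
  by near: n.
have [_ s2] : fine (P [set w | X n w <= x - delta / 3]) <=
    fine (P0 [set y | y <= x - delta / 3 + delta / 3]) + eps / 3 /\
    fine (P0 [set y | y <= x - delta / 3 - delta / 3]) <= fine (P [set w | X n w <= x - delta / 3]) + eps / 3.
  by near: n.
have mgt : measurable [set w | delta / 3 < `|Y n w - X n w|].
  rewrite -[X in measurable X]setTI.
  have mYX : measurable_fun setT (fun w => `|Y n w - X n w|).
    by apply: measurableT_comp => //; exact: measurable_funB.
  have := mYX measurableT _ (measurable_itv `]delta / 3, +oo[).
  by congr measurable; apply/seteqP; split => w /=; rewrite in_itv/= andbT.
have ml r : measurable [set w | X n w <= r] by exact: measurable_le_set.
have leP' (A B C : set T) : measurable A -> measurable B -> measurable C ->
    A `<=` B `|` C -> fine (P A) <= fine (P B) + fine (P C).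
  move=> mA mB mC ABC; rewrite -lee_fin EFinD !fineK ?fin_num_measure//.
  apply: (@le_trans _ _ (P (B `|` C))); last exact: measureU2.
  by apply: le_measure => //; rewrite inE//; exact: measurableU.
have u1 : fine (P [set w | Y n w <= x]) <= fine (P [set w | X n w <= x + delta / 3]) +
    fine (P [set w | delta / 3 < `|Y n w - X n w|]).
  apply: leP' => // w /= Yx; have [h|h] := ltP (delta / 3) `|Y n w - X n w|; [by right|left].
  by move: h; rewrite ler_norml => /andP[]; lra.
have u2 : fine (P [set w | X n w <= x - delta / 3]) <= fine (P [set w | Y n w <= x]) +
    fine (P [set w | delta / 3 < `|Y n w - X n w|]).
  apply: leP' => // w /= Yx; have [h|h] := ltP (delta / 3) `|Y n w - X n w|; [by right|left].
  by move: h; rewrite ler_norml => /andP[]; lra.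
have : `|F x - F (x + delta / 3 + delta / 3)| <= eps / 3.
  by apply: hd; rewrite -addrA opprD addrA subrr add0r normrN gtr0_norm; lra.
have : `|F x - F (x - delta / 3 - delta / 3)| <= eps / 3.
  by apply: hd; rewrite -addrA opprD addrA subrr add0r normrN ltr0_norm; lra.
rewrite !ler_norml /F /= => /andP[f1 f2] /andP[f3 f4].
move: (fine (P0 [set y | y <= x])) (fine (P0 [set y | y <= x + delta / 3 + delta / 3]))
  (fine (P0 [set y | y <= x - delta / 3 - delta / 3])) (fine (P [set w | Y n w <= x]))
  (fine (P [set w | X n w <= x + delta / 3])) (fine (P [set w | X n w <= x - delta / 3]))
  (fine (P [set w | delta / 3 < `|Y n w - X n w|])) f1 f2 f3 f4 u1 u2 s1 s2 hn.
move=> p0 p1 p2 p3 p4 p5 p6 f1 f2 f3 f4 u1 u2 s1 s2 hn.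
by apply/andP; split; lra.
Unshelve. all: by end_near. Qed.

End MethodOfMoments.

(** * The precision matrix of the exponential kernel *)

Section ExponentialKernel.
Context {R : realType}.
Implicit Types (t y : nat -> R) (theta x : R) (m : nat).

(** The hyperbolic functions are written in terms of [expR (- x)], the correlation across a gap of
    scaled length [x]. *)
Definition coth x : R := (1 + expR (- x) ^+ 2) / (1 - expR (- x) ^+ 2).
Definition csch x : R := 2 * expR (- x) / (1 - expR (- x) ^+ 2).

Lemma expRN_lt1 x : 0 < x -> expR (- x) < 1.
Proof. by move=> x0; rewrite expR_lt1 oppr_lt0. Qed.

Lemma expRN2_lt1 x : 0 < x -> 0 < 1 - expR (- x) ^+ 2.
Proof.
move=> x0; have := expRN_lt1 x0; have := expR_gt0 (- x) => h1 h2.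
by rewrite subr_gt0 exprn_ilt1// ltW.
Qed.

(* The precision matrix of [m] points is tridiagonal; the boundary conventions
   [coth_gap 0 = coth_gap m = 1] and [csch_gap 0 = csch_gap m = 0] correspond to
   infinitely distant extra points and make all rows uniform. *)
Definition coth_gap m t theta i : R :=
  if (0 < i < m)%N then coth (theta * (t i - t i.-1)) else 1.
Definition csch_gap m t theta i : R :=
  if (0 < i < m)%N then csch (theta * (t i - t i.-1)) else 0.

Definition prec_diag m t theta i : R :=
  (coth_gap m t theta i + coth_gap m t theta i.+1) / 2.
Definition prec_app m t theta y i : R :=
  prec_diag m t theta i * y i -
  (csch_gap m t theta i * y i.-1 + csch_gap m t theta i.+1 * y i.+1) / 2.

Definition increasing_to m t := forall i, (i.+1 < m)%N -> t i < t i.+1.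

Lemma increasing_to_lt m t i j : increasing_to m t -> (i < j < m)%N -> t i < t j.
Proof.
move=> it; elim: j => [|j IH]; first by rewrite ltn0.
rewrite ltnS leq_eqVlt => /andP[/orP[/eqP ->|ij] jm]; first exact: it.
by apply: (lt_trans (IH _) (it _ jm)); rewrite ij ltnW.
Qed.

Lemma increasing_to_le m t i j : increasing_to m t -> (i <= j < m)%N -> t i <= t j.
Proof.
move=> it /andP[]; rewrite leq_eqVlt => /orP[/eqP -> //|ij jm].
by apply/ltW/(increasing_to_lt it); rewrite ij.
Qed.

(** Half of a row of the precision matrix, applied to the kernel across one gap, returns the value
    at its node: with sign plus if the neighbour is farther from the centre of the kernel, and
    minus, in the next lemma, if it is nearer. *)
Lemma coth_csch_decay x (r : R) : 0 < x ->
  coth x * r - csch x * (expR (- x) * r) = r.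
Proof.
move=> x0; rewrite /coth /csch; field.
by rewrite gt_eqF// expRN2_lt1.
Qed.

Lemma coth_csch_growth x (r : R) : 0 < x ->
  coth x * (expR (- x) * r) - csch x * r = - (expR (- x) * r).
Proof.
move=> x0; rewrite /coth /csch; field.
by rewrite gt_eqF// expRN2_lt1.
Qed.

(** Each row splits into a left and a right half, each reading one neighbour. A half returns plus or
    minus the kernel at [i] according to the side of [k]; the two cancel unless [i = k], and then
    both give 1. *)
Lemma prec_app_kernel m t theta i k : 0 < theta -> increasing_to m t ->
  (i < m)%N -> (k < m)%N ->
  prec_app m t theta (fun j => expR (- theta * `|t j - t k|)) i = (i == k)%:R.
Proof.
move=> th0 it im km; set r := fun j => expR (- theta * `|t j - t k|).
have left_ : coth_gap m t theta i * r i - csch_gap m t theta i * r i.-1 =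
    if (i <= k)%N then r i else - r i.
  rewrite /coth_gap /csch_gap; case: i im => [|i] im.
    by rewrite ltnn /= mul1r mul0r subr0.
  rewrite ltn0Sn im /=.
  have d0 : 0 < theta * (t i.+1 - t i) by rewrite mulr_gt0// subr_gt0 it.
  have ti := it _ im.
  case: (leqP i.+1 k) => ik.
    have tk : t i.+1 <= t k by apply: (increasing_to_le it); rewrite ik.
    have -> : r i = expR (- (theta * (t i.+1 - t i))) * r i.+1.
      rewrite /r -expRD; congr expR.
      rewrite !ler0_norm ?subr_le0//; last by rewrite (le_trans (ltW ti)).
      by ring.
    exact: coth_csch_decay.
  have tk : t k <= t i by apply: (increasing_to_le it); rewrite -ltnS ik ltnW.
  have -> : r i.+1 = expR (- (theta * (t i.+1 - t i))) * r i.
    rewrite /r -expRD; congr expR.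
    rewrite !ger0_norm ?subr_ge0//; last by rewrite (le_trans tk)// ltW.
    by ring.
  exact: coth_csch_growth.
have right_ : coth_gap m t theta i.+1 * r i - csch_gap m t theta i.+1 * r i.+1 =
    if (k <= i)%N then r i else - r i.
  rewrite /coth_gap /csch_gap /=; case: ltnP => im'.
    have d0 : 0 < theta * (t i.+1 - t i) by rewrite mulr_gt0// subr_gt0 it.
    have ti := it _ im'.
    case: (leqP k i) => ik.
      have tk : t k <= t i by apply: (increasing_to_le it); rewrite ik.
      have -> : r i.+1 = expR (- (theta * (t i.+1 - t i))) * r i.
        rewrite /r -expRD; congr expR.
        rewrite !ger0_norm ?subr_ge0//; last by rewrite (le_trans tk)// ltW.
        by ring.
      exact: coth_csch_decay.
    have tk : t i.+1 <= t k by apply: (increasing_to_le it); rewrite ik.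
    have -> : r i = expR (- (theta * (t i.+1 - t i))) * r i.+1.
      rewrite /r -expRD; congr expR.
      rewrite !ler0_norm ?subr_le0//; last by rewrite (le_trans (ltW ti)).
      by ring.
    exact: coth_csch_growth.
  by rewrite mul1r mul0r subr0 -ltnS (leq_trans km im').
have -> : prec_app m t theta r i =
    ((coth_gap m t theta i * r i - csch_gap m t theta i * r i.-1) +
     (coth_gap m t theta i.+1 * r i - csch_gap m t theta i.+1 * r i.+1)) / 2.
  by rewrite /prec_app /prec_diag; field.
rewrite left_ right_; case: (ltngtP i k) => [_|_|ik] /=.
- by rewrite subrr mul0r.
- by rewrite addNr mul0r.
- by rewrite /r ik subrr normr0 mulr0 expR0; field.
Qed.

Definition kernel_mx m t theta : 'M[R]_m :=
  \matrix_(i < m, j < m) expR (- theta * `|t i - t j|).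

Definition prec_mx m t theta : 'M[R]_m :=
  \matrix_(i < m, j < m) prec_app m t theta (fun k => (k == j)%:R) i.

Lemma prec_mxE m t theta (i : 'I_m) y :
  \sum_(j < m) prec_mx m t theta i j * y j = prec_app m t theta y i.
Proof.
have pick (k : nat) (c : R) : ((k < m)%N = false -> c = 0) ->
    \sum_(j < m) c * (k == j)%:R * y j = c * y k.
  move=> hc; have [km|km] := boolP (k < m)%N.
    rewrite (bigD1 (Ordinal km))//= eqxx mulr1 big1 ?addr0// => j jk.
    rewrite (_ : (k == j) = false) ?mulr0 ?mul0r//.
    by apply/negbTE/eqP => kj; move/eqP: jk; apply; apply/val_inj.
  by rewrite hc ?(negbTE km)// mul0r big1// => j _; rewrite !mul0r.
have i0 : (i.-1 < m)%N by rewrite (leq_ltn_trans (leq_pred i)).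
transitivity (\sum_(j < m) (prec_diag m t theta i * (i == j :> nat)%:R * y j +
    (- csch_gap m t theta i / 2 * (i.-1 == j)%:R * y j +
     - csch_gap m t theta i.+1 / 2 * (i.+1 == j)%:R * y j))).
  by apply: eq_bigr => j _; rewrite mxE /prec_app; field.
rewrite !big_split/= !pick ?ltn_ord ?i0//.
  by rewrite /prec_app; field.
by move=> h; rewrite /csch_gap h andbF oppr0 mul0r.
Qed.

Lemma mul_prec_kernel m t theta : 0 < theta -> increasing_to m t ->
  prec_mx m t theta *m kernel_mx m t theta = 1%:M.
Proof.
move=> th0 it; apply/matrixP => i k; rewrite !mxE.
under eq_bigr do rewrite [kernel_mx _ _ _ _ _]mxE.
by rewrite (prec_mxE t theta i (fun j => expR (- theta * `|t j - t k|))) prec_app_kernel.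
Qed.

Lemma kernel_mx_unit m t theta : 0 < theta -> increasing_to m t ->
  kernel_mx m t theta \in unitmx.
Proof. by move=> th0 it; have [] := mulmx1_unit (mul_prec_kernel th0 it). Qed.

Lemma coth_gt0 x : 0 < x -> 0 < coth x.
Proof.
move=> x0; rewrite /coth divr_gt0 ?expRN2_lt1// ltr_pwDl// exprn_ge0// expR_ge0.
Qed.

Lemma coth_gap_gt0 m t theta i : 0 < theta -> increasing_to m t ->
  0 < coth_gap m t theta i.
Proof.
move=> th0 it; rewrite /coth_gap; case: i => [|i] //=; case: ifP => // im.
by rewrite coth_gt0// mulr_gt0// subr_gt0 it.
Qed.

Lemma prec_diag_gt0 m t theta i : 0 < theta -> increasing_to m t ->
  0 < prec_diag m t theta i.
Proof. by move=> th0 it; rewrite /prec_diag divr_gt0// addr_gt0 ?coth_gap_gt0. Qed.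

Lemma prec_mx_diag m t theta (i : 'I_m) :
  prec_mx m t theta i i = prec_diag m t theta i.
Proof.
rewrite mxE /prec_app eqxx mulr1 (_ : (i.+1 == i) = false); last by rewrite gtn_eqF.
rewrite mulr0 addr0; case: (val i) => [|j]; first by rewrite /csch_gap ltnn mul0r mul0r subr0.
by rewrite /= (_ : (j == j.+1) = false) ?mulr0 ?mul0r ?subr0// ltn_eqF.
Qed.

(** * Leave-one-out prediction through the precision matrix *)

Section LeaveOneOut.
Variables (n : nat) (s : nat -> R) (theta : R).
Hypotheses (th0 : 0 < theta) (si : forall i, (1 <= i < n)%N -> s i < s i.+1).
Let t i := s i.+1.
Let it : increasing_to n t. Proof. by move=> i im; apply: si. Qed.

Lemma loo_corr_mx_unit (i : 'I_n) : loo_corr_mx s theta i \in unitmx.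
Proof.
(* Deleting a point leaves an increasing sequence, so the reduced matrix is again an exponential
   kernel. *)
have -> : loo_corr_mx s theta i = kernel_mx n.-1 (t \o bump i) theta.
  by apply/matrixP => j k; rewrite !mxE.
apply: kernel_mx_unit => // j jn; apply: (increasing_to_lt it).
have [k kj] : exists k : 'I_n.-1, k = j.+1 :> nat by exists (Ordinal jn).
rewrite -{2}kj (ltn_ord (lift i k)) andbT /bump.
by case: (leqP i j) => h1; case: (leqP i j.+1) => h2 //; lia.
Qed.

(** Row [i] of precision times kernel equals identity, read in the columns other than [i], says that
    these weights solve the normal equations of the prediction. *)
Lemma loo_weight (i : 'I_n) :
  (loo_corr_col s theta i)^T *m invmx (loo_corr_mx s theta i) =
  \row_j (- (prec_mx n t theta i (lift i j) / prec_diag n t theta i)).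
Proof.
apply: (canLR (mulmxK (loo_corr_mx_unit i))); apply/rowP => k.
have q0 := prec_diag_gt0 i th0 it.
have := congr1 (fun A : 'M[R]_n => A i (lift i k)) (mul_prec_kernel th0 it).
rewrite mxE [RHS]mxE (negbTE (neq_lift i k)) (bigD1_ord i)//= prec_mx_diag.
rewrite [kernel_mx _ _ _ i _]mxE => h.
rewrite !mxE; under eq_bigr do rewrite mxE mulNr mulrAC.
rewrite sumrN -mulr_suml.
have -> : \sum_(j < n.-1) prec_mx n t theta i (lift i j) * loo_corr_mx s theta i j k =
    - (prec_diag n t theta i * expR (- theta * `|t i - t (lift i k)|)).
  move/eqP: h; rewrite addrC addr_eq0 => /eqP <-; apply: eq_bigr => j _.
  by rewrite !mxE.
rewrite -/(t i) -/(t (lift i k)); set e := expR _.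
by field; rewrite gt_eqF.
Qed.

Lemma loo_meanE y (i : 'I_n) : y i.+1 - loo_mean s y theta i =
  prec_app n t theta (fun j => y j.+1) i / prec_diag n t theta i.
Proof.
have q0 := prec_diag_gt0 i th0 it.
rewrite /loo_mean loo_weight.
have -> : ((\row_j - (prec_mx n t theta i (lift i j) / prec_diag n t theta i)) *m
    loo_obs y i) ord0 ord0 =
   - ((prec_app n t theta (fun j => y j.+1) i - prec_diag n t theta i * y i.+1) /
      prec_diag n t theta i).
  rewrite -(prec_mxE t theta i (fun j => y j.+1)) (bigD1_ord i)//= prec_mx_diag.
  rewrite [X in X - _]addrC addrK mulr_suml -sumrN mxE; apply: eq_bigr => j _.
  by rewrite !mxE mulNr mulrAC.
by field; rewrite gt_eqF.
Qed.

Lemma loo_varE sigma2 (i : 'I_n) :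
  loo_var s theta sigma2 i = sigma2 / prec_diag n t theta i.
Proof.
have q0 := prec_diag_gt0 i th0 it.
rewrite /loo_var loo_weight; congr (_ * _).
have := congr1 (fun A : 'M[R]_n => A i i) (mul_prec_kernel th0 it).
rewrite mxE [RHS]mxE eqxx (bigD1_ord i)//= prec_mx_diag.
rewrite [kernel_mx _ _ _ i i]mxE subrr normr0 mulr0 expR0 mulr1 => h.
have -> : ((\row_j - (prec_mx n t theta i (lift i j) / prec_diag n t theta i)) *m
    loo_corr_col s theta i) ord0 ord0 =
   - ((1 - prec_diag n t theta i) / prec_diag n t theta i).
  move: h => /(canRL (addKr _)) h.
  rewrite [1 - _]addrC -h mulr_suml -sumrN mxE; apply: eq_bigr => j _.
  by rewrite !mxE mulNr mulrAC distrC.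
by field; rewrite gt_eqF.
Qed.

Lemma log_scoreE y sigma2 : log_score n s y theta sigma2 =
  \sum_(i < n) (ln (sigma2 / prec_diag n t theta i) +
    prec_app n t theta (fun j => y j.+1) i ^+ 2 / (sigma2 * prec_diag n t theta i)).
Proof.
apply: eq_bigr => i _; rewrite loo_meanE loo_varE; congr (_ + _).
have q0 := prec_diag_gt0 i th0 it.
move: q0; move: (prec_diag _ _ _ _) (prec_app _ _ _ _ _) => q a q0.
rewrite invf_div [(sigma2 * _)^-1]invfM; move: sigma2^-1 => z.
by field; rewrite gt_eqF.
Qed.

End LeaveOneOut.

End ExponentialKernel.

(** * Elementary bounds on coth and csch *)

Section CothBounds.
Context {R : realType}.

Let scE (a b : R) : a *: (b : R^o) = a * b. Proof. by []. Qed.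

Lemma expR_ge_quadratic (x : R) : 0 <= x -> 1 + x + x ^+ 2 / 2 <= expR x.
Proof.
move=> x0.
pose f (y : R) := expR y - 1 - y - 2^-1 * y ^+ 2.
have fE : f = expR - cst 1 - id - 2^-1 \*: (id ^+ 2).
  by apply/funext => y; rewrite /f !fctE.
have df y : is_derive (y : R) 1 f (expR y - 1 - y).
  by rewrite fE; apply: is_derive_eq; rewrite !scE/=; field.
have := is_derive_ge0_le df _ x0; rewrite /f expR0 expr0n/= => h.
suff : 0 <= expR x - 1 - x - 2^-1 * x ^+ 2 by lra.
apply: le_trans (h _); first by lra.
by move=> y _; have := expR_ge1Dx y; lra.
Qed.

Lemma coth_bounds (x : R) : 0 < x -> x^-1 <= coth x <= x^-1 + x.
Proof.
move=> x0; have e1 := expRN2_lt1 x0.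
set u := expR (- x) ^+ 2 in e1 *.
have u0 : 0 < u by rewrite exprn_gt0// expR_gt0.
have uE : u = expR (- (2 * x)) by rewrite /u -expRM_natl mulrN.
have xn : x != 0 by rewrite gt_eqF.
apply/andP; split.
  have h : 0 <= x * (1 + u) - (1 - u).
    have := @is_derive_ge0_le R (id + id * (expR \o (-2 \*: id)) - cst 1 + (expR \o (-2 \*: id)))
      (fun x => 1 - expR (-2 * x) * (1 + 2 * x)) 0 x _ _ (ltW x0).
    rewrite !fctE/= !scE mulr0 expR0 mul0r => h.
    have {}h := h _ _; rewrite uE -mulNr; suff : 0 <= x + x * expR (-2 * x) - 1 + expR (-2 * x) by lra.
    apply: le_trans (h _ _); first by lra.
      move=> y; apply: is_derive_eq; rewrite !scE/=; ring.
    move=> y y0; rewrite subr_ge0 mulNr expRN mulrC ler_pdivrMr ?expR_gt0// mul1r.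
    exact: expR_ge1Dx.
  rewrite /coth -/u ler_pdivlMr// mulrC ler_pdivrMr// mulrC; lra.
have h : u * (1 + 2 * x + 2 * x ^+ 2) <= 1.
  rewrite uE expRN [_^-1 * _]mulrC ler_pdivrMr ?expR_gt0// mul1r.
  have := @expR_ge_quadratic (2 * x).
  by move=> h; apply: le_trans (h _); [lra|rewrite mulr_ge0// ltW].
have -> : x^-1 + x = (1 + x ^+ 2) / x by field.
rewrite /coth -/u ler_pdivrMr// mulrAC ler_pdivlMr//.
(* The goal amounts to [u (1 + x + x^2) <= 1 - x + x^2], and [(1 - x + x^2)(1 + 2x + 2x^2) = 1 + x +
   x^2 + 2x^4]. *)
have : (1 - x + x ^+ 2) * (u * (1 + 2 * x + 2 * x ^+ 2)) <= 1 - x + x ^+ 2.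
  by rewrite ler_piMr//; nra.
have : 0 <= u * x ^+ 4 by rewrite mulr_ge0 ?(ltW u0)// exprn_ge0// ltW.
lra.
Qed.

(** Transfers the bounds on [coth] to [csch]. *)
Lemma csch_double (x : R) : 0 < x -> csch x = coth (x / 2) - coth x.
Proof.
move=> x0; have x2 : 0 < x / 2 by rewrite divr_gt0.
have e1 := expRN2_lt1 x0; have e2 := expRN2_lt1 x2.
have ee : expR (- (x / 2)) ^+ 2 = expR (- x).
  by rewrite -expRM_natl; congr expR; field.
rewrite /csch /coth ee in e2 *; move: (expR (- x)) e1 e2 => e e1 e2.
field; rewrite !gt_eqF//.
Qed.

Lemma csch_bounds (x : R) : 0 < x -> `|csch x - x^-1| <= x.
Proof.
move=> x0; have x2 : 0 < x / 2 by rewrite divr_gt0.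
have /andP[h1 h2] := coth_bounds x0; have /andP[h3 h4] := coth_bounds x2.
have e : (x / 2)^-1 = 2 * x^-1 by rewrite invf_div; field; rewrite gt_eqF.
rewrite e in h3 h4; rewrite csch_double// ler_norml.
by apply/andP; split; lra.
Qed.

Lemma ratio_perturb (Q P q qt eta e : R) : 0 < P -> Q = P + e -> 0 <= e ->
  `|q - qt| <= eta ->
  `|q ^+ 2 / Q - qt ^+ 2 / P| <=
    2 * eta * `|qt / P| + eta ^+ 2 / P + e * (qt / P) ^+ 2.
Proof.
move=> P0 QE e0 qqt; have Q0 : 0 < Q by rewrite QE ltr_wpDr.
have PQ : P <= Q by rewrite QE lerDl.
have iPQ : Q^-1 <= P^-1 by rewrite lef_pV2 ?posrE.
have iP0 : 0 < P^-1 by rewrite invr_gt0.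
have iQ0 : 0 < Q^-1 by rewrite invr_gt0.
have -> : q ^+ 2 / Q - qt ^+ 2 / P = (q ^+ 2 - qt ^+ 2) / Q - e * (qt ^+ 2 / (P * Q)).
  by rewrite QE; field; rewrite -QE !gt_eqF.
apply: le_trans (ler_normB _ _) _; apply: lerD.
  rewrite normrM (ger0_norm (ltW iQ0)).
  have h : `|q ^+ 2 - qt ^+ 2| <= eta * (2 * `|qt| + eta).
    rewrite subr_sqr normrM ler_pM//.
    have -> : q + qt = 2 * qt + (q - qt) by ring.
    by rewrite (le_trans (ler_normD _ _))// normrM (ger0_norm (ler0n _ _)) lerD2l.
  apply: (@le_trans _ _ (eta * (2 * `|qt| + eta) / P)).
    by apply: ler_pM => //; exact: ltW.
  rewrite normrM (ger0_norm (ltW iP0)).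
  by rewrite le_eqVlt; apply/orP; left; apply/eqP; ring.
rewrite normrM (ger0_norm e0) ler_wpM2l// ger0_norm; last first.
  by rewrite mulr_ge0 ?sqr_ge0// invr_ge0 mulr_ge0// ltW.
rewrite exprMn ler_wpM2l ?sqr_ge0// invfM exprVn -exprVn expr2.
by rewrite ler_wpM2l// ltW.
Qed.

Lemma ln_perturb (P e : R) : 0 < P -> 0 <= e -> `|ln (P + e) - ln P| <= e / P.
Proof.
move=> P0 e0; have Q0 : 0 < P + e by rewrite ltr_wpDr.
rewrite -ln_div ?posrE//; have -> : (P + e) / P = 1 + e / P by field; rewrite gt_eqF.
have r0 : 0 <= e / P by rewrite divr_ge0// ltW.
rewrite ger0_norm; last by rewrite ln_ge0// lerDl.
by apply: le_ln1Dx; lra.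
Qed.

End CothBounds.

(** * Small-gap approximation of the score *)

Section Increments.
Context {R : realType}.
Implicit Types (m i j : nat) (t y : nat -> R).

Definition gap m t j : R := if (0 < j < m)%N then t j - t j.-1 else 0.
Definition incr m y j : R := if (0 < j < m)%N then y j - y j.-1 else 0.

(* Limits of [theta * prec_diag] and [theta * prec_app] as the gaps shrink; at
   the two ends, [0^-1 = 0] discards the missing neighbour. *)
Definition lim_diag m t i : R := ((gap m t i)^-1 + (gap m t i.+1)^-1) / 2.
Definition lim_app m t y i : R :=
  ((gap m t i)^-1 * incr m y i - (gap m t i.+1)^-1 * incr m y i.+1) / 2.

(** This and [incr_sqr] are Cauchy-Schwarz bounds for the square of a sum of three absolute values
    and of two absolute increments; the factors 3 and 2 count the terms. *)
Definition nbr_sqr m y i : R :=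
  3 * (y i ^+ 2 + (if (0 < i < m)%N then y i.-1 ^+ 2 else 0) +
       (if (i.+1 < m)%N then y i.+1 ^+ 2 else 0)).
Definition incr_sqr m y i : R := 2 * (incr m y i ^+ 2 + incr m y i.+1 ^+ 2).

(** Bounds [coth_gap] minus its approximation [1 / (theta * gap)]: by [theta * gap] at a true gap,
    and by 1 at the two missing ones, where [coth_gap] is 1 and the approximation 0. *)
Definition gap_err hi m t j : R := if (0 < j < m)%N then hi * gap m t j else 1.
Definition node_err hi m t i : R := (gap_err hi m t i + gap_err hi m t i.+1) / 2.

(** [r] stands for the square root of the mesh. Values have mean square of order 1 and increments of
    order [r^2], so with the weights [r] and [1 / r] both contributions have mean of order [r]. *)
Definition score_err hi r m t y : R := \sum_(i < m) node_err hi m t i *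
  ((r + 2 * hi * (hi + 1) * r ^+ 2) * nbr_sqr m y i + (r^-1 + 1) * incr_sqr m y i).

End Increments.

Section ScoreApproximation.
Context {R : realType}.
Variables (m : nat) (t : nat -> R) (hi r : R).
Hypotheses (m2 : (2 <= m)%N) (it : increasing_to m t) (hi0 : 0 < hi).
Hypotheses (r0 : 0 < r) (r1 : r <= 1) (gap_le : forall j, gap m t j <= r ^+ 2).
Hypothesis t_range : t m.-1 - t 0%N = 1.

Let sqn (x : R) : `|x| ^+ 2 = x ^+ 2. Proof. by rewrite real_normK ?num_real. Qed.
Let r21 : r ^+ 2 <= 1. Proof. by rewrite expr_le1// ltW. Qed.

Lemma gap_gt0 j : (0 < j < m)%N -> 0 < gap m t j.
Proof.
by move=> jm; rewrite /gap jm subr_gt0; case: j jm => [//|j] /= jm; exact: it.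
Qed.

Lemma gap_ge0 j : 0 <= gap m t j.
Proof.
by case: (boolP (0 < j < m)%N) => [/gap_gt0/ltW//|/negbTE h]; rewrite /gap h.
Qed.

Lemma gap_err_bounds j : 0 <= gap_err hi m t j <= hi + 1.
Proof.
rewrite /gap_err; case: ifP => _; last by rewrite ler01/= lerDr ltW.
rewrite mulr_ge0 ?gap_ge0// ?(ltW hi0)//=.
apply: (@le_trans _ _ hi); last by rewrite lerDl.
by rewrite ler_piMr// ?(ltW hi0)// (le_trans (gap_le j)).
Qed.

Lemma node_err_bounds i : 0 <= node_err hi m t i <= hi + 1.
Proof.
have /andP[a1 a2] := gap_err_bounds i; have /andP[b1 b2] := gap_err_bounds i.+1.
by rewrite /node_err; apply/andP; split; lra.
Qed.

Lemma sum_gap : \sum_(i < m.-1) gap m t i.+1 = 1.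
Proof.
rewrite -t_range -(big_mkord xpredT (fun i => gap m t i.+1)) -telescope_sumr//.
apply: eq_big_nat => i /andP[_ im].
by rewrite /gap /= (_ : (i.+1 < m)%N)// -(prednK (ltnW m2)) ltnS.
Qed.

(** The gaps sum to 1 whatever their number, and each missing gap adds one half. This bound, free of
    [m], is why the mesh may tend to 0 at any rate. *)
Lemma sum_node_err : \sum_(i < m) node_err hi m t i = hi + 1.
Proof.
have mE := prednK (ltnW m2).
have h : \sum_(i < m.-1) gap_err hi m t i.+1 = hi.
  rewrite -[RHS]mulr1 -sum_gap mulr_sumr; apply: eq_bigr => i _.
  by rewrite /gap_err /=; have := ltn_ord i; rewrite -ltnS mE => ->.
rewrite -mulr_suml big_split/=.
have -> : \sum_(i < m) gap_err hi m t i = 1 + hi.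
  transitivity (1 + \sum_(i < m.-1) gap_err hi m t i.+1); last by rewrite h.
  rewrite -(big_mkord xpredT (gap_err hi m t)) -[in LHS]mE big_nat_recl//.
  by rewrite mE big_mkord.
have -> : \sum_(i < m) gap_err hi m t i.+1 = hi + 1.
  transitivity (\sum_(i < m.-1) gap_err hi m t i.+1 + 1); last by rewrite h.
  rewrite -(big_mkord xpredT (fun i => gap_err hi m t i.+1)) -[in LHS]mE.
  by rewrite big_nat_recr//= mE big_mkord; congr (_ + _); rewrite /gap_err ltnn andbF.
by field.
Qed.

Lemma lim_diag_ge i : (i < m)%N -> (2 * r ^+ 2)^-1 <= lim_diag m t i.
Proof.
move=> im; rewrite /lim_diag invfM mulrC ler_pM2r//.
have h j : (0 < j < m)%N -> (r ^+ 2)^-1 <= (gap m t j)^-1.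
  by move=> jm; rewrite lef_pV2 ?posrE ?gap_gt0// exprn_gt0.
have h0 j : 0 <= (gap m t j)^-1 by rewrite invr_ge0 gap_ge0.
case: (ltnP i.+1 m) => i1.
  by rewrite -[leLHS]add0r lerD// h.
rewrite -[leLHS]addr0 lerD// h// im andbT.
by case: i i1 im => // m1 _; rewrite leqNgt m2 in m1.
Qed.

Lemma lim_diag_gt0 i : (i < m)%N -> 0 < lim_diag m t i.
Proof.
by move=> im; apply: lt_le_trans (lim_diag_ge im); rewrite invr_gt0 mulr_gt0// exprn_gt0.
Qed.

Section FixedParameter.
Variables (theta : R).
Hypotheses (th0 : 0 < theta) (thi : theta <= hi).

Lemma coth_gap_approx j :
  0 <= coth_gap m t theta j - (gap m t j)^-1 / theta <= gap_err hi m t j.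
Proof.
rewrite /coth_gap /gap_err; case: ifP => jm; last first.
  by rewrite /gap jm invr0 mul0r subr0 ler01 lexx.
have g0 := gap_gt0 jm; have <- : gap m t j = t j - t j.-1 by rewrite /gap jm.
have /andP[h1 h2] := coth_bounds (mulr_gt0 th0 g0).
have e : (theta * gap m t j)^-1 = (gap m t j)^-1 / theta by rewrite invfM mulrC.
rewrite e in h1 h2; rewrite subr_ge0 h1 lerBlDl (le_trans h2)// lerD2l.
by rewrite ler_pM2r.
Qed.

Lemma csch_gap_approx j : (0 < j < m)%N ->
  `|csch_gap m t theta j - (gap m t j)^-1 / theta| <= gap_err hi m t j.
Proof.
move=> jm; rewrite /csch_gap /gap_err jm.
have g0 := gap_gt0 jm; have <- : gap m t j = t j - t j.-1 by rewrite /gap jm.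
have h := csch_bounds (mulr_gt0 th0 g0).
have e : (theta * gap m t j)^-1 = (gap m t j)^-1 / theta by rewrite invfM mulrC.
by rewrite e in h; rewrite (le_trans h)// ler_pM2r.
Qed.

(** Arbitrary [u] and [v] let it serve both halves of row [i]: gap [i] with [y i] and [y i.-1], gap
    [i.+1] with [y i] and [y i.+1]. *)
Lemma half_app_approx j (u v : R) :
  `|coth_gap m t theta j * u - csch_gap m t theta j * v -
    (gap m t j)^-1 * (if (0 < j < m)%N then u - v else 0) / theta| <=
  gap_err hi m t j * (`|u| + if (0 < j < m)%N then `|v| else 0).
Proof.
have /andP[h1 h2] := coth_gap_approx j.
set g := gap_err hi m t j in h1 h2 *.
case: ifP => jm; last first.
  rewrite /csch_gap jm mul0r subr0 mulr0 mul0r subr0 addr0.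
  move: h1 h2; rewrite /gap jm invr0 mul0r subr0 => h1 h2.
  by rewrite normrM ger0_norm// ler_wpM2r.
have -> : coth_gap m t theta j * u - csch_gap m t theta j * v -
    (gap m t j)^-1 * (u - v) / theta =
  (coth_gap m t theta j - (gap m t j)^-1 / theta) * u -
  (csch_gap m t theta j - (gap m t j)^-1 / theta) * v by ring.
rewrite (le_trans (ler_normB _ _))// mulrDr !normrM lerD// ler_wpM2r//.
  by rewrite ger0_norm.
exact: csch_gap_approx.
Qed.

Lemma prec_diag_approx i :
  0 <= prec_diag m t theta i - lim_diag m t i / theta <= node_err hi m t i.
Proof.
have /andP[a1 a2] := coth_gap_approx i; have /andP[b1 b2] := coth_gap_approx i.+1.
rewrite /prec_diag /lim_diag /node_err mulrAC mulrDl; apply/andP; split; lra.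
Qed.

Definition nbr_norm (y : nat -> R) i := `|y i| +
  (if (0 < i < m)%N then `|y i.-1| else 0) + (if (i.+1 < m)%N then `|y i.+1| else 0).

Lemma prec_app_approx y i : (i < m)%N ->
  `|prec_app m t theta y i - lim_app m t y i / theta| <=
  node_err hi m t i * nbr_norm y i.
Proof.
move=> im; have ha := half_app_approx i (y i) (y i.-1).
have hb := half_app_approx i.+1 (y i) (y i.+1).
have -> : prec_app m t theta y i - lim_app m t y i / theta =
  (coth_gap m t theta i * y i - csch_gap m t theta i * y i.-1 -
    (gap m t i)^-1 * (if (0 < i < m)%N then y i - y i.-1 else 0) / theta) / 2 +
  (coth_gap m t theta i.+1 * y i - csch_gap m t theta i.+1 * y i.+1 -
    (gap m t i.+1)^-1 * (if (0 < i.+1 < m)%N then y i - y i.+1 else 0) / theta) / 2.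
  rewrite /prec_app /prec_diag /lim_app /incr /=.
  by case: ifP => _; case: ifP => _; ring.
have /andP[c1 _] := gap_err_bounds i; have /andP[d1 _] := gap_err_bounds i.+1.
apply: le_trans (ler_normD _ _) _.
rewrite !normrM (ger0_norm (_ : 0 <= 2^-1)) ?invr_ge0//.
rewrite -mulrDl /node_err [leRHS]mulrAC ler_pM2r ?invr_gt0// mulrDl.
apply: lerD; [apply: le_trans ha _|apply: le_trans hb _]; apply: ler_wpM2l => //.
  by rewrite /nbr_norm lerDl; case: ifP.
by rewrite /nbr_norm /= lerD2r lerDl; case: ifP.
Qed.

Lemma nbr_norm_sqr y i : nbr_norm y i ^+ 2 <= nbr_sqr m y i.
Proof.
rewrite /nbr_norm /nbr_sqr.
set b := (if (0 < i < m)%N then _ ^+ 2 else _).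
have -> : b = (if (0 < i < m)%N then `|y i.-1| else 0) ^+ 2.
  by rewrite /b; case: ifP; rewrite ?expr0n// sqn.
set c := (if (i.+1 < m)%N then _ ^+ 2 else _).
have -> : c = (if (i.+1 < m)%N then `|y i.+1| else 0) ^+ 2.
  by rewrite /c; case: ifP; rewrite ?expr0n// sqn.
rewrite -(sqn (y i)); move: (`|y i|) (if _ then _ else _) (if _ then _ else _).
by move=> x z w; have := sqr_ge0 (x - z); have := sqr_ge0 (x - w); have := sqr_ge0 (z - w); lra.
Qed.

(** Up to sign the ratio averages the two increments with weights inverse to the gaps, so no power
    of a gap is lost. *)
Lemma lim_ratio_le y i : (i < m)%N ->
  `|lim_app m t y i / lim_diag m t i| <= `|incr m y i| + `|incr m y i.+1|.
Proof.
move=> im; have P0 := lim_diag_gt0 im.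
rewrite normrM normfV (gtr0_norm P0) ler_pdivrMr//.
have a0 : 0 <= (gap m t i)^-1 by rewrite invr_ge0 gap_ge0.
have b0 : 0 <= (gap m t i.+1)^-1 by rewrite invr_ge0 gap_ge0.
rewrite /lim_app /lim_diag normrM (ger0_norm (_ : 0 <= 2^-1)) ?invr_ge0//.
rewrite mulrA ler_pM2r ?invr_gt0//.
apply: le_trans (ler_normB _ _) _; rewrite !normrM (ger0_norm a0) (ger0_norm b0).
have := mulr_ge0 a0 (normr_ge0 (incr m y i.+1)).
have := mulr_ge0 b0 (normr_ge0 (incr m y i)).
lra.
Qed.

Lemma node_score_approx y i : (i < m)%N ->
  `|prec_app m t theta y i ^+ 2 / prec_diag m t theta i -
    lim_app m t y i ^+ 2 / lim_diag m t i / theta| <=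
  node_err hi m t i * ((r + 2 * hi * (hi + 1) * r ^+ 2) * nbr_sqr m y i +
                       (r^-1 + 1) * incr_sqr m y i).
Proof.
move=> im; have P0 := lim_diag_gt0 im.
have thn : theta != 0 by rewrite gt_eqF.
have Pn : lim_diag m t i != 0 by rewrite gt_eqF.
have /andP[e0 e1] := prec_diag_approx i.
have /andP[k0 k1] := node_err_bounds i.
have := @ratio_perturb R (prec_diag m t theta i) (lim_diag m t i / theta)
  (prec_app m t theta y i) (lim_app m t y i / theta) _ _ (divr_gt0 P0 th0)
  (esym (subrKC _ _)) e0 (prec_app_approx y im).
have -> : (lim_app m t y i / theta) ^+ 2 / (lim_diag m t i / theta) =
  lim_app m t y i ^+ 2 / lim_diag m t i / theta by field; rewrite thn Pn.
have -> : lim_app m t y i / theta / (lim_diag m t i / theta) =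
  lim_app m t y i / lim_diag m t i by field; rewrite thn Pn.
move=> h; apply: le_trans h _.
have hU := lim_ratio_le y im.
set k := node_err hi m t i in e1 k0 k1 *; set V : R := nbr_norm y i.
have V0 : 0 <= V by rewrite /V /nbr_norm !addr_ge0//; case: ifP.
have hV : V ^+ 2 <= nbr_sqr m y i := nbr_norm_sqr y i.
set U : R := `|incr m y i| + `|incr m y i.+1| in hU.
have U0 : 0 <= U by rewrite addr_ge0.
have hZ : U ^+ 2 <= incr_sqr m y i.
  rewrite /U /incr_sqr -(sqn (incr m y i)) -(sqn (incr m y i.+1)).
  move: `|incr m y i| `|incr m y i.+1| => x z; have := sqr_ge0 (x - z); lra.
have hPi : (lim_diag m t i / theta)^-1 <= 2 * hi * r ^+ 2.
  rewrite invf_div ler_pdivrMr//.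
  apply: (@le_trans _ _ (2 * hi * r ^+ 2 * (2 * r ^+ 2)^-1)); last first.
    by rewrite ler_wpM2l ?lim_diag_ge// !mulr_ge0// ?exprn_ge0// ltW.
  by rewrite (_ : _ * _^-1 = hi)//; field; rewrite gt_eqF.
clearbody k V U.
(* The cross term is split by [2 V U <= r V^2 + U^2 / r]. *)
have hx : 2 * (k * V) * `|lim_app m t y i / lim_diag m t i| <=
    k * (r * V ^+ 2 + r^-1 * U ^+ 2).
  apply: (@le_trans _ _ (2 * (k * V) * U)).
    by apply: ler_wpM2l hU; rewrite !mulr_ge0.
  have -> : 2 * (k * V) * U = k * (2 * V * U) by ring.
  rewrite ler_wpM2l// -subr_ge0.
  have -> : r * V ^+ 2 + r^-1 * U ^+ 2 - 2 * V * U = (r * V - U) ^+ 2 / r.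
    by field; rewrite gt_eqF.
  by rewrite divr_ge0 ?sqr_ge0// ltW.
have hy : (k * V) ^+ 2 / (lim_diag m t i / theta) <=
    k * (2 * hi * (hi + 1) * r ^+ 2 * V ^+ 2).
  apply: (@le_trans _ _ ((k * V) ^+ 2 * (2 * hi * r ^+ 2))).
    by rewrite ler_wpM2l ?sqr_ge0.
  have -> : (k * V) ^+ 2 * (2 * hi * r ^+ 2) = k * (k * (2 * hi * r ^+ 2 * V ^+ 2)) by ring.
  rewrite ler_wpM2l//.
  have -> : 2 * hi * (hi + 1) * r ^+ 2 * V ^+ 2 = (hi + 1) * (2 * hi * r ^+ 2 * V ^+ 2) by ring.
  by rewrite ler_wpM2r// !mulr_ge0 ?sqr_ge0// ltW.
have hz : (prec_diag m t theta i - lim_diag m t i / theta) *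
    (lim_app m t y i / lim_diag m t i) ^+ 2 <= k * U ^+ 2.
  by rewrite ler_pM ?sqr_ge0// -sqn lerXn2r ?nnegrE.
apply: le_trans (lerD (lerD hx hy) hz) _.
have -> : k * (r * V ^+ 2 + r^-1 * U ^+ 2) + k * (2 * hi * (hi + 1) * r ^+ 2 * V ^+ 2) +
    k * U ^+ 2 = k * ((r + 2 * hi * (hi + 1) * r ^+ 2) * V ^+ 2 + (r^-1 + 1) * U ^+ 2) by ring.
rewrite ler_wpM2l// lerD// ler_wpM2l// addr_ge0 ?invr_ge0 ?(ltW r0)//.
by rewrite !mulr_ge0 ?addr_ge0 ?(ltW hi0) ?(ltW r0).
Qed.

Lemma sum_node_score_approx y :
  `|\sum_(i < m) prec_app m t theta y i ^+ 2 / prec_diag m t theta i -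
    (\sum_(i < m) lim_app m t y i ^+ 2 / lim_diag m t i) / theta| <=
  score_err hi r m t y.
Proof.
rewrite mulr_suml -sumrB (le_trans (ler_norm_sum _ _ _))// ler_sum// => i _.
exact: node_score_approx.
Qed.

(** Since [lim_diag] is at least [1 / (2 r^2)], a node contributes at most [2 hi r^2] times its
    [node_err], and these sum to [hi + 1]. *)
Lemma sum_log_approx (sigma2 : R) : 0 < sigma2 ->
  `|\sum_(i < m) ln (sigma2 / prec_diag m t theta i) -
    (m%:R * ln (theta * sigma2) - \sum_(i < m) ln (lim_diag m t i))| <=
  2 * hi * (hi + 1) * r ^+ 2.
Proof.
move=> s0.
have -> : m%:R * ln (theta * sigma2) = \sum_(i < m) ln (theta * sigma2).
  by rewrite sumr_const card_ord mulr_natl.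
rewrite -!sumrB (le_trans (ler_norm_sum _ _ _))//.
rewrite -[X in 2 * hi * X]sum_node_err mulr_sumr mulr_suml.
apply: ler_sum => i _; have P0 := lim_diag_gt0 (ltn_ord i).
have /andP[e0 e1] := prec_diag_approx i.
have Q0 := prec_diag_gt0 i th0 it.
have PT := divr_gt0 P0 th0.
rewrite ln_div ?posrE// lnM ?posrE//.
have -> : ln sigma2 - ln (prec_diag m t theta i) -
    (ln theta + ln sigma2 - ln (lim_diag m t i)) =
    - (ln (prec_diag m t theta i) - ln (lim_diag m t i / theta)).
  by rewrite ln_div ?posrE//; ring.
rewrite normrN.
have := ln_perturb PT e0; rewrite subrKC => h; apply: le_trans h _.
have hPi : (lim_diag m t i / theta)^-1 <= 2 * hi * r ^+ 2.
  rewrite invf_div ler_pdivrMr//.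
  apply: (@le_trans _ _ (2 * hi * r ^+ 2 * (2 * r ^+ 2)^-1)); last first.
    by rewrite ler_wpM2l ?lim_diag_ge// !mulr_ge0// ?exprn_ge0// ltW.
  by rewrite (_ : _ * _^-1 = hi)//; field; rewrite gt_eqF.
rewrite (_ : 2 * hi * _ * _ = node_err hi m t i * (2 * hi * r ^+ 2)); last by ring.
by rewrite ler_pM// invr_ge0 ltW.
Qed.

Lemma score_approx y (sigma2 : R) : 0 < sigma2 ->
  `|\sum_(i < m) (ln (sigma2 / prec_diag m t theta i) +
      prec_app m t theta y i ^+ 2 / (sigma2 * prec_diag m t theta i)) -
    (m%:R * ln (theta * sigma2) - \sum_(i < m) ln (lim_diag m t i) +
     (\sum_(i < m) lim_app m t y i ^+ 2 / lim_diag m t i) / (theta * sigma2))| <=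
  2 * hi * (hi + 1) * r ^+ 2 + score_err hi r m t y / sigma2.
Proof.
move=> s0; rewrite big_split/=.
have -> : \sum_(i < m) prec_app m t theta y i ^+ 2 / (sigma2 * prec_diag m t theta i) =
  (\sum_(i < m) prec_app m t theta y i ^+ 2 / prec_diag m t theta i) / sigma2.
  rewrite mulr_suml; apply: eq_bigr => i _.
  by rewrite invfM mulrCA mulrC.
have hl := sum_log_approx s0; have hs := sum_node_score_approx y.
rewrite invfM mulrA.
rewrite opprD addrACA -mulrBl.
apply: le_trans (ler_normD _ _) _; apply: lerD => //.
by rewrite normrM normfV (gtr0_norm s0) ler_pM2r ?invr_gt0.
Qed.

End FixedParameter.
End ScoreApproximation.

(** * The Ornstein-Uhlenbeck process *)

Section ProcessSpan.
Context {d : measure_display} {T : measurableType d} {R : realType}.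
Variable P : probability T R.
Variables (D : set R) (Y : R -> {RV P >-> R}).

Definition process_span : set (T -> R) := [set f | exists (k : nat) (t c : 'I_k -> R),
  (forall i, D (t i)) /\ f = (fun w => \sum_(i < k) c i * Y (t i) w)].

Lemma process_span_lin c f g : process_span f -> process_span g ->
  process_span (fun w => f w + c * g w).
Proof.
move=> [k1 [t1 [c1 [D1 ->]]]] [k2 [t2 [c2 [D2 ->]]]].
exists (k1 + k2)%N.
exists (fun i => match fintype.split i with inl i => t1 i | inr i => t2 i end).
exists (fun i => match fintype.split i with inl i => c1 i | inr i => c * c2 i end).
split=> [i|]; first by case: (fintype.split i).
apply/funext => w; rewrite big_split_ord/= mulr_sumr; congr (_ + _); apply: eq_bigr => i _.
  by rewrite (unsplitK (inl i)).
by rewrite (unsplitK (inr i)) mulrA.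
Qed.

Hypotheses (Ygauss : gaussian_process D Y) (Ycentered : centered_on D Y).

Let mY t : measurable_fun setT (Y t : T -> R). Proof. exact: measurable_funP. Qed.

Let EY t : D t -> Ex P (Y t) = 0.
Proof.
by move=> Dt; have := Ycentered Dt; rewrite expectation.unlock /Ex /Rintegral => ->.
Qed.

Lemma allmom_process t : D t -> allmom P (Y t).
Proof.
move=> Dt; have := @Ygauss _ (fun _ : 'I_1 => t) (fun=> 1) (fun=> Dt).
have -> : (fun w => \sum_(i < 1) 1 * Y t w) = Y t :> (T -> R).
  by apply/funext => w; rewrite big_ord1 mul1r.
by move=> h; have [] := gaussian_law_moments (mY t) h (EY Dt).
Qed.

Lemma gaussian_space_process_span : gaussian_space P process_span.
Proof.
split; first by move=> c f g; exact: process_span_lin.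
move=> f [k [t [c [Dt ->]]]].
apply: gaussian_law_moments.
- apply: measurable_sum => i; apply: measurable_funM => //.
- exact: Ygauss.
rewrite Ex_sum => [|i _]; last exact/allmomZ/allmom_process.
by rewrite big1// => i _; rewrite ExZ ?EY ?mulr0//; exact: allmom_process.
Qed.

Lemma Ex_process_mul K t1 t2 : covariance_function_on D Y K -> D t1 -> D t2 ->
  Ex P (fun w => Y t1 w * Y t2 w) = K t1 t2.
Proof.
move=> hK D1 D2; have := hK _ _ D1 D2.
rewrite covariance.unlock (Ycentered D1) (Ycentered D2) expectation.unlock /Ex /Rintegral.
move=> h; rewrite -[RHS]/(fine (K t1 t2)%:E) -h; congr fine; apply: eq_integral => w _ /=.
by change ((Y t1 w * Y t2 w)%:E = ((Y t1 w - 0) * (Y t2 w - 0))%:E); rewrite !subr0.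
Qed.

End ProcessSpan.

(** * Standardized residuals at the true parameter *)

Section OrnsteinUhlenbeck.
Context {d : measure_display} {T : measurableType d} {R : realType}.
Variable P : probability T R.
Variables (D : set R) (Y : R -> {RV P >-> R}) (theta v : R).
Hypotheses (th0 : 0 < theta) (v0 : 0 < v).
Hypotheses (Ygauss : gaussian_process D Y) (Ycentered : centered_on D Y).
Hypothesis Ycov : covariance_function_on D Y
  (fun t1 t2 => v * expR (- theta * `|t1 - t2|)).
Variables (m : nat) (t : nat -> R).
Hypotheses (it : increasing_to m t) (Dt : forall i, (i < m)%N -> D (t i)).

Local Notation q := (prec_diag m t theta).
Local Notation pm := (prec_mx m t theta).
Local Notation obs w := (fun i => Y (t i) w).

Let aY i : (i < m)%N -> allmom P (Y (t i)).
Proof. by move=> im; apply: (allmom_process Ygauss Ycentered); exact: Dt. Qed.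

Let EYY i j : (i < m)%N -> (j < m)%N ->
  Ex P (fun w => Y (t i) w * Y (t j) w) = v * expR (- theta * `|t i - t j|).
Proof. by move=> im jm; rewrite (Ex_process_mul Ycentered Ycov) //; exact: Dt. Qed.

(** The leave-one-out residual [prec_app / q] divided by its standard deviation [sqrt (v / q)]. *)
Definition std_resid (i : 'I_m) (w : T) : R :=
  prec_app m t theta (obs w) i / Num.sqrt (v * q i).

Let prec_appE (i : 'I_m) w :
  prec_app m t theta (obs w) i = \sum_(j < m) pm i j * Y (t j) w.
Proof. by rewrite -prec_mxE. Qed.

Lemma std_resid_span i : process_span D Y (std_resid i).
Proof.
exists m, (fun i => t i), (fun j => pm i j / Num.sqrt (v * q i)).
split=> [j|]; first exact: Dt.
apply/funext => w; rewrite /std_resid prec_appE mulr_suml; apply: eq_bigr => j _.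
by rewrite mulrAC.
Qed.

Let aprec i : (i < m)%N -> allmom P (fun w => prec_app m t theta (obs w) i).
Proof.
move=> im; rewrite (_ : (fun _ => _) = fun w => \sum_(j < m) pm (Ordinal im) j * Y (t j) w).
  by apply: allmom_sum => j _; apply: allmomZ; exact: aY.
by apply/funext => w; rewrite -prec_appE.
Qed.

(** Precision times kernel is the identity: a residual is orthogonal to all observations but its
    own. *)
Let Ex_prec_app_obs (i k : 'I_m) :
  Ex P (fun w => prec_app m t theta (obs w) i * Y (t k) w) = v * (i == k)%:R.
Proof.
under Ex_ext do rewrite prec_appE mulr_suml.
rewrite Ex_sum => [|j _]; last by do 2 ?apply: allmomM; [exact: allmom_cst|exact: aY..].
have -> : (i == k) = (val i == val k) by [].
rewrite -(prec_app_kernel th0 it (ltn_ord i) (ltn_ord k)) -prec_mxE mulr_sumr.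
apply: eq_bigr => j _.
under Ex_ext do rewrite -mulrA.
by rewrite ExZ; [rewrite EYY// mulrCA|apply: allmomM; exact: aY].
Qed.

Let vq_gt0 i : 0 < v * q i.
Proof. by rewrite mulr_gt0// prec_diag_gt0. Qed.

Lemma Ex_std_resid (i j : 'I_m) : Ex P (fun w => std_resid i w * std_resid j w) =
  pm j i / Num.sqrt (q i * q j).
Proof.
have si := vq_gt0 i; have sj := vq_gt0 j.
have h w : std_resid i w * std_resid j w = \sum_(k < m)
    pm j k / (Num.sqrt (v * q i) * Num.sqrt (v * q j)) *
    (prec_app m t theta (obs w) i * Y (t k) w).
  rewrite /std_resid [prec_app m t theta _ j]prec_appE mulf_div mulr_sumr mulr_suml.
  by apply: eq_bigr => k _; ring.
have ax (k : 'I_m) : allmom P (fun w => prec_app m t theta (obs w) i * Y (t k) w).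
  by apply: allmomM; [exact: aprec|exact: aY].
rewrite (Ex_ext _ h) Ex_sum => [|k _]; last exact: allmomZ.
under eq_bigr do rewrite ExZ// Ex_prec_app_obs.
rewrite (bigD1 i)//= eqxx big1 ?addr0 => [|k ki]; last first.
  by rewrite eq_sym (negbTE ki) !mulr0.
rewrite -sqrtrM ?(ltW si)//.
have -> : v * q i * (v * q j) = v ^+ 2 * (q i * q j) by ring.
rewrite sqrtrM ?sqr_ge0// sqrtr_sqr gtr0_norm// mulr1 invfM; field.
by rewrite !gt_eqF// sqrtr_gt0 mulr_gt0// prec_diag_gt0.
Qed.

Lemma Ex_std_resid_sqr i : Ex P (fun w => std_resid i w * std_resid i w) = 1.
Proof.
rewrite Ex_std_resid prec_mx_diag -expr2 sqrtr_sqr gtr0_norm ?prec_diag_gt0//.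
by rewrite divff// gt_eqF// prec_diag_gt0.
Qed.

(** Cauchy-Schwarz, from the second moments of the sum and the difference of two residuals. *)
Lemma Ex_std_resid_le1 i j : `|Ex P (fun w => std_resid i w * std_resid j w)| <= 1.
Proof.
have ae k : allmom P (std_resid k).
  exact: gaussian_space_allmom (gaussian_space_process_span Ygauss Ycentered) _ (std_resid_span k).
have h (c : R) : 0 <= 1 + 2 * c * Ex P (fun w => std_resid i w * std_resid j w) + c ^+ 2.
  have -> : 1 + 2 * c * Ex P (fun w => std_resid i w * std_resid j w) + c ^+ 2 =
    Ex P (fun w => (std_resid i w + c * std_resid j w) * (std_resid i w + c * std_resid j w)).
    under [RHS]Ex_ext => w.
      rewrite (_ : _ * _ = std_resid i w * std_resid i w +
        2 * c * (std_resid i w * std_resid j w) +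
        c ^+ 2 * (std_resid j w * std_resid j w)); last by ring.
      over.
    have aM k l : allmom P (fun w => std_resid k w * std_resid l w) by exact: allmomM.
    rewrite (ExD (allmomD (aM i i) (allmomZ (2 * c) (aM i j))) (allmomZ (c ^+ 2) (aM j j))).
    rewrite (ExD (aM i i) (allmomZ (2 * c) (aM i j))).
    by rewrite (ExZ (2 * c) (aM i j)) (ExZ (c ^+ 2) (aM j j)) !Ex_std_resid_sqr mulr1.
  by apply: Ex_ge0 => w; rewrite -expr2 sqr_ge0.
by have := h 1; have := h (-1); rewrite ler_norml; lra.
Qed.

Lemma Ex_std_resid_far (i j : 'I_m) : i != j -> (i.+1 != j)%N -> (j.+1 != i)%N ->
  Ex P (fun w => std_resid i w * std_resid j w) = 0.
Proof.
move=> ij ij1 ji1; rewrite Ex_std_resid mxE /prec_app.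
have -> : (j : nat) == i = false by apply/negbTE; rewrite eq_sym.
rewrite eq_sym in ij1; rewrite (negbTE ji1) mulr0 mulr0 addr0.
rewrite (_ : csch_gap m t theta j * _ = 0) ?mul0r ?subr0 ?mul0r//.
case: (val j) ij1 => [|k]; first by rewrite /csch_gap mul0r.
by rewrite eqSS => /negbTE /= ->; rewrite mulr0.
Qed.

Lemma Ex_std_resid_row i :
  \sum_j `|Ex P (fun w => std_resid i w * std_resid j w)| <= 3.
Proof.
have pick (k : nat) : \sum_(j < m) (k == j)%:R <= 1 :> R.
  case: (ltnP k m) => km.
    rewrite (bigD1 (Ordinal km))//= eqxx big1 ?addr0// => j.
    by rewrite -val_eqE /= eq_sym => /negbTE ->.
  by rewrite big1 ?ler01// => j _; rewrite gtn_eqF// (leq_trans (ltn_ord j)).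
have pick' : \sum_(j < m) (j.+1 == i)%:R <= 1 :> R.
  apply: le_trans (pick i.-1); apply: ler_sum => j _; rewrite ler_nat.
  by case: eqP => // <-; rewrite eqxx.
apply: (@le_trans _ _ (\sum_(j < m) (((i : nat) == j)%:R + (i.+1 == j)%:R + (j.+1 == i)%:R))).
  apply: ler_sum => j _.
  case: eqP => [ij|/eqP ij].
    by rewrite -addrA ler_wpDr ?addr_ge0// Ex_std_resid_le1.
  case: eqP => [_|/eqP ij1]; first by rewrite add0r ler_wpDr// Ex_std_resid_le1.
  case: eqP => [_|/eqP ji1]; first by rewrite !add0r Ex_std_resid_le1.
  by rewrite Ex_std_resid_far// normr0 !addr0.
rewrite !big_split/=; have := pick i; have := pick i.+1; move: pick'; lra.
Qed.

(* The squared correlation of the residuals at [i.-1] and [i]. *)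
Definition nbr_corr2 i := (csch_gap m t theta i / 2) ^+ 2 / (q i.-1 * q i).

Lemma gamsq_std_resid :
  gamsq P std_resid = m%:R + 2 * \sum_(i < m) nbr_corr2 i.
Proof.
have h0 (i : 'I_m) : Ex P (fun w => std_resid i w * std_resid i w) ^+ 2 = 1.
  by rewrite Ex_std_resid_sqr expr1n.
have h1 (i j : 'I_m) : i.+1 = j ->
    Ex P (fun w => std_resid i w * std_resid j w) ^+ 2 = nbr_corr2 j.
  move=> ij; rewrite Ex_std_resid mxE /prec_app.
  rewrite -ij (gtn_eqF (ltnSn i)) eqxx (gtn_eqF (ltn_trans (ltnSn _) (ltnSn _))).
  rewrite /= !mulr0 addr0 mulr1 sub0r expr_div_n sqrrN sqr_sqrtr//.
  by rewrite mulr_ge0// ltW// prec_diag_gt0.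
have h2 (i j : 'I_m) : Ex P (fun w => std_resid i w * std_resid j w) =
    Ex P (fun w => std_resid j w * std_resid i w).
  by apply: Ex_ext => w; rewrite mulrC.
have pick (i : nat) : (i < m)%N -> \sum_(j < m) (i == j)%:R = 1 :> R.
  move=> im; rewrite (bigD1 (Ordinal im))//= eqxx big1 ?addr0// => j.
  by rewrite -val_eqE /= eq_sym => /negbTE ->.
have pickS (j : 'I_m) : \sum_(i < m) (i.+1 == j)%:R * nbr_corr2 j = nbr_corr2 j.
  rewrite -mulr_suml; case: j => -[|j] jm /=.
    by rewrite /nbr_corr2 /csch_gap mul0r expr0n/= mul0r mulr0.
  under eq_bigr do rewrite eqSS eq_sym.
  by rewrite pick ?mul1r// ltnW.
have h (i j : 'I_m) : Ex P (fun w => std_resid i w * std_resid j w) ^+ 2 =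
    ((i : nat) == j)%:R + (i.+1 == j)%:R * nbr_corr2 j + (j.+1 == i)%:R * nbr_corr2 i.
  case: (ltngtP i j) => ij.
  - rewrite (gtn_eqF (ltnW ij : (i < j.+1)%N)) mul0r addr0 add0r.
    case: eqP => [/h1 ->|/eqP ij1]; first by rewrite mul1r.
    rewrite mul0r Ex_std_resid_far ?expr0n//; first by rewrite -val_eqE /= ltn_eqF.
    by rewrite gtn_eqF// ltnW.
  - rewrite (gtn_eqF (ltnW ij : (j < i.+1)%N)) mul0r addr0 add0r h2.
    case: eqP => [/h1 ->|/eqP ij1]; first by rewrite mul1r.
    rewrite mul0r Ex_std_resid_far ?expr0n//; first by rewrite -val_eqE /= ltn_eqF.
    by rewrite gtn_eqF// ltnW.
  - have -> : i = j by exact/val_inj.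
    by rewrite h0 (gtn_eqF (ltnSn j)) !mul0r !addr0.
rewrite /gamsq; under eq_bigr do under eq_bigr do rewrite h.
under eq_bigr do rewrite !big_split/= pick//.
rewrite !big_split/= sumr_const card_ord exchange_big/=.
under eq_bigr do rewrite pickS.
by ring.
Qed.

Lemma sqsum_std_resid w :
  sqsum std_resid w = (\sum_(i < m) prec_app m t theta (obs w) i ^+ 2 / q i) / v.
Proof.
rewrite /sqsum mulr_suml; apply: eq_bigr => i _.
by rewrite /std_resid expr_div_n sqr_sqrtr ?(ltW (vq_gt0 i))// invfM mulrA mulrAC.
Qed.

Variables (hi r : R).
Hypotheses (m2 : (2 <= m)%N) (hi0 : 0 < hi) (r0 : 0 < r) (r1 : r <= 1).
Hypotheses (gap_le : forall j, gap m t j <= r ^+ 2) (t_range : t m.-1 - t 0%N = 1).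

Let aYX i : (i < m)%N -> allmom P (fun w => Y (t i) w ^+ 2).
Proof. by move=> im; exact/allmomX/aY. Qed.

Let allmom_incr i : allmom P (fun w => incr m (obs w) i).
Proof.
have [/andP[i0 im]|/negbTE i0] := boolP (0 < i < m)%N; last first.
  by have := allmom_cst P 0; congr allmom; apply/funext => w; rewrite /incr i0.
have -> : (fun w => incr m (obs w) i) = fun w => Y (t i) w - Y (t i.-1) w.
  by apply/funext => w; rewrite /incr i0 im.
by apply: allmomB; apply: aY => //; apply: leq_ltn_trans (leq_pred _) im.
Qed.

Let allmom_if (b : bool) i : (b -> (i < m)%N) ->
  allmom P (fun w => if b then Y (t i) w ^+ 2 else 0).
Proof. by case: b => [/(_ isT)/aYX//|_]; exact: allmom_cst. Qed.

Let predP i : (0 < i < m)%N -> (i.-1 < m)%N.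
Proof. by move=> /andP[_]; exact: leq_ltn_trans (leq_pred _). Qed.

Let allmom_nbr i : (i < m)%N -> allmom P (fun w => nbr_sqr m (obs w) i).
Proof.
move=> im; apply: allmomZ; apply: allmomD; last exact: allmom_if.
by apply: allmomD; [exact: aYX|apply: allmom_if; exact: predP].
Qed.

Let allmom_incr_sqr i : allmom P (fun w => incr_sqr m (obs w) i).
Proof. by apply: allmomZ; apply: allmomD; exact: allmomX. Qed.

Lemma allmom_score_err : allmom P (fun w => score_err hi r m t (obs w)).
Proof.
apply: allmom_sum => i _; apply: allmomZ; apply: allmomD; apply: allmomZ.
  exact: allmom_nbr.
exact: allmom_incr_sqr.
Qed.

Let Ex_obs_sqr i : (i < m)%N -> Ex P (fun w => Y (t i) w ^+ 2) = v.
Proof.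
move=> im; under Ex_ext do rewrite expr2.
by rewrite EYY// subrr normr0 mulr0 expR0 mulr1.
Qed.

Let Ex_nbr i : (i < m)%N -> Ex P (fun w => nbr_sqr m (obs w) i) <= 9 * v.
Proof.
have hif (b : bool) j : (b -> (j < m)%N) ->
    Ex P (fun w => if b then Y (t j) w ^+ 2 else 0) <= v.
  by case: b => [/(_ isT) jm|_]; rewrite ?Ex_cst ?Ex_obs_sqr// ltW.
move=> im; rewrite /nbr_sqr.
have a1 := aYX im; have a2 := allmom_if (@predP i).
have a3 := @allmom_if (i.+1 < m)%N i.+1 (fun h => h).
rewrite (ExZ 3 (allmomD (allmomD a1 a2) a3)) (ExD (allmomD a1 a2) a3) (ExD a1 a2).
have h2 := hif (0 < i < m)%N i.-1 (@predP i).
have h3 := hif (i.+1 < m)%N i.+1 (fun h => h).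
by have h1 := Ex_obs_sqr im; lra.
Qed.

Let Ex_incr i : Ex P (fun w => incr m (obs w) i ^+ 2) <= 2 * v * theta * r ^+ 2.
Proof.
have c0 : 0 <= 2 * v * theta * r ^+ 2 by rewrite !mulr_ge0// ltW.
have [im|/negbTE i0] := boolP (0 < i < m)%N; last first.
  by rewrite (Ex_ext P (g := fun=> 0)) ?Ex_cst// => w; rewrite /incr i0 expr0n.
have im1 := predP im; have /andP[i0 i1] := im.
have := gap_le i; rewrite /gap im => g1.
have tt : 0 <= t i - t i.-1.
  by rewrite subr_ge0 (increasing_to_le it)// leq_pred.
under Ex_ext => w.
  rewrite /incr im (_ : _ ^+ 2 = Y (t i) w ^+ 2 + Y (t i.-1) w ^+ 2 -
    2 * (Y (t i) w * Y (t i.-1) w)); last by ring.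
  over.
have aM : allmom P (fun w => Y (t i) w * Y (t i.-1) w) by apply: allmomM; exact: aY.
rewrite (ExB (allmomD (aYX i1) (aYX im1)) (allmomZ 2 aM)) (ExD (aYX i1) (aYX im1)) (ExZ 2 aM).
rewrite EYY// !Ex_obs_sqr// (ger0_norm tt).
have h : theta * (t i - t i.-1) <= theta * r ^+ 2 by rewrite ler_pM2l.
have := expR_ge1Dx (- theta * (t i - t i.-1)).
rewrite -(ler_pM2l v0); move: (expR _) => x hx.
have : v * (theta * (t i - t i.-1)) <= v * (theta * r ^+ 2) by rewrite ler_pM2l.
by move: hx; rewrite mulrDr mulNr mulrN; lra.
Qed.

(** At each node [nbr_sqr] has mean at most [9 v] and [incr_sqr] at most [8 v theta r^2], the latter
    because [1 - e^(-x) <= x]. Each node thus costs a multiple of [r] times its [node_err]. *)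
Lemma Ex_score_err : Ex P (fun w => score_err hi r m t (obs w)) <=
  r * ((hi + 1) * ((1 + 2 * hi * (hi + 1)) * (9 * v) + 16 * (v * theta))).
Proof.
rewrite /score_err Ex_sum => [|i _]; last first.
  by apply: allmomZ; apply: allmomD; apply: allmomZ; [exact: allmom_nbr|exact: allmom_incr_sqr].
rewrite [leRHS]mulrCA -[X in _ <= X * _](sum_node_err _ m2 t_range) mulr_suml.
apply: ler_sum => i _.
have an := allmom_nbr (ltn_ord i); have ai := allmom_incr_sqr i.
have /andP[k0 _] := node_err_bounds it hi0 r0 r1 gap_le i.
rewrite ExZ; last by apply: allmomD; exact: allmomZ.
rewrite ler_wpM2l// (ExD (allmomZ _ an) (allmomZ _ ai)) (ExZ _ an) (ExZ _ ai).
have h1 := Ex_nbr (ltn_ord i).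
have h2 : Ex P (fun w => incr_sqr m (obs w) i) <= 8 * v * theta * r ^+ 2.
  rewrite /incr_sqr.
  have b1 := allmomX 2 (allmom_incr i); have b2 := allmomX 2 (allmom_incr i.+1).
  rewrite (ExZ 2 (allmomD b1 b2)) (ExD b1 b2).
  by have := Ex_incr i; have := Ex_incr i.+1; lra.
have rr : r ^+ 2 <= r by rewrite expr2 ler_piMr// ltW.
have hh : 0 <= 2 * hi * (hi + 1) by rewrite !mulr_ge0// ?addr_ge0// ltW.
have ir : 0 <= r^-1 + 1 by rewrite addr_ge0// invr_ge0 ltW.
have cr : 0 <= r + 2 * hi * (hi + 1) * r ^+ 2.
  by rewrite addr_ge0 ?(ltW r0)// mulr_ge0// sqr_ge0.
apply: le_trans (lerD (ler_wpM2l cr h1) (ler_wpM2l ir h2)) _.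
have -> : (r^-1 + 1) * (8 * v * theta * r ^+ 2) = 8 * (v * theta) * (r + r ^+ 2).
  by field; rewrite gt_eqF.
have vt : 0 <= 8 * (v * theta) by rewrite !mulr_ge0// ltW.
have h3 : 8 * (v * theta) * (r + r ^+ 2) <= 8 * (v * theta) * (r + r) by rewrite ler_wpM2l// lerD2l.
have h4 : (r + 2 * hi * (hi + 1) * r ^+ 2) * (9 * v) <=
    (r + 2 * hi * (hi + 1) * r) * (9 * v).
  rewrite ler_pM2r; last by rewrite mulr_gt0.
  by rewrite lerD2l ler_wpM2l.
apply: le_trans (lerD h4 h3) _.
by rewrite le_eqVlt; apply/orP; left; apply/eqP; ring.
Qed.

End OrnsteinUhlenbeck.

(** * Neighbouring correlations and the variance [tau2] *)

Section NeighbourCorrelation.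
Context {R : realType}.
Implicit Types (x y e : R).

Lemma csch_gt0 x : 0 < x -> 0 < csch x.
Proof. by move=> x0; rewrite /csch divr_gt0 ?expRN2_lt1// mulr_gt0// expR_gt0. Qed.

Lemma csch_le_coth x : 0 < x -> csch x <= coth x.
Proof.
move=> x0; rewrite /csch /coth ler_pM2r ?invr_gt0 ?expRN2_lt1//.
by have := sqr_ge0 (1 - expR (- x)); lra.
Qed.

Lemma csch_ratio_bounds x y : 0 < x -> 0 < y -> 0 <= csch x / (coth x + coth y) <= 1.
Proof.
move=> x0 y0; have c0 : 0 < coth x + coth y by rewrite addr_gt0 ?coth_gt0.
rewrite divr_ge0 ?(ltW c0) ?(ltW (csch_gt0 x0))//= ler_pdivrMr// mul1r.
by rewrite (le_trans (csch_le_coth x0))// lerDl ltW// coth_gt0.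
Qed.

(** The limit is the ratio with [coth] and [csch] replaced by inverses. Each replacement errs by at
    most the argument, and the denominator, at least [1 / e], gains another factor [e]: [e^2] comes
    from the numerator and [2 e^2] from the denominator. *)
Lemma csch_ratio_approx x y e : 0 < x <= e -> 0 < y <= e ->
  `|csch x / (coth x + coth y) - y / (x + y)| <= 3 * e ^+ 2.
Proof.
move=> /andP[x0 xe] /andP[y0 ye].
have e0 : 0 < e := lt_le_trans x0 xe.
have ix : 0 < x^-1 by rewrite invr_gt0.
have iy : 0 < y^-1 by rewrite invr_gt0.
have c0 : 0 < coth x + coth y by rewrite addr_gt0 ?coth_gt0.
have /andP[a1 a2] := coth_bounds x0; have /andP[b1 b2] := coth_bounds y0.
have hc := csch_bounds x0.
have -> : y / (x + y) = x^-1 / (x^-1 + y^-1).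
  by field; rewrite ?gt_eqF// ?addr_gt0.
set S := coth x + coth y in c0 *; set S0 := x^-1 + y^-1.
have S00 : 0 < S0 by rewrite addr_gt0.
have -> : csch x / S - x^-1 / S0 = (csch x - x^-1) / S - (x^-1 / S0) * ((S - S0) / S).
  by field; rewrite !gt_eqF.
have iS : S^-1 <= e.
  rewrite -[leRHS]invrK lef_pV2 ?posrE ?invr_gt0//.
  apply: (@le_trans _ _ x^-1); first by rewrite lef_pV2 ?posrE.
  by rewrite /S; have := coth_gt0 y0; lra.
have iS0 : 0 <= S^-1 by rewrite invr_ge0 ltW.
have h1 : `|(csch x - x^-1) / S| <= e * e.
  by rewrite normrM (ger0_norm iS0) ler_pM// (le_trans hc).
have h2 : 0 <= x^-1 / S0 <= 1.
  rewrite divr_ge0 ?(ltW ix) ?(ltW S00)//= ler_pdivrMr// mul1r /S0 lerDl ltW//.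
have h3 : 0 <= (S - S0) / S <= 2 * e * e.
  rewrite mulr_ge0//=; last by rewrite /S /S0; lra.
  by rewrite ler_pM//; rewrite /S /S0; lra.
have h4 : `|(x^-1 / S0) * ((S - S0) / S)| <= 2 * e * e.
  case/andP: h2 => h2 h2'; case/andP: h3 => h3 h3'.
  move: (x^-1 / S0) ((S - S0) / S) h2 h2' h3 h3' => p p' h2 h2' h3 h3'.
  by rewrite ger0_norm ?mulr_ge0//; apply: le_trans h3'; rewrite ler_piMl.
apply: le_trans (ler_normB _ _) _; apply: le_trans (lerD h1 h4) _.
by rewrite le_eqVlt; apply/orP; left; apply/eqP; ring.
Qed.

Lemma csch_prod_approx x y z e : 0 < x <= e -> 0 < y <= e -> 0 < z <= e ->
  `|(csch y / 2) ^+ 2 / ((coth x + coth y) / 2 * ((coth y + coth z) / 2)) -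
    x / (y + x) * (z / (y + z))| <= 6 * e ^+ 2.
Proof.
move=> xe ye ze; have hu := csch_ratio_approx ye xe; have hv := csch_ratio_approx ye ze.
case/andP: (xe) => x0 _; case/andP: (ye) => y0 _; case/andP: (ze) => z0 _.
have cx := coth_gt0 x0; have cy := coth_gt0 y0; have cz := coth_gt0 z0.
have -> : (csch y / 2) ^+ 2 / ((coth x + coth y) / 2 * ((coth y + coth z) / 2)) =
    csch y / (coth y + coth x) * (csch y / (coth y + coth z)).
  by field; rewrite !gt_eqF ?addr_gt0.
have /andP[v0 v1] := csch_ratio_bounds y0 z0.
have u0 : 0 <= x / (y + x) <= 1.
  rewrite divr_ge0 ?addr_ge0 ?(ltW x0) ?(ltW y0)//= ler_pdivrMr ?addr_gt0//.
  by rewrite mul1r lerDr ltW.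
case/andP: u0 => u0 u1.
move: (csch y / (coth y + coth z)) (csch y / (coth y + coth x)) v0 v1 hu hv.
move: (x / (y + x)) (z / (y + z)) u0 u1 => u' v' u0 u1 v u v0 v1 hu hv.
have -> : u * v - u' * v' = (u - u') * v + u' * (v - v') by ring.
have -> : 6 * e ^+ 2 = 3 * e ^+ 2 * 1 + 1 * (3 * e ^+ 2) by ring.
by rewrite (le_trans (ler_normD _ _))// lerD// normrM ler_pM// ger0_norm.
Qed.

Lemma csch_gap_le_coth m t (theta : R) i : 0 < theta -> increasing_to m t ->
  0 <= csch_gap m t theta i <= coth_gap m t theta i.
Proof.
move=> th0 it; rewrite /csch_gap /coth_gap; case: ifP => im; last by rewrite lexx ler01.
have x0 : 0 < theta * (t i - t i.-1).
  by case: i im => [//|i] /= im; rewrite mulr_gt0// subr_gt0 it.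
by rewrite ltW ?csch_gt0// csch_le_coth.
Qed.

Lemma nbr_corr2_bounds m t (theta : R) i : 0 < theta -> increasing_to m t ->
  0 <= nbr_corr2 theta m t i <= 1.
Proof.
move=> th0 it; have /andP[h0 h1] := csch_gap_le_coth i th0 it.
have q1 := prec_diag_gt0 i.-1 th0 it; have q2 := prec_diag_gt0 i th0 it.
have qq := mulr_gt0 q1 q2.
rewrite /nbr_corr2 divr_ge0 ?sqr_ge0 ?(ltW qq)//= ler_pdivrMr// mul1r expr2.
have hc j := coth_gap_gt0 j th0 it.
case: i h0 h1 q1 q2 qq => [|i] h0 h1 q1 q2 qq.
  by rewrite /csch_gap /= mul0r mul0r ltW.
have a0 : 0 <= csch_gap m t theta i.+1 / 2 by rewrite divr_ge0.
rewrite ler_pM//= /prec_diag; have := hc i; have := hc i.+2; lra.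
Qed.

(** With [m = k + 3], the [k] terms of [tau2] match the correlations of index 2 to [k + 1]. The
    three missing units, the correlations of index 1 and [k + 2] and the ends of the telescoping sum
    account for 8; every matched correlation costs twice [6 e^2]. *)
Lemma tau2_corr m s (theta e : R) : 0 < theta -> (4 <= m)%N -> is_design m s ->
  (forall j, (0 < j < m)%N -> theta * (s j.+1 - s j) <= e) ->
  `|m%:R + 2 * \sum_(i < m) nbr_corr2 theta m (fun i => s i.+1) i - m%:R / 2 * tau2 m s| <=
  8 + 12 * m%:R * e ^+ 2.
Proof.
move=> th0 m4 [_ _ sinc] de.
have it : increasing_to m (fun i => s i.+1) by move=> i im; exact: sinc.
case: m m4 sinc de it => [|[|[|k]]]// _ sinc de it.
set m := k.+3 in sinc de it *.
(* In the notation of the overview, [dd j] is [D_(j+1)], [h j] is [(1 - a_(j+1))^2] and [w j] is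
   [(1 - a_j) a_(j+1)]. *)
pose dd j := s j.+1 - s j.
have d0 j : (0 < j < m)%N -> 0 < dd j by move=> jm; rewrite subr_gt0 sinc.
pose h j := (dd j / (dd j + dd j.+1)) ^+ 2.
pose w j := dd j.-1 / (dd j + dd j.-1) * (dd j.+1 / (dd j + dd j.+1)).
have -> : m%:R / 2 * tau2 m s = k%:R + h 1%N - h k.+1 + 2 * \sum_(i < k) w i.+2.
  rewrite /tau2 mulrA (_ : m%:R / 2 * (2 / m%:R) = 1); last by field; rewrite pnatr_eq0.
  rewrite mul1r -{1}[3%N]add0n big_addn (_ : (m - 3)%N = k); last by rewrite /m !subSS subn0.
  rewrite big_mkord.
  have hk : \sum_(i < k) (h i.+1 - h i.+2) = h 1%N - h k.+1.
    rewrite -[RHS]opprB -(@telescope_sumr _ 0 k (fun i => h i.+1))// -sumrN big_mkord.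
    by apply: eq_bigr => i _; rewrite opprB.
  rewrite -[k%:R + _ - _]addrA -hk mulr_sumr.
  have -> : k%:R = \sum_(i < k) (1 : R) by rewrite sumr_const card_ord.
  rewrite -!big_split/=; apply: eq_bigr => i _.
  have e1 := d0 i.+1; have e2 := d0 i.+2; have e3 := d0 i.+3.
  have {}e1 : 0 < dd i.+1 by apply: e1; rewrite /m /= !ltnS (leq_trans (ltnW (ltn_ord i))).
  have {}e2 : 0 < dd i.+2 by apply: e2; rewrite /m /= !ltnS (leq_trans (ltnW (ltn_ord i))).
  have {}e3 : 0 < dd i.+3 by apply: e3; rewrite /m /= !ltnS (ltn_ord i).
  rewrite !addnS addn0 /spacing /= -/(dd i.+2) -/(dd i.+1) -/(dd i.+3) /h /w /=.
  move: (dd i.+1) (dd i.+2) (dd i.+3) e1 e2 e3 => x y z x0 y0 z0.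
  by field; rewrite !gt_eqF ?addr_gt0.
have nE (i : 'I_k) : `|nbr_corr2 theta m (fun i => s i.+1) i.+2 - w i.+2| <= 6 * e ^+ 2.
  have i1 : (i.+1 < m)%N by rewrite /m ltnS (leq_trans (ltn_ord i)) // ltnW.
  have i2 : (i.+2 < m)%N by rewrite /m !ltnS (ltnW (ltn_ord i)).
  have i3 : (i.+3 < m)%N by rewrite /m !ltnS (ltn_ord i).
  have b j : (0 < j < m)%N -> 0 < theta * dd j <= e.
    by move=> jm; rewrite mulr_gt0 ?d0//= de.
  have := csch_prod_approx (b i.+1 i1) (b i.+2 i2) (b i.+3 i3).
  have e1 := d0 i.+1 i1; have e2 := d0 i.+2 i2; have e3 := d0 i.+3 i3.
  have -> : theta * dd i.+1 / (theta * dd i.+2 + theta * dd i.+1) *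
    (theta * dd i.+3 / (theta * dd i.+2 + theta * dd i.+3)) = w i.+2.
    rewrite /w /=; move: (dd i.+1) (dd i.+2) (dd i.+3) e1 e2 e3 => x y z x0 y0 z0.
    by field; rewrite ?gt_eqF ?addr_gt0// ?mulr_gt0.
  by rewrite /nbr_corr2 /prec_diag /coth_gap /csch_gap /= i1 i2 i3.
have nb j : 0 <= nbr_corr2 theta m (fun i => s i.+1) j <= 1 by exact: nbr_corr2_bounds.
have hb j : (0 < j < m.-1)%N -> 0 <= h j <= 1.
  move=> jm; have a1 : 0 < dd j by apply: d0; case/andP: jm => -> /ltnW.
  have a2 : 0 < dd j.+1 by apply: d0; case/andP: jm.
  rewrite /h sqr_ge0/=; move: (dd j) (dd j.+1) a1 a2 => x y x0 y0.
  rewrite expr_le1//; last by rewrite divr_ge0 ?addr_ge0 ?ltW.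
  by rewrite ler_pdivrMr ?addr_gt0// mul1r lerDl ltW.
pose nc := nbr_corr2 theta m (fun i => s i.+1).
have -> : \sum_(i < m) nbr_corr2 theta m (fun i => s i.+1) i =
    nc 0%N + (nc 1%N + (\sum_(i < k) nc i.+2 + nc k.+2)).
  by rewrite /m big_ord_recl big_ord_recl big_ord_recr.
rewrite /nc.
have n0 : nbr_corr2 theta m (fun i => s i.+1) 0 = 0.
  by rewrite /nbr_corr2 /csch_gap mul0r expr0n/= mul0r.
have ns : `|\sum_(i < k) nbr_corr2 theta m (fun i => s i.+1) i.+2 - \sum_(i < k) w i.+2| <=
    6 * m%:R * e ^+ 2.
  rewrite -sumrB (le_trans (ler_norm_sum _ _ _))//.
  apply: (@le_trans _ _ (\sum_(i < k) (6 * e ^+ 2))); first by apply: ler_sum => i _; exact: nE.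
  rewrite sumr_const card_ord -[_ *+ k]mulr_natl.
  rewrite (_ : k%:R * _ = 6 * k%:R * e ^+ 2); last by ring.
  rewrite ler_wpM2r ?sqr_ge0//.
  by rewrite ler_wpM2l// ler_nat /m ltnW// ltnW.
have /andP[x1 x2] := nb 1%N; have /andP[x3 x4] := nb k.+2.
have /andP[x5 x6] := hb 1%N isT; have /andP[x7 x8] : 0 <= h k.+1 <= 1.
  by apply: hb; rewrite /m /= ltnS.
move: ns; rewrite n0 !ler_norml => /andP[z1 z2].
have -> : m%:R = k%:R + 3 :> R by rewrite /m -addn3 natrD.
move: z1 z2; rewrite {1 2}(_ : m%:R = k%:R + 3 :> R); last by rewrite /m -addn3 natrD.
by move=> z1 z2; apply/andP; split; lra.
Qed.

End NeighbourCorrelation.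

(** * Asymptotics *)

Section MomentRecursion.
Context {R : realType}.

Lemma cvg_moment_recursion (M : nat -> nat -> R) (B : nat -> R) (C : R) (n0 : nat) :
  0 <= C -> (forall k, 0 <= B k) ->
  (forall n, (n0 <= n)%N -> M n 0%N = 1) -> (forall n, (n0 <= n)%N -> M n 1%N = 0) ->
  (forall n k eta, (n0 <= n)%N -> 0 < eta ->
     `|M n k.+2 - k.+1%:R * M n k| <= k.+1%:R * ((eta * B k + C / n%:R / eta) / 2)) ->
  forall k, (fun n => M n k) @ \oo --> (normal_moment k : R).
Proof.
move=> C0 B0 M0 M1 Mrec.
have step k : (fun n => M n k.+2 - k.+1%:R * M n k) @ \oo --> (0 : R).
  apply/cvgrPdist_le => eps eps0.
  (* [eta] is fixed before [n]: it makes the first error term at most [eps], and the term in [1 / n]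
     follows for large [n]. The [+ 1] keeps the denominator positive. *)
  pose eta := eps / (k.+1%:R * (B k + 1)).
  have k0 : 0 < k.+1%:R :> R by rewrite ltr0n.
  have eta0 : 0 < eta by rewrite divr_gt0// mulr_gt0// ltr_wpDl.
  near=> n; rewrite sub0r normrN.
  have n1 : (n0 <= n)%N by near: n; exists n0.
  have hn : k.+1%:R * (C / eta / eps) <= n%:R.
    by near: n; exact: nbhs_infty_ger.
  have np : (0 < n)%N by near: n; exists 1%N.
  have np' : 0 < n%:R :> R by rewrite ltr0n.
  apply: le_trans (Mrec n k eta n1 eta0) _.
  have h1 : k.+1%:R * (eta * B k) <= eps.
    rewrite mulrA (mulrC _ eta) /eta invfM -!mulrA.
    rewrite [X in eps * X](_ : _ = B k / (B k + 1)); last first.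
      by move: (k.+1%:R) k0 => K K0; field; rewrite !gt_eqF// ltr_wpDl.
    by rewrite ler_piMr ?(ltW eps0)// ler_pdivrMr ?ltr_wpDl// mul1r lerDl.
  have h2 : k.+1%:R * (C / n%:R / eta) <= eps.
    have -> : k.+1%:R * (C / n%:R / eta) = (k.+1%:R * (C / eta / eps)) * eps / n%:R.
      by field; rewrite !gt_eqF.
    by rewrite ler_pdivrMr// [eps * _]mulrC ler_pM2r.
  by rewrite mulrA mulrDr; lra.
elim/ltn_ind => -[|[|k]] IH.
- apply: cvg_near_cst; exists n0 => // n /= h; exact: M0.
- apply: cvg_near_cst; exists n0 => // n /= h; exact: M1.
- have -> : (fun n => M n k.+2) = (fun n => (M n k.+2 - k.+1%:R * M n k) + k.+1%:R * M n k).
    by apply/funext => n; rewrite subrK.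
  rewrite [normal_moment _](_ : _ = 0 + k.+1%:R * normal_moment k); last by rewrite add0r.
  by apply: cvgD; [exact: step|apply: cvgMr; exact: IH].
Unshelve. all: by end_near. Qed.

Lemma limn_esup_le_cvg_fin (u : nat -> R) : (forall n, 0 <= u n) ->
  limn_esup (fun n => (u n)%:E) = 0%E -> u @ \oo --> (0 : R).
Proof.
move=> u0 h; have hu : (fun n => (u n)%:E) @ \oo --> 0%E.
  by apply: limn_esup_le_cvg => [|n]; rewrite ?h// lee_fin.
exact: (fine_cvg hu).
Qed.

(** From [ln u <= u - 1] at [u = sqrt t], the left-hand side being [(sqrt t - 1)^2]. The bound is
    global in [t], so no prior consistency of the estimator is involved. *)
Lemma t_sub_ln_ge (t : R) : 0 < t -> (t - 1) ^+ 2 / (Num.sqrt t + 1) ^+ 2 <= t - 1 - ln t.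
Proof.
move=> t0; set u := Num.sqrt t; have u0 : 0 < u by rewrite sqrtr_gt0.
have tE : t = u ^+ 2 by rewrite sqr_sqrtr// ltW.
rewrite [in ln _]tE lnXn// tE.
have -> : (u ^+ 2 - 1) ^+ 2 / (u + 1) ^+ 2 = (u - 1) ^+ 2.
  by field; rewrite gt_eqF// addr_gt0.
have := @le_ln1Dx _ (u - 1); rewrite [1 + _]addrC subrK => h.
have {h} : ln u <= u - 1 by apply: h; lra.
rewrite mulr2n; lra.
Qed.

(** [n0 ln z + n0 G / z] is minimal at [z = G], with excess [n0 (t - 1 - ln t)] for [t = G / z]. *)
Lemma log_ratio_argmin (n0 G z err : R) : 0 < n0 -> 0 < G -> 0 < z ->
  n0 * ln z + n0 * G / z <= n0 * ln G + n0 * G / G + err ->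
  n0 * (G - z) ^+ 2 <= (Num.sqrt G + Num.sqrt z) ^+ 2 * z * err.
Proof.
move=> n00 G0 z0; set g := G / z => h.
have g0 : 0 < g by rewrite divr_gt0.
have lg : ln g = ln G - ln z by rewrite ln_div ?posrE.
have := t_sub_ln_ge g0; rewrite lg => h1.
have h2 : n0 * (g - 1 - (ln G - ln z)) <= err.
  move: h; rewrite -[n0 * G / z]mulrA -/g -[n0 * G / G]mulrA divff ?gt_eqF//; lra.
have := le_trans (ler_wpM2l (ltW n00) h1) h2.
have sG : 0 < Num.sqrt G by rewrite sqrtr_gt0.
have sz : 0 < Num.sqrt z by rewrite sqrtr_gt0.
have -> : n0 * ((g - 1) ^+ 2 / (Num.sqrt g + 1) ^+ 2) =
   n0 * (G - z) ^+ 2 / ((Num.sqrt G + Num.sqrt z) ^+ 2 * z).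
  have -> : Num.sqrt g = Num.sqrt G / Num.sqrt z by rewrite sqrtrM ?(ltW G0)// sqrtrV ?(ltW z0).
  have zE : z = Num.sqrt z ^+ 2 by rewrite sqr_sqrtr// ltW.
  rewrite /g; move: (Num.sqrt z) sz zE => v v0 ->.
  by field; rewrite !gt_eqF ?addr_gt0.
by rewrite ler_pdivrMr ?mulr_gt0 ?exprn_gt0 ?addr_gt0// [err * _]mulrC.
Qed.

End MomentRecursion.

(** * Non-asymptotic bounds for a single design *)

Section FixedDesign.
Context {d : measure_display} {T : measurableType d} {R : realType}.
Variable P : probability T R.
Variables (Y : R -> {RV P >-> R}) (theta0 v : R).
Hypotheses (th0 : 0 < theta0) (v0 : 0 < v).
Hypotheses (Ygauss : gaussian_process `[0, 1]%classic Y)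
  (Ycentered : centered_on `[0, 1]%classic Y).
Hypothesis Ycov : covariance_function_on `[0, 1]%classic Y
  (fun t1 t2 => v * expR (- theta0 * `|t1 - t2|)).
Variables (n : nat) (s : nat -> R) (hi r : R).
Hypotheses (n4 : (4 <= n)%N) (sd : is_design n s) (thi : theta0 <= hi).
Hypotheses (r0 : 0 < r) (r1 : r <= 1).
Hypothesis s_le : forall j, (0 < j < n)%N -> s j.+1 - s j <= r ^+ 2.
Hypothesis n_large : 8 + 12 * n%:R * (theta0 * r ^+ 2) ^+ 2 <= n%:R / 2.

Local Notation t := (fun i => s i.+1).
Local Notation obs w := (fun i => Y (s i.+1) w).

Let it : increasing_to n t.
Proof. by case: sd => _ _ si i im; exact: si. Qed.

Let n2 : (2 <= n)%N. Proof. exact: ltnW (ltnW n4). Qed.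

Let t_range : t n.-1 - t 0%N = 1.
Proof. by case: sd => s1 sn _; rewrite prednK ?sn ?s1 ?subr0// ltnW. Qed.

Let Dt i : (i < n)%N -> `[0, 1]%classic (t i).
Proof.
move=> im; have nn : (n.-1 < n)%N by rewrite prednK// ltnW.
case: sd => s1 sn _; rewrite /= in_itv/=; apply/andP; split.
  by rewrite -s1; apply: (increasing_to_le it (i := 0)).
rewrite -sn -[in leRHS](prednK (ltnW n2)).
by apply: (increasing_to_le it (j := n.-1)); rewrite nn andbT -ltnS prednK// ltnW.
Qed.

Let gap_le j : gap n t j <= r ^+ 2.
Proof.
rewrite /gap; case: ifP => jn; last by rewrite sqr_ge0.
by rewrite /= prednK; [exact: s_le|case/andP: jn].
Qed.

Let hi0 : 0 < hi. Proof. exact: lt_le_trans thi. Qed.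
Let np : 0 < n%:R :> R. Proof. by rewrite ltr0n ltnW. Qed.

Local Notation e := (@std_resid _ _ _ P Y theta0 v n t).

Let Ve i : process_span `[0, 1]%classic Y (e i).
Proof. exact: std_resid_span. Qed.
Let gV := gaussian_space_process_span Ygauss Ycentered.
Let gam1 := Ex_std_resid_sqr th0 v0 Ygauss Ycentered Ycov it Dt.
Let gam_le1 := Ex_std_resid_le1 th0 v0 Ygauss Ycentered Ycov it Dt.
Let gam_row := Ex_std_resid_row th0 v0 Ygauss Ycentered Ycov it Dt.
Local Notation gam := (gamsq P e).

Let gam_gt0 : 0 < gam.
Proof. exact: lt_le_trans np (gamsq_geN gam1). Qed.

Definition fluct_scale : R := (Num.sqrt (2 * gam))^-1.
Definition fluct w : R := chaos e fluct_scale w.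
Definition remainder w : R := score_err hi r n t (obs w).

Let scale2 : 2 * fluct_scale ^+ 2 * gam = 1.
Proof.
rewrite /fluct_scale exprVn sqr_sqrtr ?mulr_ge0 ?(ltW gam_gt0)//.
by field; rewrite gt_eqF.
Qed.

Lemma allmom_fluct : allmom P fluct.
Proof. exact: (allmom_chaos gV Ve). Qed.

Lemma Ex_fluct1 : Ex P (fun w => fluct w ^+ 1) = 0.
Proof. by rewrite (Ex_chaosS gV Ve gam1) mul0r. Qed.

Lemma Ex_fluct_rec k eta : 0 < eta ->
  `|Ex P (fun w => fluct w ^+ k.+2) - k.+1%:R * Ex P (fun w => fluct w ^+ k)| <=
  k.+1%:R * ((eta * chaos_moment_bound k + 54 / n%:R / eta) / 2).
Proof.
move=> eta0; apply: (Ex_chaos_rec gV Ve gam1 gam_le1 gam_row) => //.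
exact: ltnW n2.
Qed.

Lemma Ex_fluct2 : Ex P (fun w => fluct w ^+ 2) <= chaos_moment_bound 1.
Proof. exact: (Ex_chaos_even gV Ve gam1 gam_row (ltnW n2) scale2 1). Qed.

Lemma allmom_remainder : allmom P remainder.
Proof. exact: (allmom_score_err Ygauss Ycentered Dt). Qed.

Lemma remainder_approx w :
  `|v * sqsum e w - (\sum_(i < n) lim_app n t (obs w) i ^+ 2 / lim_diag n t i) / theta0| <=
  remainder w.
Proof.
rewrite (sqsum_std_resid Y th0 v0 it) mulrC divfK ?gt_eqF//.
exact: sum_node_score_approx.
Qed.

Lemma remainder_ge0 w : 0 <= remainder w.
Proof. exact: le_trans (remainder_approx w). Qed.

Lemma Ex_remainder : Ex P remainder <=
  r * ((hi + 1) * ((1 + 2 * hi * (hi + 1)) * (9 * v) + 16 * (v * theta0))).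
Proof. exact: (Ex_score_err th0 v0 Ygauss Ycentered Ycov it Dt n2 hi0 r0 r1 gap_le t_range). Qed.

Let corr : `|gam - n%:R / 2 * tau2 n s| <= 8 + 12 * n%:R * (theta0 * r ^+ 2) ^+ 2.
Proof.
rewrite (gamsq_std_resid th0 v0 Ygauss Ycentered Ycov it Dt).
apply: tau2_corr => // j jn; rewrite ler_pM2l//; exact: s_le.
Qed.

(** The diagonal alone gives [gamsq >= n], and by [n_large] the difference between [gamsq] and
    [n / 2 * tau2] is at most [n / 2]. *)
Lemma tau2_ge1 : 1 <= tau2 n s.
Proof.
have := gamsq_geN gam1; have := corr; rewrite ler_norml => /andP[h1 h2] h3.
have n20 : 0 < n%:R / 2 :> R by rewrite divr_gt0.
rewrite -(ler_pM2l n20); have := n_large; move: h2 h3.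
by move: (gamsq _ _) (tau2 n s) ((theta0 * r ^+ 2) ^+ 2) (n%:R : R) => g u q k; lra.
Qed.

Let tau_ge1 : 1 <= tau n s.
Proof. by rewrite /tau -sqrtr1 ler_wsqrtr// tau2_ge1. Qed.

(** The exact standard deviation of [sqsum] over its asymptotic form [sqrt n * tau]. *)
Let kappa : R := Num.sqrt (2 * gam) / (Num.sqrt n%:R * tau n s).

Let kappa_close : `|kappa - 1| <= 16 / n%:R + 24 * (theta0 * r ^+ 2) ^+ 2.
Proof.
have t2 : 0 < tau2 n s := lt_le_trans ltr01 tau2_ge1.
have k0 : 0 <= kappa by rewrite divr_ge0 ?mulr_ge0 ?sqrtr_ge0.
have k2 : kappa ^+ 2 - 1 = (gam - n%:R / 2 * tau2 n s) / (n%:R / 2 * tau2 n s).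
  rewrite /kappa /tau; move: (tau2 n s) t2 => u u0.
  rewrite expr_div_n exprMn !sqr_sqrtr ?mulr_ge0 ?(ltW gam_gt0) ?(ltW np) ?(ltW u0)//.
  by field; rewrite !gt_eqF.
move: kappa k0 k2 => k k0 k2.
apply: (@le_trans _ _ `|k ^+ 2 - 1|).
  have -> : k ^+ 2 - 1 = (k - 1) * (k + 1) by ring.
  by rewrite normrM ler_peMr// ger0_norm ?lerDr// addr_ge0.
have n20 : 0 < n%:R / 2 * tau2 n s by apply: mulr_gt0 t2; rewrite divr_gt0.
rewrite k2 normrM normfV (gtr0_norm n20) ler_pdivrMr//; apply: le_trans corr _.
set q := (theta0 * r ^+ 2) ^+ 2.
have -> : 8 + 12 * n%:R * q = (16 / n%:R + 24 * q) * (n%:R / 2) by field; rewrite gt_eqF.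
rewrite ler_wpM2l//; last by apply: ler_peMr tau2_ge1; rewrite divr_ge0 ?(ltW np).
by rewrite addr_ge0 ?divr_ge0 ?(ltW np)// mulr_ge0// sqr_ge0.
Qed.

Let x0 := theta0 * v.
Let x00 : 0 < x0. Proof. exact: mulr_gt0. Qed.

(** The unconstrained minimizer of the approximate score [n ln x + n gmean / x]. *)
Let gmean w := (\sum_(i < n) lim_app n t (obs w) i ^+ 2 / lim_diag n t i) / n%:R.

Let sqsumE w : sqsum e w = n%:R + Num.sqrt (2 * gam) * fluct w.
Proof.
rewrite /fluct /chaos /fluct_scale; field.
by rewrite gt_eqF// sqrtr_gt0 mulr_gt0.
Qed.

Let gmean_approx w :
  `|gmean w - x0 - x0 / n%:R * (Num.sqrt (2 * gam) * fluct w)| <=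
  theta0 * remainder w / n%:R.
Proof.
have := remainder_approx w; rewrite sqsumE -/(remainder w).
move=> h; rewrite -(ler_pM2l th0) in h; move: h; rewrite -(ler_pM2r (_ : 0 < n%:R^-1)) ?invr_gt0//.
apply: le_trans; rewrite -[X in _ <= X * _ * _](gtr0_norm th0) -normrM.
rewrite -[X in _ <= _ * X](gtr0_norm (_ : 0 < n%:R^-1)) ?invr_gt0// -normrM -normrN.
rewrite le_eqVlt; apply/orP; left; apply/eqP; congr `| _ |.
by rewrite /gmean /x0; field; rewrite !gt_eqF.
Qed.

(** The conditions on [J] are common to the rectangle and to its slices: bounded parameters,
    variance away from 0, and products filling a neighbourhood of the true one. *)
Variables (J : set (R * R)) (lo zhi eps0 : R).
Hypotheses (lo0 : 0 < lo) (zhi0 : 0 < zhi).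
Hypothesis J_bounds : forall p, J p -> [/\ 0 < p.1, p.1 <= hi, lo <= p.2 & p.1 * p.2 <= zhi].
Hypothesis J_cover : forall g, `|g - x0| < eps0 -> exists2 p, J p & p.1 * p.2 = g.

Let score w (p : R * R) := log_score n s (fun i => Y (s i) w) p.1 p.2.

Let score_close w p : J p ->
  `|score w p - (n%:R * ln (p.1 * p.2) - \sum_(i < n) ln (lim_diag n t i) +
     n%:R * gmean w / (p.1 * p.2))| <= 2 * hi * (hi + 1) * r ^+ 2 + remainder w / lo.
Proof.
move=> /J_bounds[p1 p1hi p2 _]; have p20 : 0 < p.2 := lt_le_trans lo0 p2.
have si i : (1 <= i < n)%N -> s i < s i.+1 by case: sd => _ _; exact.
rewrite /score (log_scoreE p1 si) [n%:R * gmean w]mulrC divfK ?gt_eqF//.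
apply: le_trans (score_approx n2 it hi0 r0 r1 gap_le t_range p1 p1hi (obs w) p20) _.
by rewrite lerD2l ler_wpM2l ?remainder_ge0// lef_pV2 ?posrE.
Qed.

(** The smallness condition puts [gmean] near [x0], hence among the products attained on [J], and
    the scores at [p] and at such a point are compared. The three terms bound the distance from the
    minimizer to [gmean], the linearization of [gmean], and the replacement of the exact variance by
    [tau]. *)
Lemma minimizer_close w p : is_minimizer J (score w) p ->
  theta0 * remainder w / n%:R + 3 * x0 * `|fluct w| / Num.sqrt n%:R < eps0 ->
  `|Num.sqrt n%:R / (x0 * tau n s) * (p.1 * p.2 - x0) - fluct w| <=
  2 * zhi / x0 * Num.sqrt (4 * hi * (hi + 1) * r ^+ 2 + 2 * remainder w / lo) +
  theta0 / x0 * remainder w +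
  `|fluct w| * (16 / n%:R + 24 * (theta0 * r ^+ 2) ^+ 2).
Proof.
move=> [Jp minp] small; have X0 := remainder_ge0 w.
have sn0 : 0 < Num.sqrt n%:R :> R by rewrite sqrtr_gt0.
have snE : Num.sqrt n%:R ^+ 2 = n%:R :> R by rewrite sqr_sqrtr// ltW.
(* [gam <= 3 n], as squared correlations are at most 1, and [6 n <= 9 n]. *)
have gam3 : Num.sqrt (2 * gam) <= 3 * Num.sqrt n%:R.
  have -> : 3 = Num.sqrt (3 ^+ 2) :> R by rewrite sqrtr_sqr ger0_norm.
  rewrite -sqrtrM ?sqr_ge0// ler_wsqrtr//.
  rewrite (gamsq_std_resid th0 v0 Ygauss Ycentered Ycov it Dt).
  have : \sum_(i < n) nbr_corr2 theta0 n t i <= \sum_(i < n) (1 : R).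
    by apply: ler_sum => i _; case/andP: (nbr_corr2_bounds i th0 it).
  rewrite sumr_const card_ord; move: np.
  by move: (\sum_(i < n) _) (n%:R : R) => x y; lra.
have gclose : `|gmean w - x0| < eps0.
  apply: le_lt_trans small.
  have -> : gmean w - x0 = (gmean w - x0 - x0 / n%:R * (Num.sqrt (2 * gam) * fluct w)) +
    x0 / n%:R * (Num.sqrt (2 * gam) * fluct w) by rewrite subrK.
  apply: le_trans (ler_normD _ _) _; apply: lerD; first exact: gmean_approx.
  rewrite normrM (gtr0_norm (divr_gt0 x00 np)) normrM (ger0_norm (sqrtr_ge0 _)).
  rewrite -{1}snE.
  have -> : 3 * x0 * `|fluct w| / Num.sqrt n%:R =
     x0 / Num.sqrt n%:R ^+ 2 * (3 * Num.sqrt n%:R * `|fluct w|).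
    by field; rewrite gt_eqF.
  rewrite ler_wpM2l ?divr_ge0 ?sqr_ge0 ?(ltW x00)//.
  by rewrite ler_wpM2r.
have [p' Jp' p'E] := J_cover gclose.
have [p1 _ p2 pz] := J_bounds Jp; have [p1' _ p2' pz'] := J_bounds Jp'.
have z0 : 0 < p.1 * p.2 by rewrite mulr_gt0// (lt_le_trans lo0).
have g0 : 0 < gmean w by rewrite -p'E mulr_gt0// (lt_le_trans lo0).
(* Twice the bound of [score_close], which is used at [p] and at [p']. *)
set err := 4 * hi * (hi + 1) * r ^+ 2 + 2 * remainder w / lo.
have key : n%:R * (gmean w - p.1 * p.2) ^+ 2 <= 4 * zhi ^+ 2 * err.
  have h1 := score_close w Jp; have h2 := score_close w Jp'; have h3 := minp _ Jp'.
  rewrite p'E in h2 pz'; move: h1 h2; rewrite !ler_norml => /andP[h1 _] /andP[_ h2].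
  have := @log_ratio_argmin _ n%:R (gmean w) (p.1 * p.2) err np g0 z0.
  move=> h; apply: le_trans (h _) _.
    by rewrite /err; rewrite /score in h1 h2 h3 *; lra.
  have e0 : 0 <= err.
    apply: addr_ge0; last by apply: divr_ge0 (ltW lo0); exact: mulr_ge0 X0.
    by rewrite !mulr_ge0 ?addr_ge0 ?(ltW hi0) ?(ltW r0).
  rewrite ler_wpM2r//.
  have : (Num.sqrt (gmean w) + Num.sqrt (p.1 * p.2)) ^+ 2 <= 4 * zhi.
    have -> : 4 * zhi = (Num.sqrt zhi + Num.sqrt zhi) ^+ 2.
      by rewrite -[X in 4 * X](sqr_sqrtr (ltW zhi0)); ring.
    by rewrite lerXn2r ?nnegrE ?addr_ge0 ?sqrtr_ge0// lerD// ler_wsqrtr.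
  by move=> h4; rewrite [zhi ^+ 2]expr2 (mulrA 4); apply: ler_pM => //; exact: ltW.
have hA : `|Num.sqrt n%:R / (x0 * tau n s) * (p.1 * p.2 - gmean w)| <=
    2 * zhi / x0 * Num.sqrt err.
  have tn : 0 < tau n s := lt_le_trans ltr01 tau_ge1.
  have : Num.sqrt n%:R * `|p.1 * p.2 - gmean w| <= 2 * zhi * Num.sqrt err.
    have := ler_wsqrtr key.
    rewrite sqrtrM ?(ltW np)// sqrtr_sqr distrC => h; apply: le_trans h _.
    have -> : 4 * zhi ^+ 2 = (2 * zhi) ^+ 2 by ring.
    by rewrite sqrtrM ?sqr_ge0// sqrtr_sqr ger0_norm// mulr_ge0// ltW.
  move=> h.
  rewrite normrM (ger0_norm (_ : 0 <= Num.sqrt n%:R / (x0 * tau n s))); last first.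
    by rewrite divr_ge0 ?sqrtr_ge0// mulr_ge0// ltW.
  have -> : Num.sqrt n%:R / (x0 * tau n s) * `|p.1 * p.2 - gmean w| =
      (Num.sqrt n%:R * `|p.1 * p.2 - gmean w|) / x0 / tau n s.
    by field; rewrite !gt_eqF.
  rewrite ler_pdivrMr//; apply: (@le_trans _ _ (2 * zhi / x0 * Num.sqrt err)).
    by rewrite [leRHS]mulrAC ler_pM2r ?invr_gt0.
  apply: ler_peMr tau_ge1; apply: mulr_ge0; last exact: sqrtr_ge0.
  by apply: divr_ge0 (ltW x00); rewrite mulr_ge0// ltW.
have hB : `|Num.sqrt n%:R / (x0 * tau n s) *
    (gmean w - x0 - x0 / n%:R * (Num.sqrt (2 * gam) * fluct w))| <= theta0 / x0 * remainder w.
  have tn : 0 < tau n s := lt_le_trans ltr01 tau_ge1.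
  have q0 : 0 < Num.sqrt n%:R / (x0 * tau n s) by rewrite divr_gt0// mulr_gt0.
  rewrite normrM (gtr0_norm q0).
  apply: le_trans (ler_wpM2l (ltW q0) (gmean_approx w)) _.
  rewrite -{2}snE.
  have -> : Num.sqrt n%:R / (x0 * tau n s) * (theta0 * remainder w / Num.sqrt n%:R ^+ 2) =
      theta0 / x0 * remainder w / (tau n s * Num.sqrt n%:R) by field; rewrite !gt_eqF.
  rewrite ler_pdivrMr ?mulr_gt0// ler_peMr//.
    by rewrite mulr_ge0// divr_ge0// ltW.
  apply: mulr_ege1 tau_ge1 _.
  by rewrite -[leLHS]sqrtr1 ler_wsqrtr// ler1n ltnW.
have hC : `|fluct w * (kappa - 1)| <=
    `|fluct w| * (16 / n%:R + 24 * (theta0 * r ^+ 2) ^+ 2).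
  by rewrite normrM ler_wpM2l// kappa_close.
have -> : Num.sqrt n%:R / (x0 * tau n s) * (p.1 * p.2 - x0) - fluct w =
  Num.sqrt n%:R / (x0 * tau n s) * (p.1 * p.2 - gmean w) +
  Num.sqrt n%:R / (x0 * tau n s) *
    (gmean w - x0 - x0 / n%:R * (Num.sqrt (2 * gam) * fluct w)) + fluct w * (kappa - 1).
  have tn : 0 < tau n s := lt_le_trans ltr01 tau_ge1.
  rewrite /kappa; move: (Num.sqrt n%:R) sn0 snE => q q0 <-.
  by field; rewrite !gt_eqF.
apply: le_trans (ler_normD _ _) _; apply: lerD => //.
by apply: le_trans (ler_normD _ _) _; apply: lerD.
Qed.

End FixedDesign.

Section FillDistance.
Context {R : realType}.
Implicit Types (n : nat) (s : nat -> R).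

Lemma spacing_le_max n s i : (2 <= i < n.+1)%N -> spacing s i <= max_spacing n s.
Proof. by move=> im; apply: le_bigmax_seq => //; rewrite mem_index_iota. Qed.

Lemma max_spacing_ge0 n s : 0 <= max_spacing n s.
Proof. exact: bigmax_ge_id. Qed.

Lemma max_spacing_gt0 n s : (2 <= n)%N -> is_design n s -> 0 < max_spacing n s.
Proof.
move=> n2 [_ _ si]; have h : spacing s 2 <= max_spacing n s.
  by apply: spacing_le_max; rewrite /= ltnS.
apply: lt_le_trans h; by rewrite /spacing /= subr_gt0 si.
Qed.

Lemma cvg_sqrt_max_spacing (s : nat -> nat -> R) :
  limn_esup (fun n => (max_spacing n (s n))%:E) = 0%E ->
  (fun n => Num.sqrt (max_spacing n (s n))) @ \oo --> (0 : R).
Proof.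
move=> h; have := limn_esup_le_cvg_fin (fun n => max_spacing_ge0 n (s n)) h.
by move=> /(continuous_cvg _ (@sqrt_continuous R 0)); rewrite sqrtr0.
Qed.

Lemma chaos_moment_bound_ge0 k : 0 <= chaos_moment_bound k :> R.
Proof.
rewrite /chaos_moment_bound !mulr_ge0 ?exprn_ge0//.
by apply: prodr_ge0 => j _; rewrite addr_ge0 ?mulr_ge0.
Qed.

Lemma measurable_superlevel (d : measure_display) (T : measurableType d) (f : T -> R) c :
  measurable_fun setT f -> measurable [set w | c <= f w] /\ measurable [set w | c < f w].
Proof.
move=> mf; split; rewrite -[X in measurable X]setTI.
  have := mf measurableT _ (measurable_itv `[c, +oo[).
  by congr measurable; apply/seteqP; split => w /=; rewrite in_itv/= andbT.
have := mf measurableT _ (measurable_itv `]c, +oo[).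
by congr measurable; apply/seteqP; split => w /=; rewrite in_itv/= andbT.
Qed.

End FillDistance.

(** * The limit law of the product of the parameters *)

Section ProductEstimator.
Context {d : measure_display} {T : measurableType d} {R : realType}.
Variable P : probability T R.
Variables (Y : R -> {RV P >-> R}) (theta0 v : R) (s : nat -> nat -> R).
Hypotheses (th0 : 0 < theta0) (v0 : 0 < v).
Hypotheses (Ygauss : gaussian_process `[0, 1]%classic Y)
  (Ycentered : centered_on `[0, 1]%classic Y).
Hypothesis Ycov : covariance_function_on `[0, 1]%classic Y
  (fun t1 t2 => v * expR (- theta0 * `|t1 - t2|)).
Hypothesis sd : forall n, (2 <= n)%N -> is_design n (s n).
Hypothesis sfill : limn_esup (fun n => (max_spacing n (s n))%:E) = 0%E.
Let x0 := theta0 * v.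
Let x00 : 0 < x0. Proof. exact: mulr_gt0. Qed.

Variables (J : set (R * R)) (hi lo zhi eps0 : R).
Hypotheses (thi : theta0 <= hi) (lo0 : 0 < lo) (zhi0 : 0 < zhi) (eps00 : 0 < eps0).
Hypothesis J_bounds : forall p, J p -> [/\ 0 < p.1, p.1 <= hi, lo <= p.2 & p.1 * p.2 <= zhi].
Hypothesis J_cover : forall g, `|g - x0| < eps0 -> exists2 p, J p & p.1 * p.2 = g.
Variable zh : nat -> T -> R.
Hypothesis mzh : forall n, measurable_fun setT (zh n).
Hypothesis min_zh : forall n w, (2 <= n)%N -> exists2 p,
  is_minimizer J (fun p => log_score n (s n) (fun i => Y (s n i) w) p.1 p.2) p &
  zh n w = p.1 * p.2.

Let r n := Num.sqrt (max_spacing n (s n)).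
(** The bounds for a single design start at four points; below, the value 0 keeps all moments
    finite. *)
Let X n : T -> R := if (4 <= n)%N then fluct Y theta0 v n (s n) else fun=> 0.
Let Z n w : R := Num.sqrt n%:R / (x0 * tau n (s n)) * (zh n w - x0).

Let sd4 n : (4 <= n)%N -> is_design n (s n).
Proof. by move=> n4; apply: sd; apply: leq_trans n4. Qed.

Let aX n : allmom P (X n).
Proof.
rewrite /X; case: ifP => n4; last exact: allmom_cst.
by apply: allmom_fluct => //; exact: sd4.
Qed.

Let cX k : (fun n => Ex P (fun w => X n w ^+ k)) @ \oo --> (normal_moment k : R).
Proof.
apply: (@cvg_moment_recursion _ (fun n k => Ex P (fun w => X n w ^+ k)) chaos_moment_bound 54 4) => //.
- exact: chaos_moment_bound_ge0.
- by move=> n n4; under Ex_ext do rewrite expr0; exact: Ex_cst.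
- by move=> n n4; rewrite /X n4 (Ex_fluct1 th0 v0 Ygauss Ycentered Ycov)//; exact: sd4.
- move=> n k' eta n4 eta0; rewrite /X n4.
  by apply: (Ex_fluct_rec th0 v0 Ygauss Ycentered Ycov) => //; exact: sd4.
Qed.

Let r_near (c : R) : 0 < c -> \forall n \near \oo, r n <= c.
Proof.
move=> c0; have /cvgrPdist_le /(_ c c0) := cvg_sqrt_max_spacing sfill.
apply: filterS => n; rewrite sub0r normrN; apply: le_trans; exact: ler_norm.
Qed.

Let hi0 : 0 < hi. Proof. exact: lt_le_trans thi. Qed.

Let rem n w : R := remainder Y n (s n) hi (r n) w.
Let C1 := (hi + 1) * ((1 + 2 * hi * (hi + 1)) * (9 * v) + 16 * (v * theta0)).
Let C10 : 0 < C1.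
Proof. by rewrite /C1 !(mulr_gt0, addr_gt0). Qed.

Let r2 n : r n ^+ 2 = max_spacing n (s n).
Proof. by rewrite sqr_sqrtr// max_spacing_ge0. Qed.

Let r_gt0 n : (4 <= n)%N -> 0 < r n.
Proof. move=> n4; rewrite sqrtr_gt0; apply: max_spacing_gt0 (sd4 n4).
exact: leq_trans n4. Qed.

Let s_le n j : (0 < j < n)%N -> s n j.+1 - s n j <= r n ^+ 2.
Proof.
by move=> jn; rewrite r2; apply: (@spacing_le_max _ n (s n) j.+1); rewrite !ltnS.
Qed.

(** Purely deterministic: once remainder and squared fluctuation are below [rho] and [L], each of
    the three terms of [minimizer_close] is at most [eps / 3] for large [n], uniformly in [w]. *)
Let close_near (eps L rho : R) : 0 < eps -> 0 < L -> 0 < rho ->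
  rho <= lo * (eps * x0 / (6 * zhi)) ^+ 2 / 4 -> rho <= eps * x0 / (3 * theta0) ->
  \forall n \near \oo, forall w, rem n w < rho -> X n w ^+ 2 < L ->
    `|Z n w - X n w| <= eps.
Proof.
move=> e0 L0 rho0 rho1 rho2.
(* Chosen so that [2 zhi / x0 * E1 = eps / 3]. Under the square root, [rho1] gives the remainder one
   half of [E1 ^+ 2], and [rA] gives the mesh the other. *)
set E1 := eps * x0 / (6 * zhi) in rho1.
have E10 : 0 < E1 by rewrite divr_gt0 ?mulr_gt0.
have L00 : 0 < Num.sqrt L by rewrite sqrtr_gt0.
pose a := eps / 3 / Num.sqrt L / 2.
have a0 : 0 < a by rewrite !divr_gt0.
have cA : 0 < 8 * hi * (hi + 1) by rewrite !mulr_gt0 ?addr_gt0.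
have cB : 0 < 48 * theta0 ^+ 2 by rewrite mulr_gt0 ?exprn_gt0.
near=> n => w remw Xw.
have n4 : (4 <= n)%N by near: n; exists 4%N.
have np : 0 < n%:R :> R by rewrite ltr0n (leq_trans _ n4).
(* With [rB], this yields the two quarters of [n] that make up [n_large]. *)
have n32 : 32 <= n%:R :> R by near: n; exact: nbhs_infty_ger.
have na : 16 / a <= n%:R by near: n; exact: nbhs_infty_ger.
(* Brings [gmean] within [eps0] of [x0], as [minimizer_close] demands. *)
have nK : ((theta0 * rho + 3 * x0 * Num.sqrt L) / eps0) ^+ 2 < n%:R.
  by near: n; exact: nbhs_infty_gtr.
have r1 : r n <= 1 by near: n; exact: r_near.
have rA : r n <= E1 ^+ 2 / (8 * hi * (hi + 1)).
  by near: n; apply: r_near; rewrite divr_gt0 ?exprn_gt0.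
have rB : r n <= (48 * theta0 ^+ 2)^-1 by near: n; apply: r_near; rewrite invr_gt0.
have rC : r n <= a / (24 * theta0 ^+ 2).
  by near: n; apply: r_near; apply: divr_gt0 => //; rewrite mulr_gt0 ?exprn_gt0.
have r0 := r_gt0 n4.
have rr : r n ^+ 2 <= r n by rewrite expr2 ler_piMr// ltW.
have r4 : (theta0 * r n ^+ 2) ^+ 2 <= theta0 ^+ 2 * r n.
  rewrite exprMn ler_wpM2l ?sqr_ge0// expr2 (le_trans _ rr)// ler_piMr ?sqr_ge0//.
  by rewrite (le_trans rr).
have large : 8 + 12 * n%:R * (theta0 * r n ^+ 2) ^+ 2 <= n%:R / 2.
  have h : 12 * n%:R * (theta0 * r n ^+ 2) ^+ 2 <= n%:R / 4.
    apply: (@le_trans _ _ (12 * n%:R * (theta0 ^+ 2 * (48 * theta0 ^+ 2)^-1))).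
      by rewrite ler_wpM2l ?mulr_ge0// (le_trans r4)// ler_wpM2l ?sqr_ge0.
    by rewrite le_eqVlt; apply/orP; left; apply/eqP; field; rewrite gt_eqF.
  have -> : n%:R / 2 = n%:R / 4 + n%:R / 4 :> R by field.
  apply: lerD => //; rewrite ler_pdivlMr//; apply: le_trans n32.
  by rewrite le_eqVlt; apply/orP; left; apply/eqP; ring.
have [p minp zE] := min_zh w (leq_trans (isT : 2 <= 4)%N n4).
have X1 : `|X n w| <= Num.sqrt L by rewrite -sqrtr_sqr ler_wsqrtr// ltW.
have rem0 : 0 <= rem n w by exact: (remainder_ge0 Y th0 v0 n4 (sd4 n4) thi r0 r1 (@s_le n)).
move: Xw X1; rewrite /Z /X n4 => Xw X1.
have sn : (theta0 * rho + 3 * x0 * Num.sqrt L) / eps0 < Num.sqrt n%:R.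
  rewrite -[ltLHS]ger0_norm; last first.
    by rewrite divr_ge0 ?addr_ge0 ?mulr_ge0 ?sqrtr_ge0 ?(ltW th0) ?(ltW rho0) ?(ltW v0) ?(ltW eps00).
  by rewrite -sqrtr_sqr ltr_sqrt.
have sn0 : 0 < Num.sqrt n%:R :> R by rewrite sqrtr_gt0.
have sn1 : Num.sqrt n%:R <= n%:R :> R.
  rewrite -[leRHS](sqr_sqrtr (ltW np)) expr2 ler_peMr ?(ltW sn0)//.
  by rewrite -[leLHS]sqrtr1 ler_wsqrtr// ler1n (leq_trans _ n4).
have small : theta0 * rem n w / n%:R + 3 * x0 * `|fluct Y theta0 v n (s n) w| / Num.sqrt n%:R < eps0.
  apply: (@le_lt_trans _ _ ((theta0 * rho + 3 * x0 * Num.sqrt L) / Num.sqrt n%:R)).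
    rewrite [leRHS]mulrDl; apply: lerD.
      rewrite ler_pM ?invr_ge0 ?mulr_ge0 ?(ltW th0) ?(ltW np)//.
        by rewrite ler_pM2l// ltW.
      by rewrite lef_pV2 ?posrE.
    by rewrite ler_pM2r ?invr_gt0// ler_pM2l// mulr_gt0.
  by rewrite ltr_pdivrMr// [eps0 * _]mulrC -ltr_pdivrMr.
have := minimizer_close th0 v0 Ygauss Ycentered Ycov n4 (sd4 n4) thi r0 r1 (@s_le n) large
  lo0 zhi0 J_bounds J_cover minp small.
rewrite -zE; move=> h; apply: le_trans h _.
have hA : 2 * zhi / x0 * Num.sqrt (4 * hi * (hi + 1) * r n ^+ 2 + 2 * rem n w / lo) <= eps / 3.
  have : Num.sqrt (4 * hi * (hi + 1) * r n ^+ 2 + 2 * rem n w / lo) <= E1.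
    rewrite -[leRHS]gtr0_norm// -sqrtr_sqr ler_wsqrtr//.
    have h1 : 4 * hi * (hi + 1) * r n ^+ 2 <= E1 ^+ 2 / 2.
      apply: (@le_trans _ _ (4 * hi * (hi + 1) * (E1 ^+ 2 / (8 * hi * (hi + 1))))).
        by rewrite ler_wpM2l ?(le_trans rr)// !mulr_ge0 ?addr_ge0 ?(ltW hi0).
      by rewrite le_eqVlt; apply/orP; left; apply/eqP; field; rewrite !gt_eqF ?addr_gt0.
    have h2 : 2 * rem n w / lo <= E1 ^+ 2 / 2.
      rewrite ler_pdivrMr//.
      apply: le_trans (ler_wpM2l (ler0n _ 2) (le_trans (ltW remw) rho1)) _.
      by rewrite le_eqVlt; apply/orP; left; apply/eqP; field.
    have -> : E1 ^+ 2 = E1 ^+ 2 / 2 + E1 ^+ 2 / 2 by field.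
    exact: lerD.
  move=> h; apply: (@le_trans _ _ (2 * zhi / x0 * E1)).
    by apply: ler_wpM2l h; apply: divr_ge0 (ltW x00); rewrite mulr_ge0// ltW.
  by rewrite le_eqVlt /E1; apply/orP; left; apply/eqP; field; rewrite !gt_eqF.
have hB : theta0 / x0 * rem n w <= eps / 3.
  apply: (@le_trans _ _ (theta0 / x0 * (eps * x0 / (3 * theta0)))).
    by apply: ler_wpM2l (le_trans (ltW remw) rho2); apply: divr_ge0 (ltW x00); exact: ltW.
  by rewrite le_eqVlt; apply/orP; left; apply/eqP; field; rewrite !gt_eqF.
have hC : `|fluct Y theta0 v n (s n) w| * (16 / n%:R + 24 * (theta0 * r n ^+ 2) ^+ 2) <= eps / 3.
  apply: (@le_trans _ _ (Num.sqrt L * (a + a))).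
    apply: ler_pM => //.
      by apply: addr_ge0; [apply: divr_ge0 (ltW np)|apply: mulr_ge0 (sqr_ge0 _)].
    apply: lerD; first by rewrite ler_pdivrMr// [a * _]mulrC -ler_pdivrMr.
    apply: (@le_trans _ _ (24 * (theta0 ^+ 2 * (a / (24 * theta0 ^+ 2))))).
      by rewrite ler_wpM2l// (le_trans r4)// ler_wpM2l ?sqr_ge0.
    by rewrite le_eqVlt; apply/orP; left; apply/eqP; field; rewrite !gt_eqF.
  by rewrite le_eqVlt /a; apply/orP; left; apply/eqP; field; rewrite gt_eqF.
have -> : eps = eps / 3 + eps / 3 + eps / 3 by field.
by rewrite lerD// lerD.
Unshelve. all: by end_near. Qed.

Let mZ n : measurable_fun setT (Z n).
Proof. by apply: measurable_funM => //; apply: measurable_funB. Qed.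

(** Markov's inequality bounds by [eta / 2] each way of leaving the event of [close_near]: [L]
    depends on [eta] only, through the uniform second moment of the fluctuation, and the mean of the
    remainder is a multiple of [r n]. *)
Let close_prob (eps eta : R) : 0 < eps -> 0 < eta ->
  \forall n \near \oo, fine (P [set w | eps < `|Z n w - X n w|]) <= eta.
Proof.
move=> e0 eta0.
pose B1 : R := chaos_moment_bound 1 + 1.
have B10 : 0 < B1 by rewrite ltr_wpDl// chaos_moment_bound_ge0.
pose L := 2 / eta * B1.
have L0 : 0 < L by rewrite mulr_gt0 ?divr_gt0.
pose rho := Num.min (lo * (eps * x0 / (6 * zhi)) ^+ 2 / 4) (eps * x0 / (3 * theta0)).
have rho0 : 0 < rho.
  by rewrite lt_min !(mulr_gt0, divr_gt0, exprn_gt0, invr_gt0).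
have rho1 : rho <= lo * (eps * x0 / (6 * zhi)) ^+ 2 / 4 by rewrite ge_min lexx.
have rho2 : rho <= eps * x0 / (3 * theta0) by rewrite ge_min lexx orbT.
have hclose := @close_near eps L rho e0 L0 rho0 rho1 rho2.
near=> n.
have n4 : (4 <= n)%N by near: n; exists 4%N.
have hn : forall w, rem n w < rho -> X n w ^+ 2 < L -> `|Z n w - X n w| <= eps.
  by near: n.
have r1 : r n <= 1 by near: n; exact: r_near.
have rD : r n <= eta / 2 * rho / C1.
  near: n; apply: r_near; apply: divr_gt0 C10; apply: mulr_gt0 rho0; exact: divr_gt0.
have r0 := r_gt0 n4.
have arem : allmom P (rem n) by apply: allmom_remainder => //; exact: sd4.
have aX2 : allmom P (fun w => X n w ^+ 2) by exact: allmomX.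
have mA : measurable [set w | rho <= rem n w].
  exact: (measurable_superlevel rho (allmom_meas arem)).1.
have mB : measurable [set w | L <= X n w ^+ 2].
  exact: (measurable_superlevel L (allmom_meas aX2)).1.
have mE : measurable [set w | eps < `|Z n w - X n w|].
  apply: (measurable_superlevel (f := fun w => `|Z n w - X n w|) eps _).2.
  apply: measurableT_comp => //; apply: measurable_funB => //.
  exact: allmom_meas (aX n).
have pA : (P [set w | (rho <= rem n w)%R] <= (eta / 2)%:E)%E.
  apply: le_trans (markov_Ex (allmom_meas arem) (allmom_int arem) _ rho0) _.
    by move=> w; exact: (remainder_ge0 Y th0 v0 n4 (sd4 n4) thi r0 r1 (@s_le n)).
  rewrite lee_fin ler_pdivrMr//.
  apply: le_trans (Ex_remainder th0 v0 Ygauss Ycentered Ycov n4 (sd4 n4) thi r0 r1 (@s_le n)) _.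
  by rewrite -ler_pdivlMr.
have pB : (P [set w | (L <= X n w ^+ 2)%R] <= (eta / 2)%:E)%E.
  apply: le_trans (markov_Ex (allmom_meas aX2) (allmom_int aX2) _ L0) _.
    by move=> w; exact: sqr_ge0.
  rewrite lee_fin ler_pdivrMr// /L.
  apply: (@le_trans _ _ B1); last by rewrite le_eqVlt; apply/orP; left; apply/eqP; field; rewrite gt_eqF.
  rewrite /X n4 /B1; apply: le_trans (Ex_fluct2 th0 v0 Ygauss Ycentered Ycov n4 (sd4 n4)) _.
  by rewrite lerDl.
rewrite -lee_fin fineK ?fin_num_measure//.
have -> : eta = eta / 2 + eta / 2 by field.
rewrite EFinD; apply: le_trans (leeD pA pB).
apply: (@le_trans _ _ (P ([set w | rho <= rem n w] `|` [set w | L <= X n w ^+ 2]))); last exact: measureU2.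
apply: le_measure; rewrite ?inE//; first exact: measurableU.
move=> w /= h; have [h1|h1] := leP rho (rem n w); [by left|right].
by rewrite leNgt; apply/negP => h2; move: h; rewrite ltNge hn.
Unshelve. all: by end_near. Qed.

Theorem product_estimator_cvg : cvg_in_distribution P
  (fun n w => Num.sqrt n%:R / (theta0 * v * tau n (s n)) * (zh n w - theta0 * v))
  (normal_prob 0 1).
Proof. exact: (cvg_in_distribution_moments aX cX mZ close_prob). Qed.

End ProductEstimator.

(** * The three estimators as minimizers over a rectangle and two slices *)

Theorem theorem4p1 (R : realType) (d : measure_display) (T : measurableType d)
  (P : probability T R) (Y : R -> {RV P >-> R}) (theta0 sigma02 : R)
  (s : nat -> nat -> R) (a A b B : R)
  (htheta0 : 0 < theta0) (hsigma02 : 0 < sigma02)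
  (Ygauss : gaussian_process `[0, 1]%classic Y)
  (Ycentered : centered_on `[0, 1]%classic Y)
  (Ycov : covariance_function_on `[0, 1]%classic Y
            (fun t1 t2 => sigma02 * expR (- theta0 * `|t1 - t2|)))
  (sdesign : forall n, (2 <= n)%N -> is_design n (s n))
  (sfill : limn_esup (fun n => (max_spacing n (s n))%:E) = 0%E)
  (ha : 0 < a) (haA : a <= A) (hb : 0 < b) (hbB : b <= B)
  (hJ : exists thetat sigmat2 : R,
     (`[a, A]%classic `*` `[b, B]%classic) (thetat, sigmat2) /\
     thetat * sigmat2 = theta0 * sigma02)
  (hcase : (a * B < theta0 * sigma02 /\ theta0 * sigma02 < A * b) \/
           (theta0 * sigma02 < a * B /\ A * b < theta0 * sigma02)) :
  (forall thetah sigmah2 : nat -> {RV P >-> R},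
     (forall n w, (2 <= n)%N ->
        is_minimizer (`[a, A]%classic `*` `[b, B]%classic)
          (fun p : R * R =>
             log_score n (s n) (fun i => Y (s n i) w) p.1 p.2)
          (thetah n w, sigmah2 n w)) ->
     cvg_in_distribution P
       (fun n w => Num.sqrt n%:R / (theta0 * sigma02 * tau n (s n))
                   * (thetah n w * sigmah2 n w - theta0 * sigma02))
       (normal_prob 0 1)) /\
  (forall sigma12 : R, 0 < sigma12 ->
     let theta1 := sigma02 * theta0 / sigma12 in
     a < theta1 < A ->
     forall thetah1 : nat -> {RV P >-> R},
     (forall n w, (2 <= n)%N ->
        is_minimizer `[a, A]%classic (fun theta =>
             log_score n (s n) (fun i => Y (s n i) w) theta sigma12)
          (thetah1 n w)) ->
     cvg_in_distribution P
       (fun n w => Num.sqrt n%:R / (theta1 * tau n (s n))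
                   * (thetah1 n w - theta1))
       (normal_prob 0 1)) /\
  (forall theta2 : R, 0 < theta2 ->
     let sigma22 := sigma02 * theta0 / theta2 in
     b < sigma22 < B ->
     forall sigmah22 : nat -> {RV P >-> R},
     (forall n w, (2 <= n)%N ->
        is_minimizer `[b, B]%classic (fun sigma2 =>
             log_score n (s n) (fun i => Y (s n i) w) theta2 sigma2)
          (sigmah22 n w)) ->
     cvg_in_distribution P
       (fun n w => Num.sqrt n%:R / (sigma22 * tau n (s n))
                   * (sigmah22 n w - sigma22))
       (normal_prob 0 1)).
Proof.
have x00 : 0 < theta0 * sigma02 by exact: mulr_gt0.
have A0 : 0 < A := lt_le_trans ha haA; have B0 : 0 < B := lt_le_trans hb hbB.
have close (g x lo hi : R) : `|g - x| < Num.min (x - lo) (hi - x) -> lo < g < hi.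
  by rewrite lt_min !ltr_norml => /andP[/andP[h1 h2] /andP[h3 h4]]; apply/andP; split; lra.
split; [|split].
- move=> thetah sigmah2 hmin.
  (* Either case puts the true product strictly between the extreme products on [J]. *)
  have [abx xAB] : a * b < theta0 * sigma02 /\ theta0 * sigma02 < A * B.
    have h1 : a * b <= a * B by rewrite ler_pM2l.
    have h2 : a * b <= A * b by rewrite ler_pM2r.
    have h3 : A * b <= A * B by rewrite ler_pM2l.
    have h4 : a * B <= A * B by rewrite ler_pM2r.
    by case: hcase => -[h5 h6]; split; lra.
  (* [hi = A + theta0] dominates [theta0] as well, which need not lie in [[a, A]]. *)
  apply: (@product_estimator_cvg _ _ _ P Y theta0 sigma02 s htheta0 hsigma02 Ygauss
    Ycentered Ycov sdesign sfill (`[a, A]%classic `*` `[b, B]%classic) (A + theta0) b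
    (A * B) (Num.min (theta0 * sigma02 - a * b) (A * B - theta0 * sigma02)) _ hb _ _ _ _
    (fun n w => thetah n w * sigmah2 n w)).
  + by rewrite lerDr ltW.
  + exact: mulr_gt0.
  + by rewrite lt_min !subr_gt0 abx.
  + move=> [p q] [] /=; rewrite !in_itv/= => /andP[ap pA] /andP[bq qB].
    have p0 := lt_le_trans ha ap; have q0 := lt_le_trans hb bq.
    by split => //; [rewrite (le_trans pA)// lerDl ltW|rewrite ler_pM// ltW].
  (* Products are attained along two edges of the rectangle: variance [b] up to [A * b], then
     [theta = A]. *)
  + move=> g /close/andP[abg gAB]; have [gAb|gAb] := leP g (A * b).
      exists (g / b, b); last by rewrite /= divfK// gt_eqF.
      split; rewrite /= in_itv/= ?lexx ?hbB//.
      by rewrite ler_pdivlMr// ler_pdivrMr// (ltW abg).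
    exists (A, g / A); last by rewrite /= mulrC divfK// gt_eqF.
    split; rewrite /= in_itv/= ?lexx ?haA//.
    by rewrite ler_pdivlMr// ler_pdivrMr// [b * A]mulrC [B * A]mulrC !ltW.
  + by move=> n; apply: measurable_funM; exact: measurable_funP.
  + by move=> n w n2; exists (thetah n w, sigmah2 n w) => //; exact: hmin.
- move=> sigma12 s0 /= /andP[a1 A1] thetah1 hmin.
  (* Multiplying numerator and denominator by [sigma12] turns the statement into one on the
     product. *)
  have -> : (fun n w => Num.sqrt n%:R / (sigma02 * theta0 / sigma12 * tau n (s n)) *
      (thetah1 n w - sigma02 * theta0 / sigma12)) = fun n w =>
      Num.sqrt n%:R / (theta0 * sigma02 * tau n (s n)) *
      (thetah1 n w * sigma12 - theta0 * sigma02).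
    apply/funext => n; apply/funext => w.
    rewrite !invfM invrK; move: (tau n (s n))^-1 => u.
    by field; rewrite !gt_eqF.
  have ax : a * sigma12 < theta0 * sigma02 by rewrite [ltRHS]mulrC -ltr_pdivlMr.
  have xA : theta0 * sigma02 < A * sigma12 by rewrite [ltLHS]mulrC -ltr_pdivrMr.
  apply: (@product_estimator_cvg _ _ _ P Y theta0 sigma02 s htheta0 hsigma02 Ygauss
    Ycentered Ycov sdesign sfill [set p | a <= p.1 <= A /\ p.2 = sigma12] (A + theta0)
    sigma12 (A * sigma12)
    (Num.min (theta0 * sigma02 - a * sigma12) (A * sigma12 - theta0 * sigma02)) _ s0 _ _ _ _
    (fun n w => thetah1 n w * sigma12)).
  + by rewrite lerDr ltW.
  + exact: mulr_gt0.
  + by rewrite lt_min !subr_gt0 ax.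
  + move=> [p q] /= [/andP[ap pA] ->]; have p0 := lt_le_trans ha ap.
    by split => //; [rewrite (le_trans pA)// lerDl ltW|rewrite ler_pM2r].
  + move=> g /close/andP[ag gA]; exists (g / sigma12, sigma12); last by rewrite /= divfK// gt_eqF.
    by split => //=; rewrite ler_pdivlMr// ler_pdivrMr// !ltW.
  + by move=> n; apply: measurable_funM => //; exact: measurable_funP.
  + move=> n w n2; exists (thetah1 n w, sigma12) => //.
    have [] := hmin n w n2; rewrite /= in_itv/= => h1 h2; split => //.
    by move=> [p q] /= [pA ->]; apply: h2; rewrite /= in_itv.
- move=> theta2 t0 /= /andP[b1 B1] sigmah22 hmin.
  have -> : (fun n w => Num.sqrt n%:R / (sigma02 * theta0 / theta2 * tau n (s n)) *
      (sigmah22 n w - sigma02 * theta0 / theta2)) = fun n w =>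
      Num.sqrt n%:R / (theta0 * sigma02 * tau n (s n)) *
      (theta2 * sigmah22 n w - theta0 * sigma02).
    apply/funext => n; apply/funext => w.
    rewrite !invfM invrK; move: (tau n (s n))^-1 => u.
    by field; rewrite !gt_eqF.
  have bx : theta2 * b < theta0 * sigma02 by rewrite [ltLHS]mulrC [ltRHS]mulrC -ltr_pdivlMr.
  have xB : theta0 * sigma02 < theta2 * B by rewrite [ltLHS]mulrC [ltRHS]mulrC -ltr_pdivrMr.
  apply: (@product_estimator_cvg _ _ _ P Y theta0 sigma02 s htheta0 hsigma02 Ygauss
    Ycentered Ycov sdesign sfill [set p | p.1 = theta2 /\ b <= p.2 <= B] (theta2 + theta0)
    b (theta2 * B)
    (Num.min (theta0 * sigma02 - theta2 * b) (theta2 * B - theta0 * sigma02)) _ hb _ _ _ _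
    (fun n w => theta2 * sigmah22 n w)).
  + by rewrite lerDr ltW.
  + exact: mulr_gt0.
  + by rewrite lt_min !subr_gt0 bx.
  + move=> [p q] /= [-> /andP[bq qB]].
    by split => //; [rewrite lerDl ltW|rewrite ler_pM2l].
  + move=> g /close/andP[bg gB]; exists (theta2, g / theta2); last by rewrite /= mulrC divfK// gt_eqF.
    by split => //=; rewrite ler_pdivlMr// ler_pdivrMr// mulrC [B * _]mulrC !ltW.
  + by move=> n; apply: measurable_funM => //; exact: measurable_funP.
  + move=> n w n2; exists (theta2, sigmah22 n w) => //.
    have [] := hmin n w n2; rewrite /= in_itv/= => h1 h2; split => //.
    by move=> [p q] /= [-> qB]; apply: h2; rewrite /= in_itv.
Qed.
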